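(* Let $n\in\mathbb{N}_0$ and $1\le p<\infty$. There exists a constant $c=c(n,p,B)$ such that, for every $u\in W^{n+1,p}_B\cap C^\infty(\mathbb{R}^{N+1})$, $$\|u-T_nu(\cdot\circ\zeta,\cdot)\|_p\le c\,\|\zeta\|_B^{n+1}\,\|u\|_{W^{n+1,p}_B},\qquad \zeta\in\mathbb{R}^{N+1},$$ where $T_nu(\cdot\circ\zeta,\cdot)$ denotes the function $z\mapsto T_nu(z\circ\zeta,z)$ and $T_nu(\zeta,z)$ is the $n$-th order $B$-Taylor polynomial of $u$ around $\zeta$ evaluated at $z$.
   Context: Setting. Fix integers $1\le d\le N$ and write points of $\mathbb{R}^{N+1}=\mathbb{R}\times\mathbb{R}^N$ as $z=(t,x)$. $B$ is a constant real $N\times N$ matrix for which there are integers $r\ge 0$ and $d=d_0\ge d_1\ge\dots\ge d_r\ge 1$ with $\sum_{j=0}^r d_j=N$ such that, in the corresponding block decomposition (block rows and columns indexed $0,\dots,r$), the only possibly nonzero blocks are $B_1,\dots,B_r$, where $B_j$ is the block in block row $j$ and block column $j-1$, a $d_j\times d_{j-1}$ matrix of rank $d_j$. Put $\bar d_i=\sum_{j=0}^i d_j$, $\bar d_{-1}=0$; $x^{[i]}\in\mathbb{R}^N$ is the vector with the same components as $x$ for indices $\bar d_{i-1}<k\le\bar d_i$ and zero otherwise. Put $\nabla_d=(\partial_{x_1},\dots,\partial_{x_d})$, $Y=\langle Bx,\nabla_x\rangle+\partial_t$, $e^{hY}(t,x)=(t+h,e^{hB}x)$. Group law: $(t,x)\circ(s,\xi)=(t+s,e^{sB}x+\xi)$.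 Homogeneous norm: $\|(t,x)\|_B=|t|^{1/2}+\sum_{i=0}^r|x^{[i]}|^{\frac1{2i+1}}$. Taylor polynomial. For $\beta\in\mathbb{N}_0^N$ let $\langle\beta\rangle_B=\sum_{i=0}^r(2i+1)\sum_{k=1+\bar d_{i-1}}^{\bar d_i}\beta_k$. For $\zeta=(s,\xi)$, $z=(t,x)$, $$T_nu(\zeta,z)=\sum_{0\le2k+\langle\beta\rangle_B\le n}\frac{(t-s)^k(x-e^{(t-s)B}\xi)^\beta}{k!\,\beta!}\,(Y^k\partial_x^\beta u)(s,\xi),$$ the sum being over $k\in\mathbb{N}_0$, $\beta\in\mathbb{N}_0^N$. Sobolev spaces. For $1\le p<\infty$, $\|\cdot\|_p$ is the norm of $L^p(\mathbb{R}^{N+1})$; derivatives are weak derivatives; a quasi-norm of the vector $\nabla_d u$ means the sum of the quasi-norms of its components. Set $$[u]_{Y,\frac12,p}=\Big(\int_{\mathbb{R}^{N+1}}dz\int_{|h|\le 1}\frac{|u(e^{hY}z)-u(z)|^p}{|h|^{\frac p2+1}}dh\Big)^{1/p},$$ $\|u\|_{W^{1,p}_B}=\|u\|_p+\|\nabla_du\|_p+[u]_{Y,\frac12,p}$, $\|u\|_{W^{2,p}_B}=\|u\|_p+\|\nabla_du\|_{W^{1,p}_B}+\|Yu\|_p$, and for $n\ge3$, $\|u\|_{W^{n,p}_B}=\|u\|_p+\|\nabla_du\|_{W^{n-1,p}_B}+\|Yu\|_{W^{n-2,p}_B}$. $W^{n,p}_B$ is the set of $u\in L^p$ with finite quasi-norm.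 *)

(* Defs.v *)
From HB Require Import structures.
From mathcomp Require Import all_boot all_order all_algebra.
From mathcomp Require Import all_classical all_reals all_analysis.

Set Implicit Arguments.
Unset Strict Implicit.
Unset Printing Implicit Defensive.

Import Order.TTheory GRing.Theory Num.Theory.
Import numFieldNormedType.Exports.

Local Open Scope classical_set_scope.
Local Open Scope ring_scope.

Definition measure_cV_display : measure_display.
Proof. exact: (measure_tuple_display default_measure_display). Qed.

Section measurable_cV.
Context (R : realType) (n : nat).

Let coor (i : 'I_n) (x : 'cV[R]_n) : measurableTypeR R := x i ord0.

Let cV_set0 : g_sigma_preimage coor set0.
Proof. exact: sigma_algebra0. Qed.

Let cV_setC A : g_sigma_preimage coor A -> g_sigma_preimage coor (~` A).
Proof. exact: sigma_algebraC. Qed.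

Let cV_bigcup (F : (set _)^nat) : (forall i, g_sigma_preimage coor (F i)) ->
  g_sigma_preimage coor (\bigcup_i (F i)).
Proof. exact: sigma_algebra_bigcup. Qed.

HB.instance Definition _ := @isMeasurable.Build measure_cV_display
  'cV[R]_n (g_sigma_preimage coor) cV_set0 cV_setC cV_bigcup.

End measurable_cV.

Lemma measurable_coord (R : realType) m (i : 'I_m) :
  measurable_fun [set: 'cV[R]_m]
    ((fun x : 'cV[R]_m => x i ord0) : 'cV[R]_m -> measurableTypeR R).
Proof.
move=> _ Y mY; rewrite setTI; apply: sub_sigma_algebra => /=.
rewrite -bigcup_seq/=; exists i => /=; first by rewrite mem_index_enum.
by exists Y => //; rewrite setTI.
Qed.

Lemma measurable_to_cV (R : realType) d (T : measurableType d) m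
    (f : T -> 'cV[R]_m) :
  (forall i, measurable_fun [set: T]
    ((fun t => f t i ord0) : T -> measurableTypeR R)) ->
  measurable_fun [set: T] f.
Proof.
move=> mf; apply: (@measurability _ _ _ _ setT f
  (\big[setU/set0]_(i < m) preimage_set_system setT
     (fun x : 'cV[R]_m => x i ord0 : measurableTypeR R) measurable)).
  by [].
move=> _ [C + <-]; rewrite -bigcup_seq/= => -[i _ [Y mY <-]].
by rewrite [X in _ @^-1` X]setTI; exact: mf.
Qed.

Section cons_measure.
Local Open Scope ereal_scope.
Context (R : realType) (n : nat).
Variable mu : {sigma_finite_measure set 'cV[R]_n -> \bar R}.

Definition cons_cV (p : measurableTypeR R * 'cV[R]_n) : 'cV[R]_n.+1 :=
  \col_i (if unlift ord0 i is Some j then p.2 j ord0 else p.1).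

Definition cons_measure : set 'cV[R]_n.+1 -> \bar R :=
  pushforward (lebesgue_measure \x mu) cons_cV.

Let measurable_cons_cV : measurable_fun setT cons_cV.
Proof.
apply: measurable_to_cV => i; have [j ->|->] := unliftP ord0 i.
  under eq_fun do rewrite mxE liftK.
  apply: (@measurableT_comp _ _ _ _ _ _ (fun x : 'cV[R]_n => x j ord0)) => //.
  exact: measurable_coord.
by under eq_fun do rewrite mxE unlift_none; exact: measurable_fst.
Qed.

Let leb : {sigma_finite_measure set (measurableTypeR R) -> \bar R} :=
  lebesgue_measure.
Let push : {measure set 'cV[R]_n.+1 -> \bar R} :=
  measure_function_pushforward__canonical__measure_function_Measure
    (leb \x mu) measurable_cons_cV.

Let cons_measure0 : cons_measure set0 = 0.
Proof. exact: (measure0 push). Qed.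

Let cons_measure_ge0 A : 0 <= cons_measure A.
Proof. exact: (measure_ge0 push). Qed.

Let cons_measure_sigma_additive : semi_sigma_additive cons_measure.
Proof. exact: (@measure_semi_sigma_additive _ _ _ push). Qed.

HB.instance Definition _ := isMeasure.Build _ _ _ cons_measure
  cons_measure0 cons_measure_ge0 cons_measure_sigma_additive.

Lemma cons_measure_cylinder (A : set R) (F : set 'cV[R]_n) :
  measurable A -> measurable F ->
  cons_measure [set y | A (y ord0 ord0) /\ F (\col_j y (lift ord0 j) ord0)] =
  lebesgue_measure A * mu F.
Proof.
move=> mA mF; rewrite -[RHS](product_measure1E leb mu mA mF).
rewrite /cons_measure /pushforward; congr (_ _).
apply/seteqP; split=> -[t x] /=; rewrite /cons_cV !mxE unlift_none /=.
  move=> [At Fx]; split=> //; congr (F _): Fx.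
  by apply/colP => j; rewrite !mxE liftK.
move=> [At Fx]; split=> //; congr (F _): Fx.
by apply/colP => j; rewrite !mxE liftK.
Qed.

Lemma measurable_cylinder (A : set R) (F : set 'cV[R]_n) :
  measurable A -> measurable F ->
  measurable [set y : 'cV[R]_n.+1 |
    A (y ord0 ord0) /\ F (\col_j y (lift ord0 j) ord0)].
Proof.
move=> mA mF.
have mtail : measurable_fun setT
    (fun y : 'cV[R]_n.+1 => \col_j y (lift ord0 j) ord0 : 'cV[R]_n).
  apply: measurable_to_cV => i; under eq_fun do rewrite mxE.
  exact: measurable_coord.
apply: measurableI; rewrite -[X in measurable X]setTI.
  exact: (@measurable_coord R n.+1 ord0 measurableT A mA).
exact: mtail.
Qed.

Let cons_measure_sigma_finite : sigma_finite setT cons_measure.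
Proof.
have /sigma_finiteP[F [TF ndF Foo]] := sigma_finiteT leb.
have /sigma_finiteP[G [TG ndG Goo]] := sigma_finiteT mu.
exists (fun k => [set y : 'cV[R]_n.+1 |
  F k (y ord0 ord0) /\ G k (\col_j y (lift ord0 j) ord0)]).
  apply/esym; rewrite -subTset => y _.
  have : (\bigcup_i F i) (y ord0 ord0) by rewrite -TF.
  have : (\bigcup_i G i) (\col_j y (lift ord0 j) ord0) by rewrite -TG.
  move=> [k _ Gk] [i _ Fi]; exists (maxn i k) => //; split.
    by move: (y ord0 ord0) Fi; exact/subsetPset/ndF/leq_maxl.
  by move: (\col_j _) Gk; exact/subsetPset/ndG/leq_maxr.
move=> k; have [mF Fk] := Foo k; have [mG Gk] := Goo k.
split; first exact: measurable_cylinder.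
rewrite cons_measure_cylinder// lte_mul_pinfty//.
by rewrite ge0_fin_numE.
Qed.

HB.instance Definition _ := Measure_isSigmaFinite.Build _ _ _ cons_measure
  cons_measure_sigma_finite.

End cons_measure.

(* Lebesgue measure on R^n; lebesgue_cV_box below gives its value on boxes. *)
Fixpoint lebesgue_cV (R : realType) (n : nat) :
    {sigma_finite_measure set 'cV[R]_n -> \bar R} :=
  match n with
  | 0 => \d_(0 : 'cV[R]_0)
  | m.+1 => cons_measure (lebesgue_cV R m)
  end.

Lemma lebesgue_cV_box (R : realType) (n : nat) (a b : 'cV[R]_n) :
  (forall i, a i ord0 <= b i ord0) ->
  lebesgue_cV R n [set x | forall i, x i ord0 \in `[a i ord0, b i ord0]] =
  (\prod_(i < n) (b i ord0 - a i ord0))%:E.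
Proof.
elim: n a b => [|n IHn] a b ab.
  rewrite big_ord0 /= diracE mem_set//.
  by move=> i; case: i.
have mbox m (c d : 'cV[R]_m) : measurable
    [set x : 'cV[R]_m | forall i, x i ord0 \in `[c i ord0, d i ord0]].
  rewrite (_ : mkset _ = \bigcap_(i in [set: 'I_m])
     ((fun x : 'cV[R]_m => x i ord0 : measurableTypeR R) @^-1`
       `[c i ord0, d i ord0])).
    apply: fin_bigcap_measurable => // i _; rewrite -[X in measurable X]setTI.
    by apply: (@measurable_coord R m i measurableT); exact: measurable_itv.
  apply/seteqP; split=> x /= xcd i; first by move=> _ /=; exact: xcd.
  exact: xcd.
rewrite [X in _ X = _](_ : _ = [set y : 'cV[R]_n.+1 |
    [set` `[a ord0 ord0, b ord0 ord0]] (y ord0 ord0) /\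
    [set x : 'cV[R]_n | forall i,
       x i ord0 \in `[(\col_j a (lift ord0 j) ord0) i ord0,
                      (\col_j b (lift ord0 j) ord0) i ord0]]
      (\col_j y (lift ord0 j) ord0)]).
  rewrite [LHS]cons_measure_cylinder; [|exact: measurable_itv|exact: mbox].
  rewrite IHn; last by move=> i; rewrite !mxE.
  rewrite lebesgue_measure_itv /= lte_fin big_ord_recl EFinM.
  congr (_ * _)%E; last by congr EFin; apply: eq_bigr => i _; rewrite !mxE.
  case: ltP => // ba; have /eqP -> : b ord0 ord0 == a ord0 ord0.
    by rewrite eq_le ba ab.
  by rewrite subrr.
apply/seteqP; split=> y /=.
  by move=> yab; split=> [|i]; [exact: yab|rewrite !mxE; exact: yab].
move=> [y0 yl] i; have [j ->|->//] := unliftP ord0 i.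
by have := yl j; rewrite !mxE.
Qed.

(* z = (t, x) *)
Notation timespace R N := (R * 'cV[R]_N)%type.

Definition lebesgue_space (R : realType) (N : nat) :
    {measure set (measurableTypeR R * 'cV[R]_N)%type -> \bar R} :=
  (lebesgue_measure \x lebesgue_cV R N)%E.

Section calculus.
Context {R : realType} {N : nat}.
Implicit Types (B : 'M[R]_N) (z zeta : timespace R N).
Implicit Types (u v phi : timespace R N -> R).

Definition expmx B : 'M[R]_N := limn (series (fun k => k`!%:R^-1 *: B ^+ k)).

Definition group_law B z zeta : timespace R N :=
  (z.1 + zeta.1, expmx (zeta.1 *: B) *m z.2 + zeta.2).

Definition flowY B (h : R) z : timespace R N :=
  (z.1 + h, expmx (h *: B) *m z.2).

(* [None] stands for the time variable t, [Some k] for the variable x_k. *)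
Definition direction (o : option 'I_N) : timespace R N :=
  if o is Some k then (0, delta_mx k ord0) else (1, 0).

Definition partial (o : option 'I_N) u : timespace R N -> R :=
  fun z => 'D_(direction o) u z.

Definition derY B u : timespace R N -> R :=
  fun z => \sum_(k < N) (B *m z.2) k ord0 * partial (Some k) u z
           + partial None u z.

Definition partial_multi (beta : 'I_N -> nat) u : timespace R N -> R :=
  foldr (fun k => iter (beta k) (partial (Some k))) u (enum 'I_N).

(* u is C^oo: every iterated partial derivative of u is continuous and has
   partial derivatives everywhere. *)
Definition smooth u : Prop :=
  forall s : seq (option 'I_N),
    continuous (foldr partial u s) /\
    forall o z, derivable (foldr partial u s) z (direction o).

Definition test_function phi : Prop :=
  smooth phi /\ compact (closure [set z | phi z != 0]).

Definition locally_integrable_space u : Prop :=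
  measurable_fun [set: (measurableTypeR R * 'cV[R]_N)%type] u /\
  forall K : set (timespace R N), compact K ->
    (\int[lebesgue_space R N]_(z in K) `|u z|%:E < +oo)%E.

(* Weak derivative for a first-order D whose formal adjoint is - D. This covers
   the partial derivatives, and also derY B if the trace of B is 0, as it is when
   only subdiagonal blocks of B are nonzero. *)
Definition weak_der (D : (timespace R N -> R) -> (timespace R N -> R)) u
    (v : timespace R N -> R) : Prop :=
  [/\ locally_integrable_space u, locally_integrable_space v &
    forall phi, test_function phi ->
      \int[lebesgue_space R N]_z (u z * D phi z) =
      - \int[lebesgue_space R N]_z (v z * phi z)].

(* Value of the (quasi-)norm F at the weak derivative D u, +oo if u has no weak
   derivative D u. The latter is unique up to a null set. *)
Definition at_weak_der (F : (timespace R N -> R) -> \bar R)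
    (D : (timespace R N -> R) -> (timespace R N -> R)) u : \bar R :=
  if `[< exists v, weak_der D u v >] then F (get (weak_der D u)) else +oo%E.

Local Open Scope ereal_scope.

Definition Lp_norm (p : R) u : \bar R :=
  'N[lebesgue_space R N]_p%:E [EFin \o u].

Definition seminormY B (p : R) u : \bar R :=
  (\int[lebesgue_space R N]_z \int[lebesgue_measure]_(h in `[(-1)%R, 1%R])
     (`|u (flowY B h z) - u z| `^ p / `|h| `^ (p / 2 + 1))%:E) `^ p^-1.

(* The value at n = 0 is the L^p norm, which makes the formula for n = 2 a case of
   the one for n >= 3. *)
Fixpoint Sobolev_norm B (d : nat) (p : R) (n : nat) u : \bar R :=
  match n with
  | 0 => Lp_norm p u
  | m.+1 =>
    match m with
    | 0 => Lp_norm p u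
           + \sum_(k < N | (k < d)%N)
               at_weak_der (Lp_norm p) (partial (Some k)) u
           + seminormY B p u
    | l.+1 => Lp_norm p u
           + \sum_(k < N | (k < d)%N)
               at_weak_der (Sobolev_norm B d p m) (partial (Some k)) u
           + at_weak_der (Sobolev_norm B d p l) (derY B) u
    end
  end.

Definition in_Sobolev B (d : nat) (p : R) (n : nat) u : Prop :=
  u \in Lfun (lebesgue_space R N) p%:E /\ Sobolev_norm B d p n u < +oo.

End calculus.

Section blocks.
Context {R : realType} {r : nat} (d : 'I_r.+1 -> nat).
Local Notation N := (\sum_i d i)%N.
Implicit Types (B : 'M[R]_N) (z zeta : timespace R N) (u : timespace R N -> R).

Definition block_assumption B : Prop :=
  [/\ forall i, (0 < d i)%N,
      forall i j : 'I_r.+1, (i <= j)%N -> (d j <= d i)%N,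
      forall i j : 'I_r.+1, i != j.+1 :> nat -> submxblock B i j = 0 &
      forall i j : 'I_r.+1, i = j.+1 :> nat -> \rank (submxblock B i j) = d i].

Definition euclid_norm n (x : 'cV[R]_n) : R :=
  Num.sqrt (\sum_k x k ord0 ^+ 2).

(* [tagnat.sig1 k] is the index of the block that contains the coordinate k, the
   blocks being consecutive intervals of lengths d_0, ..., d_r: see
   [tagnat.rect]. *)
Definition block_part (i : 'I_r.+1) (x : 'cV[R]_N) : 'cV[R]_N :=
  \col_k (if tagnat.sig1 k == i then x k ord0 else 0).

Definition homogeneous_norm z : R :=
  `|z.1| `^ (1 / 2) +
  \sum_(i < r.+1) euclid_norm (block_part i z.2) `^ (1 / (2 * i + 1)%N%:R).

Definition weight (beta : 'I_N -> nat) : nat :=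
  (\sum_(i < r.+1) (2 * i + 1) * \sum_(k < N | tagnat.sig1 k == i) beta k)%N.

(* The constraint 2 k + weight beta <= n forces k <= n and beta_j <= n, so that
   k and beta may range over finite types. *)
Definition Taylor B (n : nat) u zeta z : R :=
  \sum_(k < n.+1)
    \sum_(beta : {ffun 'I_N -> 'I_n.+1} |
           (2 * k + weight (fun j => beta j) <= n)%N)
      (z.1 - zeta.1) ^+ k *
      (\prod_(j < N)
         (z.2 - expmx ((z.1 - zeta.1) *: B) *m zeta.2) j ord0 ^+ beta j) /
      (k`! * \prod_(j < N) (beta j)`!)%N%:R *
      iter k (derY B) (partial_multi (fun j => beta j) u) zeta.

End blocks.

(* Main.v *)
(** Let (h, xi) be the inverse of zeta. The remainder at z is that of u around
    w = z o zeta, evaluated at the translate by xi of e^{hY} w; since z |-> z o zeta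
    preserves Lebesgue measure, it is bounded in L^p(dw). One expands u in the
    coordinates x_k one at a time, and then along Y. Each one-parameter expansion is
    obtained by integration along the flow: Y maps W^{m+2} to W^m, and the derivative
    in x_k maps W^{m+2i+1} to W^m if x_k is in block i, because [d_v, Y] = d_{Bv}.
    What remains is the zeroth order: if xi starts in block i, |xi_k| <= delta^{2j+1}
    for x_k in block j, and m <= 2i+1, then the translation by xi changes u by at most
    C delta^m |u|_{W^m} in L^p. The commutator of the translation by w and of e^{hY} is
    the translation by e^{hB} w - w, whose leading term h B w is in the next block;
    with h = delta^2 this gives the shifts in block i+1 from those in block i. The
    commutator itself is estimated by integration along Y and the estimate for
    Y u in W^{m-2}, which closes the induction on m.

    The norm of W^{m,p}_B is defined by weak derivatives. For smooth functions, the
    invariance of the measure under the flows gives integration by parts; weak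
    derivatives are unique because the sets where a test function does not vanish
    form a pi-system that generates the Borel sets. *)

From HB Require Import structures.
From mathcomp Require Import all_boot all_order all_algebra.
From mathcomp Require Import all_classical all_reals all_analysis.
From mathcomp Require Import measurable_realfun ring lra zify.
Require Import Defs.

Set Implicit Arguments.
Unset Strict Implicit.
Unset Printing Implicit Defensive.

Import Order.TTheory GRing.Theory Num.Theory.
Import numFieldNormedType.Exports.

Local Open Scope classical_set_scope.
Local Open Scope ring_scope.

(** * Measure-preserving maps *)

(** The obstacle is that the norm of order m <= 2i gives no L^p bound for a derivative along block
    i, so a shift in that block cannot be treated as the integral of a derivative. From m = 2i+1 on
    it can. For m = 2i+2 and a shift in block i+1, a derivative along block i is still available and
    lies in W^1; its increments along Y are of size delta, which supplies the missing factor. At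
    lower orders the bound in block i+1 is inherited from block i. The w whose commutator has a
    prescribed leading term comes from a right inverse of the blocks of B, and this is where the
    rank condition enters. The commutator reproduces the prescribed shift only up to later blocks; a
    descending induction on the first block absorbs these. All estimates are stated on boxes dilated
    by an arbitrary delta > 0. Since B is nilpotent, e^{hB} is polynomial in h and respects these
    boxes for |h| <= delta^2 with a constant independent of delta, so that zeta need not be small.
    Only the fractional seminorm restricts h, to |h| <= 1; the L^p norm covers larger h. *)

Section measure_preserving.
Local Open Scope ereal_scope.
Context d (T : measurableType d) (R : realType).

Definition measure_preserving (mu : {measure set T -> \bar R}) (phi : T -> T) :=
  measurable_fun setT phi /\
  forall A, measurable A -> mu (phi @^-1` A) = mu A.

Variables (mu : {measure set T -> \bar R}) (phi : T -> T).
Hypothesis muphi : measure_preserving mu phi.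

Lemma ge0_integral_preserving (f : T -> \bar R) :
  measurable_fun setT f -> (forall x, 0 <= f x) ->
  \int[mu]_x f (phi x) = \int[mu]_x f x.
Proof.
move: muphi => [mphi muE] mf f0.
have := ge0_integral_pushforward mphi mu measurableT mf.
rewrite preimage_setT /= => <-; last by move=> x _; exact: f0.
by apply: eq_measure_integral => A mA _; exact: muE.
Qed.

Lemma integral_preserving (f : T -> \bar R) : mu.-integrable setT f ->
  \int[mu]_x f (phi x) = \int[mu]_x f x.
Proof.
move=> /integrableP[mf _].
rewrite integralE [RHS]integralE; congr (_ - _).
  rewrite -(ge0_integral_preserving (measurable_funepos mf))//.
  by apply: eq_integral => x _; rewrite (funepos_comp f phi).
rewrite -(ge0_integral_preserving (measurable_funeneg mf))//.
by apply: eq_integral => x _; rewrite (funeneg_comp f phi).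
Qed.

End measure_preserving.

(** The slice over a of the preimage of A is the preimage under [psi a] of the slice of A over
    [phi a]. Its measure is therefore the slice function of A composed with [phi], which has the
    same integral. *)
Lemma measure_preserving_skew d1 d2 (T1 : measurableType d1)
    (T2 : measurableType d2) (R : realType)
    (m1 : {sigma_finite_measure set T1 -> \bar R})
    (m2 : {sigma_finite_measure set T2 -> \bar R})
    (phi : T1 -> T1) (psi : T1 -> T2 -> T2) :
  measure_preserving m1 phi ->
  (forall a, measure_preserving m2 (psi a)) ->
  measurable_fun setT (fun z : T1 * T2 => psi z.1 z.2) ->
  measure_preserving (m1 \x m2)%E (fun z => (phi z.1, psi z.1 z.2)).
Proof.
move=> [mphi phiE] psiE mpsi.
have mF : measurable_fun setT (fun z : T1 * T2 => (phi z.1, psi z.1 z.2)).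
  apply: measurable_fun_pair => //.
  exact: measurableT_comp mphi measurable_fst.
split=> // A mA.
rewrite /product_measure1.
transitivity (\int[m1]_x (m2 \o xsection A) (phi x))%E; last first.
  apply: ge0_integral_preserving => //; first exact: measurable_fun_xsection.
apply: eq_integral => a _ /=.
have [_ /(_ _ (measurable_xsection (phi a) mA)) <-] := psiE a.
by congr (m2 _); apply/seteqP; split=> y /=; rewrite /xsection/= !inE.
Qed.

Lemma lebesgue_measure_translation (R : realType) (s : R) :
  measure_preserving (@lebesgue_measure R)
    (fun t : measurableTypeR R => t + s : measurableTypeR R).
Proof.
have ms : measurable_fun setT (fun t : measurableTypeR R => t + s : measurableTypeR R).
  exact: measurable_funD.
split=> // A mA; apply/esym.
pose push : {measure set (measurableTypeR R) -> \bar R} :=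
  measure_function_pushforward__canonical__measure_function_Measure
    (@lebesgue_measure R) ms.
apply: (@lebesgue_measure_unique _ push) => // _ [[a b] _ <-].
rewrite /push/= /pushforward (_ : _ @^-1` _ = `]a - s, b - s]%classic).
  rewrite !lebesgue_measure_itv/= !lte_fin ltrD2r.
  by case: ifPn => // _; congr EFin; ring.
by apply/seteqP; split=> x /=; rewrite !in_itv/= ltrBlDr lerBrDr.
Qed.

Lemma measurable_cVP (R : realType) n d (T : measurableType d) (f : T -> 'cV[R]_n) :
  measurable_fun setT f <->
  forall i, measurable_fun [set: T] ((fun t => f t i ord0) : T -> measurableTypeR R).
Proof.
split; last exact: measurable_to_cV.
by move=> mf i; exact: (measurableT_comp (measurable_coord i) mf).
Qed.

Lemma measurable_affine (R : realType) n m d (T : measurableType d)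
    (L : T -> 'M[R]_(m, n)) (f : T -> 'cV[R]_n) (g : T -> 'cV[R]_m) :
  (forall i j, measurable_fun setT (fun t => L t i j : measurableTypeR R)) ->
  measurable_fun setT f -> measurable_fun setT g ->
  measurable_fun setT (fun x => L x *m f x + g x).
Proof.
move=> mL /measurable_cVP mf /measurable_cVP mg; apply/measurable_cVP => i.
under eq_fun do rewrite mxE mxE.
apply: measurable_funD => //.
apply: (@measurable_sum _ _ R setT _ _ (fun j t => L t i j * f t j ord0)) => j.
  exact: (measurable_funM (mL i j) (mf j)).
exact: mg.
Qed.

(** The entries on and above the diagonal are prescribed, so L is lower triangular with unit
    diagonal. The matrices e^{sB} are of this kind because the coordinates are ordered by blocks. *)
Definition unitriangular (R : realType) n (L : 'M[R]_n) :=
  forall i j : 'I_n, (i <= j)%N -> L i j = (i == j)%:R.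

(** Induction on the dimension takes the place of a determinant. The first coordinate is translated;
    the others undergo an affine map whose linear part is the lower right block, and the first
    coordinate enters only its translation part. The map is thus a skew product. *)
Lemma lebesgue_cV_affine (R : realType) n (L : 'M[R]_n) (b : 'cV[R]_n) :
  unitriangular L ->
  measure_preserving (lebesgue_cV R n) (fun x => L *m x + b).
Proof.
elim: n L b => [|n IH] L b trL.
  split; first exact: measurable_affine.
  move=> A mA; congr (_ _); apply/seteqP; split => x /=; 
    by rewrite (_ : L *m x + b = x)//; apply/colP => -[].
split; first exact: measurable_affine.
move=> A mA.
pose L' := \matrix_(i < n, j < n) L (lift ord0 i) (lift ord0 j).
pose c := \col_(i < n) L (lift ord0 i) ord0.
pose b' := \col_(i < n) b (lift ord0 i) ord0.
have trL' : unitriangular L'.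
  move=> i j ij; rewrite mxE trL.
    by rewrite (inj_eq lift_inj).
  by rewrite /= /bump/= !add1n ltnS.
pose psi (a : measurableTypeR R) (y : 'cV[R]_n) := L' *m y + (a *: c + b').
have skew := @measure_preserving_skew _ _ _ _ _ lebesgue_measure (lebesgue_cV R n)
  (fun t => t + b ord0 ord0) psi (lebesgue_measure_translation _)
  (fun a => IH L' (a *: c + b') trL').
have {}skew := skew _.
have mpsi : measurable_fun setT
    (fun z : measurableTypeR R * 'cV[R]_n => psi z.1 z.2).
  apply: measurable_affine => //.
  apply/measurable_cVP => i; under eq_fun do rewrite !mxE.
  apply: measurable_funD => //; apply: measurable_funM => //.
have [_ /= /(_ (@cons_cV R n @^-1` A))] := skew mpsi.
have mcons : measurable_fun setT (@cons_cV R n).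
  apply: measurable_to_cV => i; have [j ->|->] := unliftP ord0 i.
    under eq_fun do rewrite mxE liftK.
    apply: (@measurableT_comp _ _ _ _ _ _ (fun x : 'cV[R]_n => x j ord0)) => //.
    exact: measurable_coord.
  by under eq_fun do rewrite mxE unlift_none; exact: measurable_fst.
have mA' : measurable (@cons_cV R n @^-1` A).
  by rewrite -[X in measurable X]setTI; exact: mcons.
have consE (z : measurableTypeR R * 'cV[R]_n) :
    L *m cons_cV z + b = cons_cV (z.1 + b ord0 ord0, psi z.1 z.2).
  case: z => t x; apply/colP => i; have [j ->|->] := unliftP ord0 i.
    rewrite !mxE liftK !mxE /= big_ord_recl !mxE unlift_none /=.
    rewrite (eq_bigr (fun k => L' j k * x k ord0)); last first.
      by move=> k _; rewrite !mxE liftK.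
    by rewrite [RHS]addrCA addrA mulrC.
  rewrite !mxE unlift_none big_ord_recl !mxE unlift_none /= trL// eqxx mul1r.
  by rewrite big1 ?addr0// => k _; rewrite trL// mul0r.
move=> /(_ mA') E; rewrite -[RHS]E {E} /= /cons_measure /pushforward /=.
congr (_ _); apply/seteqP; split => z.
  by rewrite /preimage /= consE.
by rewrite /preimage /= consE.
Qed.

(** * Topology and measurability of the space-time *)

Lemma bigcup_unpickle (T : Type) (I : countType) (F : I -> set T) :
  \bigcup_q F q = \bigcup_n if unpickle n is Some q then F q else set0.
Proof.
apply/seteqP; split=> z [q _ Fz]; first by exists (pickle q) => //; rewrite pickleK.
by move: Fz; case: (unpickle q) => // q' Fz; exists q'.
Qed.

Section timespace_topology.
Context (R : realType) (N : nat).
Local Notation ts := (timespace R N).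
Local Notation mts := (measurableTypeR R * 'cV[R]_N)%type.

Definition tsbox (z : ts) (e : R) : set ts :=
  [set w : ts | `|w.1 - z.1| < e /\ forall i, `|w.2 i ord0 - z.2 i ord0| < e].

Lemma ball_tsbox (z : ts) (e : R) : 0 < e -> ball z e = tsbox z e.
Proof.
move=> e0; apply/seteqP; split=> w /=.
  case=> /= w1 w2; split; first by move: w1; rewrite /ball/= distrC.
  move=> i; case: w2 => _ /(_ i ord0).
  by rewrite /ball/= distrC.
case=> w1 w2; split; first by rewrite /= /ball/= distrC.
split=> // i j; rewrite (ord1 j).
by rewrite /ball/= distrC; exact: w2.
Qed.

Lemma nbhs_tsbox (z : ts) (A : set ts) :
  nbhs z A <-> exists2 e, 0 < e & tsbox z e `<=` A.
Proof.
split.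
  by move=> /nbhs_ballP[e /= e0 eA]; exists e => //; rewrite -ball_tsbox.
move=> [e e0 eA]; apply/nbhs_ballP; exists e => //=.
by rewrite ball_tsbox.
Qed.

Lemma measurable_tsbox (z : ts) (e : R) : measurable (tsbox z e : set mts).
Proof.
rewrite (_ : tsbox z e = (fst @^-1` [set t | `|t - z.1| < e]) `&`
   \bigcap_(i in [set: 'I_N])
    ((fun w : ts => w.2 i ord0) @^-1` [set t | `|t - z.2 i ord0| < e])); last first.
  apply/seteqP; split=> w /=; first by case=> w1 w2; split=> // i _; exact: w2.
  by case=> w1 w2; split=> // i; exact: w2.
have mI (c : R) : measurable ([set t | `|t - c| < e] : set (measurableTypeR R)).
  rewrite (_ : mkset _ = `]c - e, c + e[%classic); first exact: measurable_itv.
  by apply/seteqP; split=> t /=; rewrite in_itv/= ltr_distl.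
apply: measurableI.
  rewrite -[X in measurable X]setTI.
  by apply: (@measurable_fst _ _ (measurableTypeR R) 'cV[R]_N) => //; exact: mI.
apply: fin_bigcap_measurable => // i _; rewrite -[X in measurable X]setTI.
have mc : measurable_fun setT
    (fun w : mts => w.2 i ord0 : measurableTypeR R).
  exact: (measurableT_comp (measurable_coord i) measurable_snd).
by apply: mc => //; exact: mI.
Qed.

(** An open set is the union of the boxes with rational centre and radius 1/(k+1) that it contains.
    S is arbitrary because the lemma serves both the Borel sets and the sigma-algebra generated by
    the test sets. *)
Lemma open_sigma_tsbox (S : set (set ts)) (U : set ts) : sigma_algebra setT S ->
  (forall z e, 0 < e -> S (tsbox z e)) -> open U -> S U.
Proof.
move=> [S0 _ Sbigcup] Sbox oU.
pose T := (rat * {ffun 'I_N -> rat} * nat)%type.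
pose c (q : T) : ts := (ratr q.1.1, \col_i ratr (q.1.2 i)).
pose F (q : T) : set mts := if `[< tsbox (c q) q.2.+1%:R^-1 `<=` U >]
  then tsbox (c q) q.2.+1%:R^-1 else set0.
rewrite (_ : U = \bigcup_q F q); last first.
  apply/seteqP; split=> [z Uz|z [q _]]; last first.
    by rewrite /F; case: ifPn => // /asboolP; apply.
  have /nbhs_tsbox[e e0 zU] : nbhs z U by apply: open_nbhs_nbhs.
  have [k ke] : exists k : nat, k.+1%:R^-1 < e / 2.
    have [k _ /(_ k) H] : \forall k \near \oo, k.+1%:R^-1 < e / 2.
      by have := near_infty_natSinv_lt (PosNum (divr_gt0 e0 (ltr0Sn R 1))).
    by exists k; apply: H => /=.
  have k0 : 0 < k.+1%:R^-1 :> R by rewrite invr_gt0.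
  have Q (x : R) : {q : rat | `|x - ratr q| < k.+1%:R^-1}.
    apply: cid; have [|q] := @rat_in_itvoo R (x - k.+1%:R^-1) (x + k.+1%:R^-1).
      by rewrite ltrD2l gtrN.
    by rewrite in_itv/= => xq; exists q; rewrite distrC ltr_distl.
  exists (sval (Q z.1), [ffun i => sval (Q (z.2 i ord0))], k) => //.
  rewrite /F; case: ifPn => [_|/asboolPn[]].
    split=> /=; first exact: (svalP (Q z.1)).
    by move=> i; rewrite mxE ffunE; exact: (svalP (Q (z.2 i ord0))).
  have tri (x y w : R) : `|x - y| < k.+1%:R^-1 -> `|w - y| < k.+1%:R^-1 -> `|w - x| < e.
    move=> xy wy; rewrite (splitr e) (_ : w - x = (w - y) - (x - y)); last by ring.
    apply: le_lt_trans (ler_normB _ _) _; apply: ltrD; exact: lt_trans ke.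
  move=> w [/= w1 w2]; apply: zU; split.
    exact: tri (svalP (Q z.1)) w1.
  move=> i; have := w2 i; rewrite mxE ffunE; exact: tri (svalP (Q (z.2 i ord0))).
rewrite bigcup_unpickle; apply: Sbigcup => n; case: (unpickle n) => [q|]; last exact: S0.
rewrite /F; case: ifP => _; last exact: S0.
apply: Sbox.
by rewrite invr_gt0.
Qed.

Lemma open_measurable_space (U : set ts) : open U -> measurable (U : set mts).
Proof.
apply: (@open_sigma_tsbox measurable); first exact: sigma_algebra_measurable.
by move=> z e _; exact: measurable_tsbox.
Qed.

Lemma continuous_measurable_space (u : ts -> R) :
  continuous u -> measurable_fun [set: mts] u.
Proof.
move=> /continuousP cu; apply: (measurability _ (RGenOpens.measurableE R)).
move=> _ [_ [a [b ->]] <-]; rewrite setTI.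
by apply: open_measurable_space; apply: cu; exact: interval_open.
Qed.

Lemma compact_tsbounded (K : set ts) : compact K ->
  exists2 M, 0 < M & K `<=` tsbox 0 M.
Proof.
move=> /compact_bounded[M [_ HM]]; exists (`|M| + 2); first by rewrite ltr_pwDr.
move=> z Kz; have := HM (`|M| + 1) _ z Kz.
have -> : M < `|M| + 1 by rewrite (le_lt_trans (ler_norm _))// ltrDl.
move=> /(_ isT); rewrite /= prod_normE/= ge_max => /andP[z1 z2]; split.
  by rewrite subr0; apply: le_lt_trans z1 _; rewrite ltrD2l ltr1n.
move=> i; rewrite mxE subr0; have : `|z.2 i ord0| <= `|z.2|.
  rewrite {2}/Num.norm/= mx_normrE.
  exact: (@le_bigmax _ _ _ 0 (fun ij : 'I_N * 'I_1 => `|z.2 ij.1 ij.2|) (i, ord0)).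
move=> /le_trans /(_ z2) /le_lt_trans; apply; by rewrite ltrD2l ltr1n.
Qed.

Lemma compact_measurable_space (K : set ts) : compact K -> measurable (K : set mts).
Proof.
move=> cK; rewrite -[K]setCK; apply: measurableC; apply: open_measurable_space.
by apply: closed_openC; apply: compact_closed => //; exact: norm_hausdorff.
Qed.

Lemma lebesgue_tsbox (M : R) : 0 < M -> (lebesgue_space R N (tsbox 0%R M) < +oo)%E.
Proof.
move=> M0.
pose A : set (measurableTypeR R) := `[- M, M]%classic.
pose C : set 'cV[R]_N := [set x | forall i, x i ord0 \in `[(const_mx (- M) : 'cV[R]_N) i ord0, (const_mx M : 'cV[R]_N) i ord0]].
have mC : measurable C.
  rewrite (_ : C = \bigcap_(i in [set: 'I_N])
     ((fun x : 'cV[R]_N => x i ord0 : measurableTypeR R) @^-1`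
       `[- M, M]%classic)).
    apply: fin_bigcap_measurable => // i _; rewrite -[X in measurable X]setTI.
    by apply: (@measurable_coord R N i measurableT); exact: measurable_itv.
  apply/seteqP; split=> x /= xcd i.
    by move=> _ /=; have := xcd i; rewrite !mxE.
  by rewrite !mxE; apply: xcd.
apply: (@le_lt_trans _ _ (lebesgue_space R N (A `*` C))).
  apply: le_measure; rewrite ?inE.
  - exact: measurable_tsbox.
  - by apply: measurableX => //; exact: measurable_itv.
  - move=> z [/= z1 z2]; split => /=.
      by move: z1; rewrite /A/= subr0 in_itv/= ltr_norml => /andP[/ltW -> /ltW ->].
    move=> i; have := z2 i; rewrite !mxE subr0 in_itv/= ltr_norml.
    by move=> /andP[/ltW -> /ltW ->].
have mA : measurable A by exact: measurable_itv.
have -> : (lebesgue_space R N (A `*` C) = lebesgue_measure A * lebesgue_cV R N C)%E.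
  exact: (product_measure1E lebesgue_measure (lebesgue_cV R N) mA mC).
rewrite [X in (_ * X)%E](_ : _ = (\prod_(i < N) ((const_mx M : 'cV[R]_N) i ord0 - (const_mx (- M) : 'cV[R]_N) i ord0))%:E).
  by rewrite lebesgue_measure_itv/=; case: ifP => _; rewrite ?mul0e// -EFinD -EFinM ltry.
by apply: lebesgue_cV_box => i; rewrite !mxE; lra.
Qed.

Lemma continuous_locally_integrable (u : ts -> R) :
  continuous u -> locally_integrable_space u.
Proof.
move=> cu; have mu := continuous_measurable_space cu; split=> // K cK.
have mK := compact_measurable_space cK.
have [M M0 KM] := compact_tsbounded cK.
have /compact_bounded[C [_ HC]] : compact (u @` K).
  apply: continuous_compact => //; exact: continuous_subspaceT.
pose c := `|C| + 1.
have uc z : K z -> `|u z| <= c.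
  move=> Kz; apply: (HC c); last by exists z.
  by rewrite /c (le_lt_trans (ler_norm _))// ltrDl.
apply: (@le_lt_trans _ _ (\int[lebesgue_space R N]_(z in K) (cst c%:E z))%E).
  apply: ge0_le_integral => //.
  by apply/measurable_EFinP; apply: measurableT_comp => //; exact: measurable_funTS.
rewrite integral_cst// lte_mul_pinfty//; first by rewrite lee_fin /c addr_ge0.
apply: le_lt_trans (lebesgue_tsbox M0); apply: le_measure; rewrite ?inE//.
exact: measurable_tsbox.
Qed.

End timespace_topology.

(** * Bounds in L^p *)

Lemma measurable_norm_powR d (T : measurableType d) (R : realType) (p : R)
    (D : set T) (f : T -> R) :
  measurable_fun D f -> measurable_fun D (fun x => (`|f x| `^ p)%:E).
Proof.
move=> mf; apply/measurable_EFinP.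
by apply: (measurableT_comp (measurable_powR p)); apply: measurableT_comp.
Qed.

Section Lp_bound.
Context d (T : measurableType d) (R : realType).
Variable mu : {sigma_finite_measure set T -> \bar R}.
Variable p : R.
Hypothesis p1 : 1 <= p.

Let p0 : 0 < p. Proof. exact: lt_le_trans p1. Qed.

(** Measurability belongs to the bound, so that Minkowski's inequality applies without side
    conditions. *)
Definition Lp_le (K : R) (f : T -> R) :=
  measurable_fun setT f /\ ('N[mu]_p%:E [EFin \o f] <= K%:E)%E.

Lemma Lp_le_ge0 K f : Lp_le K f -> 0 <= K.
Proof. by move=> [_ fK]; rewrite -lee_fin; apply: le_trans fK; exact: Lnorm_ge0. Qed.

Lemma Lp_leW K L f : K <= L -> Lp_le K f -> Lp_le L f.
Proof. by move=> KL [mf fK]; split=> //; apply: le_trans fK _; rewrite lee_fin. Qed.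

Lemma eq_Lp_le K f g : f =1 g -> Lp_le K f -> Lp_le K g.
Proof. by move=> /funext ->. Qed.

Lemma Lp_le_powP K f : 0 <= K -> measurable_fun setT f ->
  Lp_le K f <-> (\int[mu]_x (`|f x| `^ p)%:E <= (K `^ p)%:E)%E.
Proof.
move=> K0 mf.
have E : (\int[mu]_x (`|f x| `^ p)%:E = 'N[mu]_p%:E [EFin \o f] `^ p)%E.
  rewrite powR_Lnorm ?gt_eqF//.
have EK : ((K `^ p)%:E = K%:E `^ p)%E by rewrite poweR_EFin.
rewrite E EK; split=> [[_ fK]|fK].
  apply: gt0_ler_poweR => //; first exact: ltW.
    by rewrite in_itv/= Lnorm_ge0/= leey.
  by rewrite in_itv/= lee_fin K0/= leey.
split=> //; have pV (x : \bar R) : (0 <= x)%E -> (x = (x `^ p) `^ p^-1)%E.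
  by move=> x0; rewrite -poweRrM divff ?gt_eqF// poweRe1.
rewrite (pV _ (Lnorm_ge0 _ _ _)) (pV K%:E) ?lee_fin//.
apply: gt0_ler_poweR => //; first by rewrite invr_ge0 ltW.
- by rewrite in_itv/= ?poweR_ge0/= ?leey ?andbT ?lee_fin ?powR_ge0.
- by rewrite in_itv/= ?poweR_ge0/= ?leey ?andbT ?lee_fin ?powR_ge0.
Qed.

Lemma Lp_leD K L f g : Lp_le K f -> Lp_le L g -> Lp_le (K + L) (fun x => f x + g x).
Proof.
move=> [mf fK] [mg gL]; split; first exact: measurable_funD.
rewrite EFinD; apply: (@le_trans _ _ ('N[mu]_p%:E[EFin \o f] + 'N[mu]_p%:E[EFin \o g])%E).
  have p1e : (1 <= p%:E)%E by rewrite lee_fin.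
  exact: (eminkowski mu mf mg p1e).
exact: leeD.
Qed.

Lemma Lp_leZ a K f : Lp_le K f -> Lp_le (`|a| * K) (fun x => a * f x).
Proof.
move=> fK; have K0 := Lp_le_ge0 fK; have mf := fK.1.
have maf : measurable_fun setT (fun x => a * f x) by exact: measurable_funM.
apply/Lp_le_powP => //; first exact: mulr_ge0.
under eq_integral do rewrite normrM powRM// EFinM.
rewrite ge0_integralZl_EFin ?powR_ge0//; last exact: measurable_norm_powR.
rewrite powRM// EFinM lee_wpmul2l ?lee_fin ?powR_ge0//.
exact: (Lp_le_powP K0 mf).1.
Qed.

Lemma Lp_leN K f : Lp_le K f -> Lp_le K (fun x => - f x).
Proof.
move=> /(Lp_leZ (-1)); rewrite normrN1 mul1r; apply: eq_Lp_le => x.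
by rewrite mulN1r.
Qed.

Lemma Lp_leB K L f g : Lp_le K f -> Lp_le L g -> Lp_le (K + L) (fun x => f x - g x).
Proof. by move=> fK /Lp_leN; exact: Lp_leD. Qed.

Lemma Lp_le0 : Lp_le 0 (fun=> 0).
Proof.
apply/Lp_le_powP => //; under eq_integral do rewrite normr0 powR0 ?gt_eqF//.
by rewrite integral0 powR0// gt_eqF.
Qed.

Lemma Lp_le_sum (I : Type) (s : seq I) (P : pred I) (K : I -> R) (f : I -> T -> R) :
  (forall i, P i -> Lp_le (K i) (f i)) ->
  Lp_le (\sum_(i <- s | P i) K i) (fun x => \sum_(i <- s | P i) f i x).
Proof.
move=> fK; elim: s => [|i s IH].
  by rewrite big_nil; apply: eq_Lp_le Lp_le0 => x; rewrite big_nil.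
rewrite big_cons; case: ifPn => [Pi|nPi].
  apply: eq_Lp_le (Lp_leD (fK _ Pi) IH) => x.
  by rewrite big_cons Pi.
by apply: eq_Lp_le IH => x; rewrite big_cons (negbTE nPi).
Qed.

Lemma Lp_le_preserving phi K f : measure_preserving mu phi ->
  Lp_le K f -> Lp_le K (fun x => f (phi x)).
Proof.
move=> muphi fK; have K0 := Lp_le_ge0 fK; have mf := fK.1.
have mfp : measurable_fun setT (fun x => f (phi x)).
  exact: measurableT_comp mf muphi.1.
apply/Lp_le_powP => //.
rewrite (ge0_integral_preserving muphi (f := fun x => (`|f x| `^ p)%:E))//.
  exact: (Lp_le_powP K0 mf).1.
exact: measurable_norm_powR.
Qed.

Lemma Lp_le_ae K f g : measurable_fun setT g -> {ae mu, forall x, f x = g x} ->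
  Lp_le K f -> Lp_le K g.
Proof.
move=> mg fg fK; have K0 := Lp_le_ge0 fK; have mf := fK.1.
apply/Lp_le_powP => //; move/(Lp_le_powP K0 mf) : fK.
rewrite (@ge0_ae_eq_integral _ _ _ mu setT _ (fun x => (`|g x| `^ p)%:E))//;
  [exact: measurable_norm_powR|exact: measurable_norm_powR|..].
by apply: filterS fg => x /= -> _.
Qed.

End Lp_bound.

(** * Jensen's inequality, mean values and averages along a parameter *)

Section mean_value.
Context d (T : measurableType d) (R : realType).
Variable mu : {sigma_finite_measure set T -> \bar R}.
Variable p : R.
Hypothesis p1 : 1 <= p.
Let p0 : 0 < p. Proof. exact: lt_le_trans p1. Qed.
Local Notation leb := (@lebesgue_measure R).

Lemma integral_indicM (A : set R) (f : measurableTypeR R -> \bar R) :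
  (\int[leb]_(s in A) f s = \int[leb]_s ((\1_A s)%:E * f s))%E.
Proof.
rewrite integral_mkcond; apply: eq_integral => s _.
by rewrite patchE indicE; case: (s \in A); rewrite ?mul1e ?mul0e.
Qed.

(** Hölder's inequality against the indicator of [0, 1], whose L^q norm is 1. The case p = 1 is
    treated apart, its conjugate exponent being infinite. *)
Lemma powR_integral01 (g : R -> R) : measurable_fun setT g ->
  (`|\int[leb]_(s in `[0%R, 1%R]) (g s)%:E| `^ p <=
   \int[leb]_(s in `[0%R, 1%R]) (`|g s| `^ p)%:E)%E.
Proof.
move=> mg; pose D : set (measurableTypeR R) := `[0, 1]%classic.
have mD : measurable D by exact: measurable_itv.
have lD : leb D = 1%E by rewrite /D lebesgue_measure_itv/= lte_fin ltr01 oppr0 adde0.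
have mgD : measurable_fun D (EFin \o g) by apply/measurable_EFinP; exact: measurable_funTS.
have le1 := le_abse_integral leb mD mgD.
have in0y (x : \bar R) : (0 <= x)%E -> x \in `[0%E, +oo%E].
  by move=> x0; rewrite in_itv/= x0 leey.
apply: (@le_trans _ _ ((\int[leb]_(s in D) `|(g s)%:E|) `^ p)%E).
  apply: gt0_ler_poweR => //; first exact: ltW.
  - by apply: in0y.
  - by apply: in0y; apply: integral_ge0.
have [pE|pn1] := eqVneq p 1.
  rewrite pE poweRe1 ?integral_ge0//.
  by under [leRHS]eq_integral do rewrite powRr1//.
have pgt1 : 1 < p by rewrite lt_neqAle eq_sym pn1.
pose q := p / (p - 1).
have q0 : 0 < q by rewrite divr_gt0// subr_gt0.
have pq : p^-1 + q^-1 = 1.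
  by rewrite /q invf_div; field; rewrite gt_eqF.
have mgD' : measurable_fun setT (g \_ D).
  by apply/(measurable_restrictT _ _).1 => //; exact: measurable_funTS.
have mD' : measurable_fun setT (\1_D : measurableTypeR R -> R).
  exact: measurable_indic.
have := hoelder leb mgD' mD' p0 q0 pq.
rewrite Lnorm1 unlock /=.
have -> : (\int[leb]_x `|(g \_ D) x * \1_D x|%:E = \int[leb]_(x in D) `|g x|%:E)%E.
  rewrite [RHS]integral_mkcond; apply: eq_integral => x _.
  rewrite indicE !patchE; case: (x \in D); first by rewrite mulr1.
  by rewrite mulr0 normr0.
have -> : (\int[leb]_x (`|(g \_ D) x| `^ p)%:E =
    \int[leb]_(x in D) (`|g x| `^ p)%:E)%E.
  rewrite [RHS]integral_mkcond; apply: eq_integral => x _.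
  by rewrite !patchE; case: (x \in D) => //; rewrite normr0 powR0// gt_eqF.
have -> : (\int[leb]_x (`|\1_D x| `^ q)%:E = 1)%E.
  transitivity (\int[leb]_x (\1_D x)%:E)%E; last by rewrite integral_indic// setIT.
  apply: eq_integral => x _.
  rewrite indicE; case: (x \in D); first by rewrite normr1 powR1.
  by rewrite normr0 powR0// gt_eqF.
rewrite poweR1r mule1 => le2.
have I0 : (0 <= \int[leb]_(x in D) (`|g x| `^ p)%:E)%E.
  by apply: integral_ge0 => x _; rewrite lee_fin powR_ge0.
set I := (\int[leb]_(s in _) (`|g s| `^ p)%:E)%E in I0 *.
suff : ((\int[leb]_(s in D) `|g s|%:E) `^ p <= (I `^ p^-1) `^ p)%E.
  by rewrite -(poweRrM I) mulVf ?gt_eqF// poweRe1.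
apply: gt0_ler_poweR => //; first exact: ltW.
- by apply: in0y; apply: integral_ge0 => x _; rewrite lee_fin.
- by apply: in0y; rewrite poweR_ge0.
Qed.

Lemma integral_is_derive01 (h g : R -> R) : (forall s : R, is_derive s 1 h (g s)) ->
  continuous g ->
  (\int[leb]_(s in `[0%R, 1%R]) (g s)%:E = (h 1 - h 0)%:E)%E.
Proof.
move=> dh cg; rewrite EFinB; apply: (@continuous_FTC2 _ g h 0 1) => //.
- by apply: continuous_subspaceT; exact: cg.
- have ch : continuous h.
    move=> s; apply: differentiable_continuous; apply/derivable1_diffP.
    exact: ex_derive.
  split; [by move=> s _; exact: ex_derive| |];
    [apply: cvg_at_right_filter|apply: cvg_at_left_filter]; exact: ch.
- by move=> s _; rewrite derive1E; exact: derive_val.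
Qed.

(** The increment is the integral of [G s] over s in [0, 1]. Jensen's inequality and Tonelli's
    theorem then reduce its norm to the norms of the slices, each at most [K]. *)
Lemma Lp_le_mean (H G : R -> T -> R) (K : R) :
  measurable_fun setT (fun a : measurableTypeR R * T => G a.1 a.2) ->
  (forall (z : T) (s : R), is_derive s 1 (H ^~ z) (G s z)) ->
  (forall z, continuous (G ^~ z)) ->
  measurable_fun setT (fun z => H 1 z - H 0 z) ->
  (forall s, 0 <= s <= 1 -> Lp_le mu p K (G s)) ->
  Lp_le mu p K (fun z => H 1 z - H 0 z).
Proof.
move=> mG dH cG mH GK.
have K0 : 0 <= K by apply: Lp_le_ge0 (GK 0 _); rewrite lexx ler01.
pose D : set (measurableTypeR R) := `[0, 1]%classic.
have mD : measurable D by exact: measurable_itv.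
have lD : leb D = 1%E by rewrite /D lebesgue_measure_itv/= lte_fin ltr01 oppr0 adde0.
have FTC z : (\int[leb]_(s in `[0%R, 1%R]) (G s z)%:E = (H 1 z - H 0 z)%:E)%E.
  exact: (integral_is_derive01 (dH z) (cG z)).
have mGz z : measurable_fun setT (G ^~ z).
  apply: (measurableT_comp mG (g := fun s => (s, z))).
  exact: measurable_fun_pair.
apply/(Lp_le_powP mu p1 K0 mH).
pose f (a : measurableTypeR R * T) := (\1_D a.1 * `|G a.1 a.2| `^ p)%:E.
have mf : measurable_fun setT f.
  apply/measurable_EFinP; apply: measurable_funM.
    exact: (measurableT_comp (measurable_indic mD) measurable_fst).
  by apply/measurable_EFinP; exact: measurable_norm_powR.
have f0 a : (0 <= f a)%E by rewrite lee_fin mulr_ge0// powR_ge0.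
apply: (@le_trans _ _ (\int[mu]_z \int[leb]_s f (s, z))%E).
  apply: ge0_le_integral => //.
  - exact: measurable_norm_powR.
  - by apply: (measurable_fun_fubini_tonelli_G (m1 := leb) f mf f0).
  - move=> z _; rewrite -poweR_EFin -abse_EFin -FTC.
    apply: le_trans (powR_integral01 (mGz z)) _.
    by rewrite integral_indicM; under eq_integral do rewrite -EFinM.
rewrite -(fubini_tonelli (m1 := leb) (m2 := mu) f mf f0).
apply: (@le_trans _ _ (\int[leb]_(s in D) (cst (K `^ p)%:E s))%E); last first.
  by rewrite integral_cst//= lD mule1.
rewrite integral_indicM; apply: ge0_le_integral => //.
- by move=> s _; apply: integral_ge0.
- exact: (measurable_fun_fubini_tonelli_F (m2 := mu) f mf f0).
- apply/measurable_EFinP; apply: measurable_funM; last exact: measurable_cst.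
  exact: measurable_indic.
move=> s _ /=; rewrite /f/= indicE; case: (boolP (s \in D)) => sD; last first.
  by under eq_integral do rewrite mul0r; rewrite integral0 mul0e.
under eq_integral do rewrite mul1r.
rewrite mul1e; have sK : Lp_le mu p K (G s) by apply: GK; move: sD; rewrite inE /D/= in_itv.
exact: (Lp_le_powP mu p1 K0 sK.1).1 sK.
Qed.

End mean_value.

(** The hypothesis is integrated over k in [0, h]. Then k runs through [0, h] and k - h through
    [-h, 0]; these intervals meet only at 0, where G vanishes, so that the two integrals add up to
    one over [-h, h]. *)
Lemma ge0_le_average (R : realType) (G : measurableTypeR R -> \bar R) (c h : R) :
  measurable_fun setT G -> (forall k, 0 <= G k)%E -> G 0 = 0%E -> 0 < h -> 0 <= c ->
  (forall k, G h <= c%:E * (G k + G (k - h)%R))%E ->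
  (h%:E * G h <= c%:E * \int[lebesgue_measure]_(k in `[(- h)%R, h]) G k)%E.
Proof.
move=> mG G0 G00 h0 c0 Gh.
have mI (A : set R) : measurable (A : set (measurableTypeR R)) ->
    measurable_fun setT (\1_A : measurableTypeR R -> R).
  by move=> mA; exact: measurable_indic.
pose A : set (measurableTypeR R) := `[0, h]%classic.
have mA : measurable A by exact: measurable_itv.
have lA : lebesgue_measure A = h%:E.
  by rewrite /A lebesgue_measure_itv/= lte_fin h0 oppr0 adde0.
have -> : (h%:E * G h = \int[lebesgue_measure]_(k in A) cst (G h) k)%E.
  by rewrite integral_cst//= lA muleC.
have mGh : measurable_fun setT (fun k : measurableTypeR R => G (k - h)).
  exact: (measurableT_comp mG (lebesgue_measure_translation (- h)).1).
apply: (@le_trans _ _ (\int[lebesgue_measure]_(k in A) (c%:E * (G k + G (k - h)%R)))%E).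
  apply: ge0_le_integral; [exact: mA|by move=> k _; exact: G0|
    exact: measurable_cst| |by move=> k _; exact: Gh].
  by apply: measurable_funTS; apply: measurable_funeM; exact: emeasurable_funD.
rewrite ge0_integralZl_EFin//; last 2 first.
- by move=> k _; rewrite adde_ge0.
- by apply: measurable_funTS; exact: emeasurable_funD.
rewrite lee_wpmul2l ?lee_fin//.
pose g (k : measurableTypeR R) := ((\1_A (k + h)%R)%:E * G k)%E.
have m1 : measurable_fun setT (fun k : measurableTypeR R => (\1_A k)%:E * G k)%E.
  by apply: emeasurable_funM => //; apply/measurable_EFinP; exact: (mI _ mA).
have mg : measurable_fun setT g.
  apply: emeasurable_funM => //; apply/measurable_EFinP.
  exact: (measurableT_comp (mI _ mA) (lebesgue_measure_translation h).1).
rewrite ge0_integralD//; last 2 first.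
- exact: measurable_funTS.
- exact: measurable_funTS.
rewrite (integral_indicM A G) (integral_indicM A (fun k => G (k - h))).
have -> : (\int[lebesgue_measure]_k ((\1_A k)%:E * G (k - h)%R) =
    \int[lebesgue_measure]_k g k)%E.
  rewrite -(ge0_integral_preserving (lebesgue_measure_translation (- h)) mg); last first.
    by move=> k; rewrite mule_ge0// lee_fin.
  by apply: eq_integral => k _; rewrite /g subrK.
rewrite -ge0_integralD//; last 2 first.
- by move=> k _; rewrite mule_ge0// lee_fin.
- by move=> k _; rewrite mule_ge0// lee_fin.
rewrite integral_indicM; apply: ge0_le_integral => //.
- by move=> k _; rewrite adde_ge0// mule_ge0// lee_fin.
- exact: emeasurable_funD.
- apply: emeasurable_funM => //; apply/measurable_EFinP.
  by apply: mI; exact: measurable_itv.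
move=> k _; rewrite /g !indicE; have [->|k0] := eqVneq k 0.
  by rewrite G00 !mule0 adde0.
have kA x : (x \in A) = (0 <= x <= h) by rewrite mem_setE in_itv.
rewrite !kA mem_setE in_itv/=.
have [k1|k1] := leP 0 k; have [k2|k2] := leP k h; have [k3|k3] := leP 0 (k + h);
 have [k4|k4] := leP (k + h) h; have [k5|k5] := leP (- h) k => //=;
 rewrite ?mul0e ?mul1e ?adde0 ?add0e//; exfalso; move/eqP: k0; apply; lra.
Qed.

Section fractional.
Context d (T : measurableType d) (R : realType).
Variable mu : {sigma_finite_measure set T -> \bar R}.
Variable p : R.
Hypothesis p1 : 1 <= p.
Let p0 : 0 < p. Proof. exact: lt_le_trans p1. Qed.
Local Notation leb := (@lebesgue_measure R).
Variable phi : R -> T -> T.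
Hypothesis phi0 : forall z, phi 0 z = z.
Hypothesis phiD : forall h k z, phi (h + k) z = phi h (phi k z).
Hypothesis muphi : forall h, measure_preserving mu (phi h).
Hypothesis mphi : measurable_fun setT (fun a : measurableTypeR R * T => phi a.1 a.2).

Lemma powR_addn_le (a b : R) : 0 <= a -> 0 <= b ->
  (a + b) `^ p <= 2 `^ p * (a `^ p + b `^ p).
Proof.
move=> a0 b0; wlog ab : a b a0 b0 / a <= b.
  move=> H; have [|/ltW] := leP a b; first exact: H.
  by rewrite addrC [_ `^ p + _]addrC; exact: H.
apply: (@le_trans _ _ ((2 * b) `^ p)).
  by apply: ge0_ler_powR; rewrite ?nnegrE ?addr_ge0 ?mulr_ge0//; [exact: ltW|lra].
by rewrite powRM// ler_wpM2l ?powR_ge0// lerDr powR_ge0.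
Qed.

Variable v : T -> R.
Hypothesis mv : measurable_fun setT v.

(* The L^p modulus of continuity along the flow is subadditive and even, so its
   value at h is controlled by its average over [-h, h]. *)
Lemma Lp_le_fractional_gt0 (K h : R) : 0 <= K -> 0 < h <= 1 ->
  (\int[mu]_z \int[leb]_(h in `[(-1)%R, 1%R])
     (`|v (phi h z) - v z| `^ p / `|h| `^ (p / 2 + 1))%:E <= (K `^ p)%:E)%E ->
  Lp_le mu p (2 * (h `^ 2^-1) * K) (fun z => v (phi h z) - v z).
Proof.
move=> K0 /andP[h0 h1] vK.
pose D : set (measurableTypeR R) := `[-1, 1]%classic.
have mD : measurable D by exact: measurable_itv.
pose F (a : measurableTypeR R * T) := `|v (phi a.1 a.2) - v a.2| `^ p.
have mF0 : measurable_fun setT (fun a : measurableTypeR R * T => v (phi a.1 a.2) - v a.2).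
  apply: measurable_funB; first exact: measurableT_comp mphi.
  exact: measurableT_comp measurable_snd.
have mF : measurable_fun setT (EFin \o F) by exact: measurable_norm_powR.
have F0 a : 0 <= F a by exact: powR_ge0.
pose G k := (\int[mu]_z (F (k, z))%:E)%E.
have G0 k : (0 <= G k)%E by apply: integral_ge0 => z _; rewrite lee_fin.
have mG : measurable_fun setT G.
  exact: (measurable_fun_fubini_tonelli_F (m2 := mu) (EFin \o F) mF).
pose w (k : measurableTypeR R) := (`|k| `^ (p / 2 + 1))^-1.
have w0 k : 0 <= w k by rewrite invr_ge0 powR_ge0.
have mw : measurable_fun setT w.
  rewrite (_ : w = fun k => `|k| `^ (- (p / 2 + 1))); last first.
    by apply/funext => k; rewrite powRN.
  by apply: (measurableT_comp (measurable_powR _)); exact: (@measurableT_comp _ _ _ _ _ _ (@Num.norm R R)).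
have mI (A : set R) : measurable (A : set (measurableTypeR R)) ->
    measurable_fun setT (\1_A : measurableTypeR R -> R).
  by move=> mA; exact: measurable_indic.
have G00 : G 0 = 0%E.
  rewrite /G; under eq_integral do rewrite /F/= phi0 subrr normr0 powR0 ?gt_eqF//.
  by rewrite integral0.
(* By Tonelli's theorem, the seminorm is the integral of the modulus [G] against the kernel [w]. *)
have GK : (\int[leb]_(k in D) ((w k)%:E * G k) <= (K `^ p)%:E)%E.
  pose f (a : measurableTypeR R * T) := (\1_D a.1 * (w a.1 * F a))%:E.
  have mf : measurable_fun setT f.
    apply/measurable_EFinP; apply: measurable_funM.
      exact: (measurableT_comp (mI _ mD) measurable_fst).
    apply: measurable_funM; first exact: (measurableT_comp mw measurable_fst).
    exact/measurable_EFinP.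
  have f0 a : (0 <= f a)%E by rewrite lee_fin mulr_ge0// mulr_ge0.
  apply: le_trans vK; rewrite integral_indicM.
  have -> : (\int[leb]_s ((\1_D s)%:E * ((w s)%:E * G s)) =
      \int[leb]_s \int[mu]_z f (s, z))%E.
    apply: eq_integral => s _; rewrite /f/=.
    under [RHS]eq_integral do rewrite mulrA EFinM.
    rewrite ge0_integralZl_EFin// ?mulr_ge0//; last 2 first.
    - by move=> z _; rewrite lee_fin.
    - apply: (measurableT_comp mF (g := fun z => (s, z))).
      exact: measurable_fun_pair.
    by rewrite EFinM muleA.
  rewrite (fubini_tonelli (m1 := leb) (m2 := mu) f mf f0).
  rewrite le_eqVlt; apply/orP; left; apply/eqP; apply: eq_integral => z _.
  rewrite integral_indicM; apply: eq_integral => s _; rewrite /f/= -EFinM; congr EFin.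
  by rewrite /F/= /w [_^-1 * _]mulrC.
(* The increment from z to [phi h z] is split at [phi k z], which is also the image of [phi h z] at
   time [k - h]. By invariance, the second increment may be integrated over [phi h z] instead of
   z. *)
have Gh k : (G h <= (2 `^ p)%:E * (G k + G (k - h)%R))%E.
  have mFk j : measurable_fun setT (fun z => (F (j, z))%:E).
    apply: (measurableT_comp mF (g := fun z => (j, z))).
    exact: measurable_fun_pair.
  have -> : G (k - h) = (\int[mu]_z (F (k - h, phi h z))%:E)%E.
    rewrite (ge0_integral_preserving (muphi h) (mFk (k - h)))// => z.
    by rewrite lee_fin.
  have mFk' : measurable_fun setT (fun z => (F (k - h, phi h z))%:E).
    exact: (measurableT_comp (mFk (k - h)) (muphi h).1).
  rewrite -ge0_integralD//; last 2 first.
  - by move=> z _; rewrite lee_fin.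
  - by move=> z _; rewrite lee_fin.
  rewrite -ge0_integralZl_EFin ?powR_ge0//; last 2 first.
  - by move=> z _; rewrite -EFinD lee_fin addr_ge0.
  - exact: emeasurable_funD.
  apply: ge0_le_integral => //.
  - by move=> z _; rewrite lee_fin.
  - by apply: measurable_funeM; exact: emeasurable_funD.
  move=> z _; rewrite -EFinD -EFinM lee_fin /F/= -phiD subrK.
  apply: le_trans (powR_addn_le (normr_ge0 _) (normr_ge0 _)).
  apply: ge0_ler_powR; rewrite ?nnegrE ?addr_ge0//; first exact: ltW.
  rewrite distrC -[leLHS](_ : `|(v (phi k z) - v z) - (v (phi k z) - v (phi h z))| = _).
    exact: ler_normB.
  by rewrite -normrN; congr `|_|; ring.
(* For |k| <= h the kernel is at least its value at h. At k = 0, where [w] has the default value 0,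
   [G] vanishes. *)
have Gw (k : R) : k \in `[- h, h] -> (G k <= (h `^ (p / 2 + 1))%:E * ((w k)%:E * G k))%E.
  rewrite in_itv/= => kh; have [->|k0] := eqVneq k 0.
    by rewrite G00 !mule0.
  rewrite muleA -EFinM -[leLHS]mul1e lee_wpmul2r// lee_fin /w.
  rewrite ler_pdivlMr ?powR_gt0 ?normr_gt0// mul1r.
  by apply: ge0_ler_powR; rewrite ?nnegrE ?ler_norml//; [rewrite addr_ge0// divr_ge0// ltW|exact: ltW].
have intG : (\int[leb]_(k in `[(- h)%R, h]) G k <= (h `^ (p / 2 + 1) * K `^ p)%:E)%E.
  have mwG (A : set R) : measurable_fun (A : set (measurableTypeR R)) (fun k => ((w k)%:E * G k)%E).
    by apply: measurable_funTS; apply: emeasurable_funM => //; exact/measurable_EFinP.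
  apply: (@le_trans _ _ (\int[leb]_(k in `[(- h)%R, h]) ((h `^ (p / 2 + 1))%:E * ((w k)%:E * G k)))%E).
    apply: ge0_le_integral => //.
    - exact: measurable_funTS.
    - by apply: measurable_funeM.
  rewrite ge0_integralZl_EFin ?powR_ge0//; last by move=> k _; rewrite mule_ge0// lee_fin.
  rewrite EFinM lee_wpmul2l ?lee_fin ?powR_ge0//; apply: le_trans GK.
  apply: ge0_subset_integral => //.
  - by move=> k _; rewrite mule_ge0// lee_fin.
  - by move=> k; rewrite /D/= !in_itv/= => /andP[ka kb]; apply/andP; split; lra.
have hG : (h%:E * G h <= (2 `^ p)%:E * \int[leb]_(k in `[(- h)%R, h]) G k)%E.
  exact: (ge0_le_average mG G0 G00 h0 (powR_ge0 _ _) Gh).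
have mFh : measurable_fun setT (fun z => v (phi h z) - v z).
  apply: (measurableT_comp mF0 (g := fun z => (h, z))).
  exact: measurable_fun_pair.
apply/(Lp_le_powP mu p1 _ mFh); first by rewrite !mulr_ge0 ?powR_ge0.
(* The average contributes the factor h on the left; removing it from [h ^ (p / 2 + 1)] leaves
   [h ^ (p / 2)], the p-th power of the square root of h. *)
rewrite -(@lee_pmul2l _ h%:E) ?lte_fin//; apply: le_trans hG _.
apply: (@le_trans _ _ ((2 `^ p)%:E * (h `^ (p / 2 + 1) * K `^ p)%:E)%E).
  by rewrite lee_wpmul2l// lee_fin powR_ge0.
rewrite -!EFinM lee_fin !powRM ?mulr_ge0 ?powR_ge0// powRD; last by rewrite (gt_eqF h0) implybT.
rewrite powRr1 ?(ltW h0)// -powRrM [2^-1 * p]mulrC.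
by rewrite le_eqVlt; apply/orP; left; apply/eqP; ring.
Qed.

End fractional.

(** * Smooth functions *)

Section smooth_functions.
Context (R : realType) (N : nat).
Local Notation ts := (timespace R N).
Implicit Types (u f g : ts -> R) (o : option 'I_N).

(** A coinduction principle: smoothness follows from membership in any class of continuous functions
    that have partial derivatives in the class. *)
Lemma smooth_class (P : (ts -> R) -> Prop) :
  (forall f, P f -> continuous f /\
    forall o, (forall z, derivable f z (direction o)) /\ P (partial o f)) ->
  forall f, P f -> smooth f.
Proof.
move=> HP f Pf s; suff: P (foldr partial f s).
  by move=> /HP[cf df]; split=> // o z; have [] := df o.
by elim: s => //= o s /HP[_ /(_ o)[]].
Qed.

Lemma smooth_continuous f : smooth f -> continuous f.
Proof. by move=> /(_ [::])[]. Qed.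

Lemma smooth_derivable f o z : smooth f -> derivable f z (direction o).
Proof. by move=> /(_ [::])[]. Qed.

Lemma smooth_partial o f : smooth f -> smooth (partial o f).
Proof.
by move=> sf s; have := sf (rcons s o); rewrite foldr_rcons.
Qed.

(** The derivative of a product is a sum of products. The algebra generated by the smooth functions
    is therefore closed under partial derivatives, as [smooth_class] demands, whereas the class of
    products is not. *)
Inductive smooth_alg : (ts -> R) -> Prop :=
| smooth_alg_base f : smooth f -> smooth_alg f
| smooth_algD f g : smooth_alg f -> smooth_alg g -> smooth_alg (fun z => f z + g z)
| smooth_algM f g : smooth_alg f -> smooth_alg g -> smooth_alg (fun z => f z * g z).

Lemma smooth_algP f : smooth_alg f -> smooth f.
Proof.
apply: smooth_class => {}f; elim=> {f}[f sf|f g _ [cf df] _ [cg dg]|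
    f g af [cf df] ag [cg dg]].
- split; first exact: smooth_continuous.
  move=> o; split; first by move=> z; exact: smooth_derivable.
  by apply: smooth_alg_base; exact: smooth_partial.
- split; first by move=> z; apply: continuousD; [exact: cf|exact: cg].
  move=> o; have [{}df pf] := df o; have [{}dg pg] := dg o; split.
    by move=> z; exact: derivableD.
  rewrite (_ : partial _ _ = fun z => partial o f z + partial o g z).
    exact: smooth_algD.
  by apply/funext => z; rewrite /partial deriveD.
- split; first by move=> z; apply: continuousM; [exact: cf|exact: cg].
  move=> o; have [{}df pf] := df o; have [{}dg pg] := dg o; split.
    by move=> z; exact: derivableM.
  rewrite (_ : partial _ _ = fun z => f z * partial o g z + g z * partial o f z).
    by apply: smooth_algD; exact: smooth_algM.
  by apply/funext => z; rewrite /partial deriveM.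
Qed.

Lemma smoothD f g : smooth f -> smooth g -> smooth (fun z => f z + g z).
Proof.
by move=> sf sg; apply: smooth_algP; apply: smooth_algD; exact: smooth_alg_base.
Qed.

Lemma smoothM f g : smooth f -> smooth g -> smooth (fun z => f z * g z).
Proof.
by move=> sf sg; apply: smooth_algP; apply: smooth_algM; exact: smooth_alg_base.
Qed.

Lemma partial_cst o (c : R) : partial o (fun _ : ts => c) = fun=> 0.
Proof. by apply/funext => z; rewrite /partial derive_cst. Qed.

Lemma smooth_cst (c : R) : smooth (fun _ : ts => c).
Proof.
apply: (@smooth_class (fun f => exists c, f = fun=> c)); last by exists c.
move=> _ [{}c ->]; split; first exact: cst_continuous.
by move=> o; split; [move=> z; exact: derivable_cst|exists 0; exact: partial_cst].
Qed.

Lemma smoothZ (a : R) f : smooth f -> smooth (fun z => a * f z).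
Proof. by move=> sf; exact: smoothM (smooth_cst a) sf. Qed.

Lemma smoothN f : smooth f -> smooth (fun z => - f z).
Proof.
by move=> /(smoothZ (-1)); congr smooth; apply/funext => z; rewrite mulN1r.
Qed.

Lemma smoothB f g : smooth f -> smooth g -> smooth (fun z => f z - g z).
Proof. by move=> sf /smoothN; exact: smoothD. Qed.

Lemma smooth_sum (I : Type) (s : seq I) (P : pred I) (f : I -> ts -> R) :
  (forall i, P i -> smooth (f i)) -> smooth (fun z => \sum_(i <- s | P i) f i z).
Proof.
move=> sf; elim: s => [|i s IH].
  rewrite (_ : (fun z => _) = fun=> 0); first exact: smooth_cst.
  by apply/funext => z; rewrite big_nil.
rewrite (_ : (fun z => _) = fun z => (if P i then f i z else 0) +
    \sum_(i <- s | P i) f i z); last first.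
  by apply/funext => z; rewrite big_cons; case: ifP => _; rewrite ?add0r.
apply: smoothD IH; case Pi: (P i); [exact: sf|exact: smooth_cst].
Qed.

Lemma smooth_prod (I : Type) (s : seq I) (P : pred I) (f : I -> ts -> R) :
  (forall i, P i -> smooth (f i)) -> smooth (fun z => \prod_(i <- s | P i) f i z).
Proof.
move=> sf; elim: s => [|i s IH].
  rewrite (_ : (fun z => _) = fun=> 1); first exact: smooth_cst.
  by apply/funext => z; rewrite big_nil.
rewrite (_ : (fun z => _) = fun z => (if P i then f i z else 1) *
    \prod_(i <- s | P i) f i z); last first.
  by apply/funext => z; rewrite big_cons; case: ifP => _; rewrite ?mul1r.
apply: smoothM IH; case Pi: (P i); [exact: sf|exact: smooth_cst].
Qed.

Lemma smoothX n f : smooth f -> smooth (fun z => f z ^+ n).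
Proof.
move=> sf; elim: n => [|n IH].
  by rewrite (_ : (fun z => _) = fun=> 1); [exact: smooth_cst|apply/funext => z; rewrite expr0].
rewrite (_ : (fun z => _) = fun z => f z * f z ^+ n); first exact: smoothM.
by apply/funext => z; rewrite exprS.
Qed.

Definition coord o (z : ts) : R := if o is Some k then z.2 k ord0 else z.1.

Lemma coordD o (z w : ts) : coord o (z + w) = coord o z + coord o w.
Proof. by case: o => //= k; rewrite mxE. Qed.

Lemma coordZ o a (z : ts) : coord o (a *: z) = a * coord o z.
Proof. by case: o => //= k; rewrite mxE. Qed.

Lemma coord_direction o o' : coord o (direction o') = (o == o')%:R.
Proof. by case: o o' => [k|] [l|]//=; rewrite mxE ?andbT// eqE. Qed.

Lemma coord_inj (z w : ts) : (forall o, coord o z = coord o w) -> z = w.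
Proof.
case: z w => [t x] [s y] H; congr pair; first exact: (H None).
by apply/colP => k; exact: (H (Some k)).
Qed.

Lemma coord_sum (I : Type) (s : seq I) (P : pred I) o (F : I -> ts) :
  coord o (\sum_(i <- s | P i) F i) = \sum_(i <- s | P i) coord o (F i).
Proof.
elim/big_rec2: _ => [|i x y _ <-]; last by rewrite coordD.
by case: o => //= k; rewrite mxE.
Qed.

Lemma continuous_coord o : continuous (coord o).
Proof.
move=> z; rewrite /coord; case: o => [k|]; last exact: cvg_fst.
apply: (@continuous_comp _ _ _ (fun z : ts => z.2) (fun x : 'cV[R]_N => x k ord0)).
  exact: cvg_snd.
exact: coord_continuous.
Qed.

Lemma is_derive_line f (z v : ts) (s : R) : derivable f (s *: v + z) v ->
  is_derive s 1 (fun h => f (h *: v + z)) ('D_v f (s *: v + z)).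
Proof.
move=> df; have E : (fun h : R => h^-1 *: (((fun h => f (h *: v + z)) \o shift s) (h *: 1) -
    f (s *: v + z))) = (fun h => h^-1 *: ((f \o shift (s *: v + z)) (h *: v) - f (s *: v + z))).
  by apply/funext => h /=; rewrite [_%:A]mulr1 scalerDl addrA.
by apply: DeriveDef; rewrite /derivable /derive E.
Qed.

Lemma is_derive_line0 f (z v : ts) (d : R) :
  is_derive (0 : R) 1 (fun h => f (h *: v + z)) d -> is_derive z v f d.
Proof.
have E : (fun h : R => h^-1 *: (((fun h => f (h *: v + z)) \o shift 0) (h *: 1) -
    f (0 *: v + z))) = (fun h => h^-1 *: ((f \o shift z) (h *: v) - f z)).
  by apply/funext => h /=; rewrite addr0 [_%:A]mulr1 scale0r add0r.
by case=> D1 D2; apply: DeriveDef; move: D1 D2; rewrite /derivable /derive E.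
Qed.

Lemma is_derive_coord o (z v : ts) (g : R -> R) (dg : R) :
  is_derive (coord o z) 1 g dg ->
  is_derive z v (fun y => g (coord o y)) (coord o v * dg).
Proof.
move=> Dg; apply: is_derive_line0.
rewrite (_ : (fun h => _) = g \o (fun h => h * coord o v + coord o z)); last first.
  by apply/funext => h /=; rewrite coordD coordZ.
have D1 : is_derive (0 : R) 1 (fun h : R => h * coord o v + coord o z) (coord o v).
  rewrite (_ : (fun h => _) = coord o v *: (id : R -> R) + cst (coord o z)).
    by apply: is_derive_eq; rewrite addr0 [_%:A]mulr1.
  by apply/funext => h; rewrite /= mulrC.
have {}Dg : is_derive (0 * coord o v + coord o z) 1 g dg by rewrite mul0r add0r.
by rewrite mulrC; exact: is_derive1_comp.
Qed.

Lemma norm_direction_le o : `|direction o : ts| <= 1.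
Proof.
rewrite prod_normE ge_max; case: o => [k|] /=; rewrite ?normr0 ?normr1 ?lexx ler01 ?andbT//=.
rewrite {1}/Num.norm/= mx_normrE; apply: bigmax_le => // -[i j] _ /=.
by rewrite mxE; case: (_ && _); rewrite ?normr1 ?normr0 ?lexx ?ler01.
Qed.

Lemma smooth_shift u (w : ts) : smooth u ->
  smooth (fun y => u (y + w)) /\
  forall o, partial o (fun y => u (y + w)) = fun y => partial o u (y + w).
Proof.
have E f (v y : ts) : (fun h : R => h^-1 *: (((fun y => f (y + w)) \o shift y) (h *: v) - f (y + w)))
    = (fun h => h^-1 *: ((f \o shift (y + w)) (h *: v) - f (y + w))).
  by apply/funext => h /=; rewrite addrA.
have pE f o : partial o (fun y => f (y + w)) = fun y => partial o f (y + w).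
  by apply/funext => y; rewrite /partial /derive E.
move=> su; split; last by move=> o; exact: pE.
apply: (@smooth_class (fun f => exists2 v, smooth v & f = fun y => v (y + w))); last by exists u.
move=> _ [v sv ->]; split.
  move=> y; apply: continuous_comp; last exact: smooth_continuous.
  by apply: continuousD; [exact: id|exact: cst_continuous].
move=> o; split; last by exists (partial o v); [exact: smooth_partial|exact: pE].
by move=> y; rewrite /derivable E; exact: smooth_derivable.
Qed.

Lemma smooth_mvt u o (z : ts) (a : R) : smooth u ->
  exists2 c : R, `|c| <= `|a| &
    u (a *: direction o + z) - u z = a * partial o u (c *: direction o + z).
Proof.
move=> su.
have D (s : R) : is_derive s 1 (fun h => u (h *: direction o + z))
    (partial o u (s *: direction o + z)).
  by apply: is_derive_line; exact: smooth_derivable.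
have C : continuous (fun h : R => u (h *: direction o + z)).
  move=> s; apply: differentiable_continuous; apply/derivable1_diffP.
  exact: ex_derive.
have [ao|ao|ao] := ltgtP a 0.
- have [c] := MVT ao (fun x _ => D x) (continuous_subspaceT C).
  rewrite in_itv/= => /andP[c1 c2]; rewrite scale0r add0r sub0r mulrN => E.
  exists c; first by rewrite !ltr0_norm// lerN2 ltW.
  by rewrite -[LHS]opprB E opprK mulrC.
- have [c] := MVT ao (fun x _ => D x) (continuous_subspaceT C).
  rewrite in_itv/= => /andP[c1 c2]; rewrite scale0r add0r subr0 => E.
  by exists c; [rewrite !gtr0_norm// ltW|rewrite E mulrC].
- by exists 0; rewrite ao ?normr0//; rewrite scale0r add0r subrr mul0r.
Qed.

(* The coordinates are moved one after the other. *)
Lemma smooth_frechet_seq u (z : ts) (l : seq (option 'I_N)) (e : R) :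
  smooth u -> 0 < e -> exists2 del, 0 < del & forall a : option 'I_N -> R,
    \sum_(o <- l) `|a o| < del ->
    `|u (\sum_(o <- l) a o *: direction o + z) - u z -
      \sum_(o <- l) a o * partial o u z| <= e * \sum_(o <- l) `|a o|.
Proof.
move=> su e0; elim: l => [|o l [d1 d10 IH]].
  exists 1 => // a _; rewrite !big_nil add0r !subrr normr0 mulr0//.
have [d2 d20 H2] : exists2 d2, 0 < d2 & forall y, `|y| < d2 ->
    `|partial o u (y + z) - partial o u z| <= e.
  have cp : continuous (partial o u) by apply: smooth_continuous; exact: smooth_partial.
  have /cvgrPdist_le /(_ _ e0) /nbhs_normP[d2 /= d20 H] := cp z.
  exists d2 => // y yd; rewrite distrC; apply: H => /=.
  by rewrite opprD addrCA subrr addr0 normrN.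
exists (Num.min d1 d2); first by rewrite lt_min d10.
move=> a; rewrite !big_cons lt_min => /andP[ad1 ad2].
set w := \sum_(j <- l) a j *: direction j.
set S := \sum_(j <- l) `|a j| in ad1 ad2 *.
have S0 : 0 <= S by apply: sumr_ge0.
have wS : `|w| <= S.
  apply: le_trans (ler_norm_sum _ _ _) _; apply: ler_sum => j _.
  by rewrite normrZ ler_piMr// norm_direction_le.
have /IH IHa : S < d1 by apply: le_lt_trans ad1; rewrite lerDr.
have [c cS Ec] := smooth_mvt o (w + z) (a o) su.
rewrite -(addrA (a o *: _)).
rewrite (_ : _ - _ - _ = (u (w + z) - u z - \sum_(j <- l) a j * partial j u z) +
   a o * (partial o u (c *: direction o + (w + z)) - partial o u z)); last first.
  by rewrite mulrBr -Ec; ring.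
apply: le_trans (ler_normD _ _) _; rewrite [leLHS]addrC [e * (_ + _)]mulrDr; apply: lerD => //.
rewrite normrM mulrC ler_wpM2r// addrA; apply: H2.
apply: le_lt_trans ad2; apply: le_trans (ler_normD _ _) _; apply: lerD => //.
by rewrite normrZ (le_trans _ cS)// ler_piMr// norm_direction_le.
Qed.

Lemma cvg_fin_sum (T I : Type) (F : set_system T) (FF : Filter F) (s : seq I)
    (f : I -> T -> R) (l : I -> R) :
  (forall i, f i x @[x --> F] --> l i) ->
  (\sum_(i <- s) f i x) @[x --> F] --> \sum_(i <- s) l i.
Proof.
move=> fl; elim: s => [|i s IH].
  rewrite big_nil (_ : (fun x => _) = fun=> 0); first exact: cvg_cst.
  by apply/funext => x; rewrite big_nil.
rewrite big_cons (_ : (fun x => _) = fun x => f i x + \sum_(i <- s) f i x).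
  exact: cvgD.
by apply/funext => x; rewrite big_cons.
Qed.

(** The chain rule. As smoothness only speaks of partial derivatives, the first-order expansion
    comes from [smooth_frechet_seq]. Divided by h, its error is at most a small multiple of the sum
    of the absolute difference quotients of the coordinates, which stays below [S + 1]. *)
Lemma is_derive_curve u (g : R -> ts) (s : R) (dg : option 'I_N -> R) :
  smooth u -> (forall o, is_derive s 1 (fun h => coord o (g h)) (dg o)) ->
  is_derive s 1 (fun h => u (g h)) (\sum_o dg o * partial o u (g s)).
Proof.
move=> su Dg; pose a (h : R) o := coord o (g (h + s)) - coord o (g s).
have gE h : g (h + s) = \sum_o a h o *: direction o + g s.
  apply: coord_inj => o; rewrite coordD coord_sum (bigD1 o)//= big1 => [|o' oo'].
    by rewrite coordZ coord_direction eqxx mulr1 addr0 subrK.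
  by rewrite coordZ coord_direction eq_sym (negbTE oo') mulr0.
have ca o : (h^-1 * a h o) @[h --> 0^'] --> dg o.
  have [C <-] := Dg o; rewrite (_ : (fun h => _) = (fun h => h^-1 *:
      (((fun h => coord o (g h)) \o shift s) (h *: 1) - coord o (g s)))).
    exact: C.
  by apply/funext => h /=; rewrite [_%:A]mulr1.
pose S := \sum_o `|dg o|.
have S0 : 0 <= S by apply: sumr_ge0.
have cS : (\sum_o `|h^-1 * a h o|) @[h --> 0^'] --> S.
  by apply: cvg_fin_sum => o; apply: cvg_norm; exact: ca.
pose rho (h : R) := h^-1 * (u (g (h + s)) - u (g s) - \sum_o a h o * partial o u (g s)).
have crho : rho h @[h --> 0^'] --> 0.
  apply/cvgrPdist_le => e e0.
  have S10 : 0 < S + 1 by rewrite ltr_wpDl.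
  have e10 : 0 < e / (S + 1) by rewrite divr_gt0.
  have [del del0 H] := smooth_frechet_seq (g s) (index_enum (option 'I_N)) su e10.
  near=> h.
  have h0 : h != 0 by near: h; exact: nbhs_dnbhs_neq.
  have hS : \sum_o `|h^-1 * a h o| <= S + 1.
    near: h; move/cvgrPdist_le : cS => /(_ 1 ltr01); apply: filterS => h.
    by rewrite distrC ler_distl => /andP[_].
  have aE : \sum_o `|a h o| = `|h| * \sum_o `|h^-1 * a h o|.
    by rewrite mulr_sumr; apply: eq_bigr => o _; rewrite -normrM mulrA mulfV// mul1r.
  have /H : \sum_o `|a h o| < del.
    apply: (@le_lt_trans _ _ (`|h| * (S + 1))); first by rewrite aE ler_wpM2l.
    rewrite -ltr_pdivlMr//; near: h.
    by apply: dnbhs0_lt; rewrite divr_gt0.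
  rewrite sub0r normrN /rho normrM normfV -gE aE => Hh.
  rewrite ler_pdivrMl ?normr_gt0//; apply: le_trans Hh _.
  by rewrite mulrCA ler_wpM2l// mulrAC ler_pdivrMr// ler_wpM2l// ltW.
have cL : h^-1 * (u (g (h + s)) - u (g s)) @[h --> 0^'] --> \sum_o dg o * partial o u (g s).
  rewrite (_ : (fun h => _) = fun h => rho h + \sum_o (h^-1 * a h o) * partial o u (g s)).
    rewrite -[X in _ --> X]add0r; apply: cvgD => //.
    by apply: cvg_fin_sum => o; apply: cvgMl; exact: ca.
  apply/funext => h; rewrite /rho [h^-1 * (_ - \sum_o _)]mulrBr mulr_sumr.
  set A := \sum_i h^-1 * _; set B := \sum_o _; suff -> : A = B by rewrite subrK.
  by apply: eq_bigr => o _; rewrite mulrA.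
have E : (fun h : R => h^-1 *: (((fun h => u (g h)) \o shift s) (h *: 1) - u (g s))) =
    (fun h => h^-1 * (u (g (h + s)) - u (g s))).
  by apply/funext => h /=; rewrite [_%:A]mulr1.
apply: DeriveDef; first by rewrite /derivable E; apply/cvg_ex; eexists; exact: cL.
by rewrite /derive E; apply/cvg_lim => //.
Unshelve. all: by end_near. Qed.

Lemma smooth_mvt2 u o o' (z : ts) (h : R) : smooth u ->
  exists c : R * R, [/\ `|c.1| <= `|h|, `|c.2| <= `|h| &
    u (h *: direction o + (h *: direction o' + z)) - u (h *: direction o + z) -
    (u (h *: direction o' + z) - u z) =
    h * (h * partial o' (partial o u) (c.2 *: direction o' + (c.1 *: direction o + z)))].
Proof.
move=> su; have [s1 p1] := smooth_shift (h *: direction o') su.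
have [c1 c1h E1] := smooth_mvt o z h (smoothB s1 su).
have [c2 c2h E2] := smooth_mvt o' (c1 *: direction o + z) h (smooth_partial o su).
exists (c1, c2); split=> //=; rewrite -E2.
rewrite (_ : partial o u (h *: _ + _) - _ =
   partial o (fun z => u (z + h *: direction o') - u z) (c1 *: direction o + z)).
  rewrite -E1 [z + _]addrC; congr (_ - _ - _); congr u; rewrite -addrA; congr (_ + _).
  by rewrite addrC.
rewrite [RHS]/partial deriveB; [|exact: smooth_derivable..].
have := congr1 (fun f => f (c1 *: direction o + z)) (p1 o).
by rewrite /partial => ->; rewrite [_ + h *: direction o']addrC.
Qed.

Lemma ler_dist_half (x y w e : R) :
  `|w - y| <= e / 2 -> `|w - x| <= e / 2 -> `|x - y| <= e.
Proof.
move=> wy wx; rewrite (splitr e) -(subrK w x) -addrA.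
by apply: le_trans (ler_normD _ _) _; apply: lerD => //; rewrite distrC.
Qed.

(** Schwarz's theorem. The second difference over a square of side [h] is symmetric in the two
    directions, and equals [h ^+ 2] times either mixed derivative at a point of a small
    neighbourhood of z; continuity brings both values within e / 2 of those at z. *)
Lemma partialC u o o' : smooth u -> partial o (partial o' u) = partial o' (partial o u).
Proof.
move=> su; apply/funext => z; apply/eqP; rewrite -subr_eq0 -normr_le0.
apply/ler_addgt0Pr => e e0; rewrite add0r.
have cP i j : exists2 d, 0 < d & forall y, `|y| < d ->
    `|partial i (partial j u) (y + z) - partial i (partial j u) z| <= e / 2.
  have cp : continuous (partial i (partial j u)).
    by apply: smooth_continuous; apply: smooth_partial; exact: smooth_partial.
  have e20 : 0 < e / 2 by rewrite divr_gt0.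
  have /cvgrPdist_le /(_ _ e20) /nbhs_normP[d /= d0 H] := cp z.
  exists d => // y yd; rewrite distrC; apply: H => /=.
  by rewrite opprD addrCA subrr addr0 normrN.
have [d1 d10 H1] := cP o o'; have [d2 d20 H2] := cP o' o.
(* Two displacements of length at most [h] add up to at most half of the smaller radius. *)
pose h := Num.min d1 d2 / 4.
have m0 : 0 < Num.min d1 d2 by rewrite lt_min d10.
have h0 : 0 < h by rewrite divr_gt0.
have nrm (i j : option 'I_N) (a b : R) : `|a| <= `|h| -> `|b| <= `|h| ->
    `|a *: (direction i : ts) + b *: direction j| < Num.min d1 d2.
  rewrite (gtr0_norm h0) => ah bh; apply: le_lt_trans (ler_normD _ _) _.
  apply: (@le_lt_trans _ _ (h + h)); last by rewrite /h; lra.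
  have nd c k : `|c| <= h -> `|c *: (direction k : ts)| <= h.
    by move=> ch; rewrite normrZ; apply: le_trans ch; rewrite ler_piMr// norm_direction_le.
  by apply: lerD; exact: nd.
have [[a b] /= [ah bh E1]] := smooth_mvt2 o o' z h su.
have [[a' b'] /= [ah' bh' E2]] := smooth_mvt2 o' o z h su.
have E : partial o' (partial o u) (b *: direction o' + (a *: direction o + z)) =
         partial o (partial o' u) (b' *: direction o + (a' *: direction o' + z)).
  apply: (mulfI (lt0r_neq0 h0)); apply: (mulfI (lt0r_neq0 h0)).
  apply: (etrans (esym E1)); apply: etrans E2.
  rewrite (addrCA (h *: direction o)).
  by move: (u _) (u _) (u _) (u _) => A1 A2 A3 A4; ring.
have /H1 : `|b' *: (direction o : ts) + a' *: direction o'| < d1.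
  by apply: lt_le_trans (nrm _ _ _ _ bh' ah') _; rewrite ge_min lexx.
have /H2 : `|b *: (direction o' : ts) + a *: direction o| < d2.
  by apply: lt_le_trans (nrm _ _ _ _ bh ah) _; rewrite ge_min lexx orbT.
rewrite -!addrA E.
exact: ler_dist_half.
Qed.

End smooth_functions.

(** * The flow of Y *)

Lemma big_option (V : nmodType) (T : finType) (F : option T -> V) :
  \sum_o F o = F None + \sum_k F (Some k).
Proof.
rewrite (bigD1 None)//=; congr (_ + _).
rewrite (reindex_omap Some id)/=; last by case.
by apply: eq_bigl => k; rewrite eqxx.
Qed.

Lemma is_derive_affine (R : realType) (a c s : R) :
  is_derive s 1 (fun h : R => a + h * c) c.
Proof.
rewrite (_ : (fun h => _) = cst a + c *: (id : R -> R)); last first.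
  by apply/funext => h; rewrite /= mulrC.
have H1 : is_derive s (1 : R) (c *: (id : R -> R)) (c *: (1 : R)).
  exact: is_deriveZ.
have H2 : is_derive s (1 : R) (cst a : R -> R) 0 by exact: is_derive_cst.
by apply: (is_derive_eq (is_deriveD H2 H1)); rewrite add0r [_%:A]mulr1.
Qed.

Section exponential.
Context (R : realType) (N : nat) (B : 'M[R]_N) (b : 'I_N -> nat) (r : nat).
(** [b k] is the index of the block that contains the coordinate k. The block form of B enters as
    follows: B raises this index by one, it is at most r, and the coordinates are ordered by it. *)
Hypothesis B0 : forall k l, b k != (b l).+1 -> B k l = 0.
Hypothesis br : forall k, (b k <= r)%N.
Hypothesis bmono : forall k l : 'I_N, (b k < b l)%N -> (k < l)%N.

Lemma expr_mx0 j k l : b k != (b l + j)%N -> (B ^+ j) k l = 0.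
Proof.
elim: j k l => [|j IH] k l.
  rewrite addn0; have [->|kl] := eqVneq k l; first by rewrite eqxx.
  by rewrite expr0 mxE (negbTE kl).
move=> kl; rewrite exprS mxE big1// => m _.
have [km|km] := eqVneq (b k) (b m).+1; last by rewrite B0// mul0r.
rewrite IH ?mulr0//; apply: contra kl => /eqP ml.
by rewrite km ml addnS.
Qed.

Lemma exprS_mx0 j : (r < j)%N -> B ^+ j = 0.
Proof.
move=> rj; apply/matrixP => k l; rewrite [RHS]mxE expr_mx0//.
by rewrite neq_ltn (leq_ltn_trans (br k))// (leq_trans rj)// leq_addl.
Qed.

Lemma exprZ_mx s j : (s *: B) ^+ j = s ^+ j *: B ^+ j.
Proof.
elim: j => [|j IH]; first by rewrite !expr0 scale1r.
by rewrite !exprS IH -[LHS]/(_ *m _) -scalemxAl -scalemxAr scalerA.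
Qed.

Definition exp_coef (j : nat) (s : R) : R := s ^+ j / j`!%:R.

Lemma exp_coefD n s t :
  \sum_(j < n.+1) exp_coef (n - j) s * exp_coef j t = exp_coef n (s + t).
Proof.
rewrite /exp_coef exprDn mulr_suml; apply: eq_bigr => j _.
have jn : (j <= n)%N by rewrite -ltnS.
have f0 m : m`!%:R != 0 :> R by rewrite pnatr_eq0 -lt0n fact_gt0.
rewrite -(bin_fact jn) -[_ *+ 'C(n, j)]mulr_natr !natrM.
have c0 : 'C(n, j)%:R != 0 :> R by rewrite pnatr_eq0 -lt0n bin_gt0.
by field; rewrite c0 !f0.
Qed.

Lemma expmx_sum s : expmx (s *: B) = \sum_(j < r.+1) exp_coef j s *: B ^+ j.
Proof.
apply/cvg_lim; first exact: norm_hausdorff.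
apply: (@cvg_near_cst _ _ _ _ _ _).
exists r.+1 => // n /= rn; rewrite /series/= -[RHS](big_mkord xpredT (fun j => exp_coef j s *: B ^+ j)).
rewrite (@big_cat_nat _ _ _ r.+1 0 n)//= [X in _ + X]big1_seq ?addr0.
  by apply: eq_bigr => j _; rewrite exprZ_mx scalerA mulrC.
by move=> j; rewrite mem_index_iota => /andP[_ /andP[rj _]]; rewrite exprZ_mx exprS_mx0// !scaler0.
Qed.

(** [B ^+ j] sends block i to block i + j, so exactly one power of B can contribute to a given
    entry. *)
Lemma expmxE s k l : expmx (s *: B) k l =
  if (b l <= b k)%N then exp_coef (b k - b l) s * (B ^+ (b k - b l)) k l else 0.
Proof.
rewrite expmx_sum summxE; case: leqP => kl.
  have jr : (b k - b l < r.+1)%N by rewrite ltnS (leq_trans (leq_subr _ _)).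
  rewrite (bigD1 (Ordinal jr))//= mxE big1 ?addr0// => j.
  move=> /eqP jN; rewrite mxE expr_mx0 ?mulr0//; apply/eqP => E; apply: jN.
  by apply: val_inj => /=; rewrite E addKn.
rewrite big1// => j _; rewrite mxE expr_mx0 ?mulr0//.
by rewrite neq_ltn (leq_trans kl)// leq_addr.
Qed.

Lemma expmx0B : expmx (0 *: B) = 1%:M.
Proof.
apply/matrixP => k l; rewrite expmxE mxE; have [kl|lk|E] := ltngtP (b l) (b k).
- rewrite /exp_coef expr0n subn_eq0 leqNgt kl/= mul0r mul0r.
  by case: eqP kl => [->|//]; rewrite ltnn.
- by case: eqP lk => [->|//]; rewrite ltnn.
- by rewrite E subnn expr0 /exp_coef expr0 fact0 invr1 !mul1r mxE.
Qed.

(** Entrywise, with n = b k - b l: the block of the intermediate index m determines how n splits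
    into n - j and j, and the sum over j is the binomial formula [exp_coefD]. *)
Lemma expmxD s t : expmx ((s + t) *: B) = expmx (s *: B) *m expmx (t *: B).
Proof.
apply/matrixP => k l; rewrite [RHS]mxE expmxE; case: leqP => kl; last first.
  rewrite big1// => m _; rewrite !expmxE; case: leqP => mk; last by rewrite mul0r.
  by case: leqP => lm; [move: (leq_trans lm mk); rewrite leqNgt kl|rewrite mulr0].
set n := (b k - b l)%N.
have E m : expmx (s *: B) k m * expmx (t *: B) m l =
    \sum_(j < n.+1) exp_coef (n - j) s * exp_coef j t * ((B ^+ (n - j)) k m * (B ^+ j) m l).
  have [/andP[lm mk]|H] := boolP ((b l <= b m) && (b m <= b k))%N.
    have jn : (b m - b l < n.+1)%N by rewrite ltnS /n leq_sub2r.
    rewrite (bigD1 (Ordinal jn))//= big1 => [|j /eqP jN].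
      rewrite addr0 !expmxE mk lm; have -> : (n - (b m - b l) = b k - b m)%N by rewrite /n; lia.
      by rewrite mulrACA.
    rewrite [(B ^+ j) m l]expr_mx0 ?mulr0//; apply/eqP => E; apply: jN.
    by apply: val_inj => /=; rewrite E addKn.
  transitivity (0 : R).
    rewrite !expmxE; move: H; rewrite negb_and -!ltnNge => /orP[H|H].
      by rewrite [X in _ * X]ifF ?mulr0//; apply/negbTE; rewrite -ltnNge.
    by rewrite ifF ?mul0r//; apply/negbTE; rewrite -ltnNge.
  rewrite big1// => j _; have jn := ltn_ord j.
  have [ml|ml] := eqVneq (b m) (b l + j)%N; last by rewrite [(B ^+ j) m l]expr_mx0// !mulr0.
  by move: H; rewrite ml leq_addr/= /n in jn * => H; exfalso; lia.
under eq_bigr do rewrite E.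
rewrite exchange_big/= -exp_coefD mulr_suml; apply: eq_bigr => j _.
rewrite -mulr_sumr; congr (_ * _).
have jn : (j <= n)%N by rewrite -ltnS.
by rewrite -{1}(subnK jn) exprD mxE.
Qed.

Lemma unitriangular_expmx s : unitriangular (expmx (s *: B)).
Proof.
move=> k l kl; rewrite expmxE; case: leqP => lk; last first.
  by case: eqP lk => [->|//]; rewrite ltnn.
have [E|NE] := eqVneq (b k) (b l).
  by rewrite E subnn expr0 /exp_coef expr0 fact0 invr1 !mul1r mxE.
have /bmono : (b l < b k)%N by rewrite ltn_neqAle eq_sym NE.
by rewrite ltnNge kl.
Qed.

Lemma is_derive_expmx (x : 'cV[R]_N) (s : R) k :
  is_derive s 1 (fun h => (expmx (h *: B) *m x) k ord0)
    ((B *m (expmx (s *: B) *m x)) k ord0).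
Proof.
have E h : (expmx (h *: B) *m x) k ord0 = \sum_(j < r.+1) exp_coef j h * (B ^+ j *m x) k ord0.
  rewrite expmx_sum mulmx_suml summxE; apply: eq_bigr => j _.
  by rewrite -scalemxAl mxE.
have -> : (B *m (expmx (s *: B) *m x)) k ord0 =
    \sum_(j < r.+1) (if (j : nat) is i.+1 then exp_coef i s else 0) * (B ^+ j *m x) k ord0.
  rewrite big_ord_recl mul0r add0r.
  rewrite expmx_sum big_ord_recr/= mulmxDl mulmxDr -scalemxAl -scalemxAr mulmxA.
  rewrite [B *m (B ^+ r *m x)]mulmxA -[B *m B ^+ r]exprS exprS_mx0// mul0mx scaler0 addr0.
  rewrite mulmx_sumr mulmx_suml summxE; apply: eq_bigr => j _.
  by rewrite -scalemxAr -scalemxAl mxE -[B *m B ^+ j]exprS.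
rewrite (_ : (fun h => _) = \sum_(j < r.+1) (fun h => exp_coef j h * (B ^+ j *m x) k ord0)); last first.
  by apply/funext => h; rewrite E fct_sumE.
apply: is_derive_sum => j; set y := (_ *m _) _ _.
case: (j : nat) => [|i].
  rewrite mul0r (_ : (fun h => _) = cst y); first exact: is_derive_cst.
  by apply/funext => h; rewrite /exp_coef expr0 fact0 invr1 !mul1r.
rewrite (_ : (fun h => _) = (y / i.+1`!%:R) *: ((id : R -> R) ^+ i.+1)); last first.
  by apply/funext => h; rewrite /exp_coef scalrfctE exprfctE/= [RHS]mulrC -mulrA [y / _]mulrC mulrA.
apply: is_derive_eq; rewrite /exp_coef factS natrM.
have f0 : i`!%:R != 0 :> R by rewrite pnatr_eq0 -lt0n fact_gt0.
have i0 : i.+1%:R != 0 :> R by rewrite pnatr_eq0.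
transitivity (y / (i.+1%:R * i`!%:R) * (i.+1%:R * s ^+ i)); first by rewrite [_%:A]mulr1.
move: (i.+1%:R : R) i0 (i`!%:R : R) f0 => c c0 f f0.
by field; rewrite f0 c0.
Qed.

(** The cube of half-side [M] dilated by [del], where the dilation scales block i by
    [del ^+ (2 * i + 1)]. *)
Definition aniso (M del : R) (x : 'cV[R]_N) :=
  forall k, `|x k ord0| <= M * del ^+ (2 * b k + 1).

Definition tail (i : nat) (x : 'cV[R]_N) := forall k, (b k < i)%N -> x k ord0 = 0.

(** An entry of e^{hB} from block j to block i is of order |h|^(i-j), at most
    [del ^+ (2 * (i - j))]. This is exactly the ratio of the scales of the two blocks, so the
    constant does not depend on [del]. *)
Lemma expmx_aniso : exists2 C, 0 <= C & forall M del h x, 0 <= M -> 0 <= del ->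
  `|h| <= del ^+ 2 -> aniso M del x -> aniso (C * M) del (expmx (h *: B) *m x).
Proof.
pose A k l := \sum_(j < r.+1) `|(B ^+ j) k l|.
have A0 k l : 0 <= A k l by apply: sumr_ge0.
exists (\sum_k \sum_l A k l); first by do 2!(apply: sumr_ge0 => ? _).
move=> M del h x M0 d0 hd xM k; rewrite mxE.
apply: (@le_trans _ _ (\sum_l A k l * (M * del ^+ (2 * b k + 1)))); last first.
  rewrite -mulr_suml -mulrA ler_wpM2r ?mulr_ge0 ?exprn_ge0//.
  by rewrite [leRHS](bigD1 k)//= lerDl; do 2!(apply: sumr_ge0 => ? _).
apply: le_trans (ler_norm_sum _ _ _) _; apply: ler_sum => l _.
rewrite normrM expmxE; case: leqP => kl; last first.
  by rewrite normr0 mul0r mulr_ge0// mulr_ge0// exprn_ge0.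
set n := (b k - b l)%N.
have en : `|exp_coef n h| <= del ^+ (2 * n).
  rewrite /exp_coef normrM normrX exprM -[leRHS]mulr1.
  have p1 : `|h| ^+ n <= (del ^+ 2) ^+ n.
    by apply: lerXn2r => //; rewrite nnegrE// exprn_ge0.
  have p2 : `|n`!%:R^-1 : R| <= 1.
    by rewrite normfV normr_nat invf_le1 ?ltr0n ?fact_gt0// ler1n fact_gt0.
  exact: ler_pM (exprn_ge0 _ (normr_ge0 _)) (normr_ge0 _) p1 p2.
have BA : `|(B ^+ n) k l| <= A k l.
  have nr : (n < r.+1)%N by rewrite ltnS (leq_trans (leq_subr _ _)).
  by rewrite /A (bigD1 (Ordinal nr))//= lerDl sumr_ge0.
have -> : (2 * b k + 1 = 2 * n + (2 * b l + 1))%N by rewrite /n; lia.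
rewrite exprD (_ : A k l * _ = del ^+ (2 * n) * A k l * (M * del ^+ (2 * b l + 1))).
  by apply: ler_pM (normr_ge0 _) (normr_ge0 _) _ (xM l); rewrite normrM; exact: ler_pM.
by rewrite [RHS]mulrACA [in RHS]mulrCA !mulrA; ring.
Qed.

Lemma aniso_le M L del x : 0 <= del -> M <= L -> aniso M del x -> aniso L del x.
Proof.
move=> d0 ML xM k; apply: le_trans (xM k) _; by rewrite ler_wpM2r// exprn_ge0.
Qed.

Lemma anisoB M L del x y : aniso M del x -> aniso L del y -> aniso (M + L) del (x - y).
Proof.
move=> xM yL k; rewrite !mxE mulrDl.
apply: le_trans (ler_normB _ _) _; exact: lerD.
Qed.

(** A vector that starts in block i needs two powers of B to go beyond block i+1; up to there e^{hB}
    acts as 1 + hB. *)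
Lemma expmx_lead i h x k : tail i x -> (b k <= i.+1)%N ->
  (expmx (h *: B) *m x) k ord0 = x k ord0 + h * (B *m x) k ord0.
Proof.
move=> xi ki; rewrite !mxE mulr_sumr.
have -> : x k ord0 = \sum_l (k == l)%:R * x l ord0.
  rewrite (bigD1 k)//= eqxx mul1r big1 ?addr0// => l.
  by rewrite eq_sym => /negbTE ->; rewrite mul0r.
rewrite -big_split/=; apply: eq_bigr => l _.
have [li|il] := ltnP (b l) i; first by rewrite xi// !mulr0 addr0.
rewrite mulrA -mulrDl; congr (_ * _); rewrite expmxE.
have [kl|lk|E] := ltngtP (b l) (b k).
- have bkE : b k = (b l).+1 by lia.
  rewrite bkE subSnn /exp_coef !expr1 (_ : 1`! = 1%N)// divr1.
  by case: eqP kl => [->|_]; rewrite ?ltnn// add0r.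
- rewrite B0 ?mulr0 ?addr0//; last by rewrite neq_ltn (leq_trans lk).
  by case: eqP lk => [->|//]; rewrite ltnn.
- rewrite E subnn expr0 /exp_coef expr0 fact0 invr1 !mul1r B0; last first.
    by rewrite E neq_ltn ltnSn.
  by rewrite mulr0 addr0 mxE.
Qed.

Lemma mulmx_tail0 i x k : tail i x -> (b k <= i)%N -> (B *m x) k ord0 = 0.
Proof.
move=> xi ki; rewrite mxE big1// => l _.
have [kl|kl] := eqVneq (b k) (b l).+1; last by rewrite B0// mul0r.
by rewrite xi ?mulr0// -kl.
Qed.

Lemma tail_expmx_sub i h x : tail i x -> tail i.+1 (expmx (h *: B) *m x - x).
Proof.
move=> xi k ki; rewrite mxE (@expmx_lead i)//.
  by rewrite (mulmx_tail0 xi)// mulr0 addr0 mxE subrr.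
exact: ltnW.
Qed.

Lemma tail_expmx i h x : tail i x -> tail i (expmx (h *: B) *m x).
Proof.
move=> xi k ki; have /(_ k (leq_trans ki (leqnSn _))) := tail_expmx_sub h xi.
by rewrite !mxE xi// subr0.
Qed.

Lemma measurable_expmx k l :
  measurable_fun setT (fun h : measurableTypeR R => expmx (h *: B) k l : measurableTypeR R).
Proof.
have [kl|kl] := leqP (b l) (b k); last first.
  by under eq_fun do rewrite expmxE leqNgt kl/=; exact: measurable_cst.
under eq_fun do rewrite expmxE kl.
apply: measurable_funM => //; rewrite /exp_coef; apply: measurable_funM => //.
Qed.

Local Notation mts := (measurableTypeR R * 'cV[R]_N)%type.

Lemma group_law_preserving (zeta : timespace R N) :
  measure_preserving (lebesgue_measure \x lebesgue_cV R N)%E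
    (fun z : mts => group_law B z zeta).
Proof.
apply: (measure_preserving_skew (psi := fun _ x => expmx (zeta.1 *: B) *m x + zeta.2)
  (lebesgue_measure_translation zeta.1)).
  by move=> _; apply: lebesgue_cV_affine; exact: unitriangular_expmx.
by apply: measurable_affine => //; exact: measurable_snd.
Qed.

Lemma measurable_flow d (T : measurableType d) (h : T -> measurableTypeR R)
    (z : T -> mts) (w : T -> 'cV[R]_N) :
  measurable_fun setT h -> measurable_fun setT z -> measurable_fun setT w ->
  measurable_fun setT (fun t => group_law B (z t) (h t, w t) : mts).
Proof.
move=> mh mz mw; apply: measurable_fun_pair.
  by apply: measurable_funD => //; exact: measurableT_comp measurable_fst mz.
apply: measurable_affine => //; last exact: measurableT_comp measurable_snd mz.
by move=> i j; exact: measurableT_comp (measurable_expmx i j) mh.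
Qed.

Lemma flowYE h z : flowY B h z = group_law B z (h, 0).
Proof. by rewrite /flowY /group_law/= addr0. Qed.

Lemma translationE (w : 'cV[R]_N) (z : timespace R N) :
  (z.1, z.2 + w) = group_law B z (0, w).
Proof. by rewrite /group_law/= expmx0B mul1mx addr0. Qed.

Lemma flowY0 z : flowY B 0 z = z.
Proof. by case: z => t x; rewrite /flowY/= expmx0B mul1mx addr0. Qed.

Lemma flowYD h k z : flowY B (h + k) z = flowY B h (flowY B k z).
Proof. by rewrite /flowY/= expmxD mulmxA addrAC addrA. Qed.

Lemma is_derive_flowY u (a s : R) z : smooth u ->
  is_derive s 1 (fun h => u (flowY B (h * a) z)) (a * derY B u (flowY B (s * a) z)).
Proof.
move=> su.
have D : is_derive (s * a) 1 (fun h => u (flowY B h z)) (derY B u (flowY B (s * a) z)).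
  pose dg (o : option 'I_N) := if o is Some k then (B *m (expmx ((s * a) *: B) *m z.2)) k ord0 else 1.
  apply: (is_derive_eq (is_derive_curve (g := fun h => flowY B h z) (dg := dg) su _)) => [[k|]/=|].
  - exact: is_derive_expmx.
  - rewrite (_ : (fun h => _) = cst z.1 + id); last by apply/funext => h.
    by apply: is_derive_eq; rewrite add0r.
  by rewrite big_option /derY addrC/= mul1r.
have Da : is_derive s 1 (fun h : R => h * a) a.
  rewrite (_ : (fun h => _) = a *: (id : R -> R)); last by apply/funext => h; rewrite mulrC.
  by apply: is_derive_eq; rewrite [_%:A]mulr1.
have H := @is_derive1_comp R (fun h => u (flowY B h z)) (fun h => h * a) s _ _ D Da.
by apply: (is_derive_eq H); exact: mulrC.
Qed.

Lemma is_derive_translation u (w : 'cV[R]_N) (s : R) (z : timespace R N) : smooth u ->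
  is_derive s 1 (fun h => u (z.1, z.2 + h *: w))
    (\sum_k w k ord0 * partial (Some k) u (z.1, z.2 + s *: w)).
Proof.
move=> su; pose dg (o : option 'I_N) := if o is Some k then w k ord0 else 0.
apply: (is_derive_eq (is_derive_curve (g := fun h => (z.1, z.2 + h *: w)) (dg := dg) su _)).
  case=> [k|]/=; last exact: is_derive_cst.
  rewrite (_ : (fun h => _) = fun h => z.2 k ord0 + h * w k ord0).
    exact: is_derive_affine.
  by apply/funext => h; rewrite !mxE.
by rewrite big_option/= mul0r add0r.
Qed.

Lemma continuous_cV (T : topologicalType) (f : T -> timespace R N) :
  (forall o, continuous (fun s => coord o (f s))) -> continuous f.
Proof.
move=> cf s; have f1 : (f t).1 @[t --> s] --> (f s).1 by exact: (cf None).
have f2 : (f t).2 @[t --> s] --> (f s).2.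
  apply/cvgrPdist_le => e e0.
  have H i : \forall t \near s, `|(f s).2 i ord0 - (f t).2 i ord0| <= e.
    by have /cvgrPdist_le /(_ e e0) := cf (Some i) s.
  near=> t; rewrite {1}/Num.norm/= mx_normrE; apply: bigmax_le; first exact: ltW.
  move=> -[i j] _ /=; rewrite !mxE (ord1 j).
  by move: i; near: t; exact: filter_forall.
rewrite /continuous_at (_ : f @ s = (fun t => ((f t).1, (f t).2)) @ s); last first.
  by congr (_ @ s); apply/funext => t; case: (f t).
exact: (cvg_pair f1 f2).
Unshelve. all: by end_near. Qed.

Lemma continuous_flowY (a : R) (z : timespace R N) :
  continuous (fun s : R => flowY B (s * a) z).
Proof.
apply: continuous_cV => o s; apply: differentiable_continuous.
apply/derivable1_diffP.
case: o => [k|].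
  have H := @is_derive1_comp R (fun h => (expmx (h *: B) *m z.2) k ord0) (fun h => 0 + h * a) s _ _
    (is_derive_expmx z.2 (0 + s * a) k) (is_derive_affine 0 a s).
  rewrite (_ : (fun s => _) = (fun h => (expmx (h *: B) *m z.2) k ord0) \o (fun h => 0 + h * a)).
    exact: ex_derive.
  by apply/funext => h; rewrite /= add0r.
rewrite (_ : (fun s => _) = fun h => z.1 + h * a); last by apply/funext => h.
by have H := is_derive_affine z.1 a s; exact: ex_derive.
Qed.

Lemma continuous_translation (w : 'cV[R]_N) (z : timespace R N) :
  continuous (fun s : R => (z.1, z.2 + s *: w) : timespace R N).
Proof.
apply: continuous_cV => o s; apply: differentiable_continuous.
apply/derivable1_diffP.
case: o => [k|].
  have H := is_derive_affine (z.2 k ord0) (w k ord0) s.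
  rewrite (_ : (fun s => _) = fun h => z.2 k ord0 + h * w k ord0); last first.
    by apply/funext => h; rewrite /= !mxE.
  exact: ex_derive.
exact: derivable_cst.
Qed.

End exponential.

(** * Taylor expansions of smooth functions in Sobolev balls *)

Section derivations.
Context (R : realType) (N : nat) (B : 'M[R]_N).
Local Notation ts := (timespace R N).
Implicit Types (f g : ts -> R) (w : 'cV[R]_N).

Lemma partialD o f g : smooth f -> smooth g ->
  partial o (fun z => f z + g z) = fun z => partial o f z + partial o g z.
Proof.
by move=> sf sg; apply/funext => z; apply: deriveD; exact: smooth_derivable.
Qed.

Lemma partialM o f g : smooth f -> smooth g ->
  partial o (fun z => f z * g z) = fun z => f z * partial o g z + g z * partial o f z.
Proof.
by move=> sf sg; apply/funext => z; apply: deriveM; exact: smooth_derivable.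
Qed.

Lemma partialZ o a f : smooth f ->
  partial o (fun z => a * f z) = fun z => a * partial o f z.
Proof.
move=> sf; rewrite (partialM _ (smooth_cst a) sf); apply/funext => z.
by rewrite partial_cst mulr0 addr0.
Qed.

Lemma partial_sum o (I : Type) (s : seq I) (F : I -> ts -> R) :
  (forall i, smooth (F i)) ->
  partial o (fun z => \sum_(i <- s) F i z) = fun z => \sum_(i <- s) partial o (F i) z.
Proof.
move=> sF; elim: s => [|i s IH].
  rewrite (_ : (fun z => _) = fun=> 0).
    by rewrite partial_cst; apply/funext => z; rewrite big_nil.
  by apply/funext => z; rewrite big_nil.
rewrite (_ : (fun z => _) = fun z => F i z + \sum_(i <- s) F i z); last first.
  by apply/funext => z; rewrite big_cons.
rewrite partialD; [|exact: sF|exact: smooth_sum]; rewrite IH.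
by apply/funext => z; rewrite big_cons.
Qed.

Definition lin_coord (k : 'I_N) (z : ts) := (B *m z.2) k ord0.

Lemma lin_coordE k z : lin_coord k z = \sum_l B k l * coord (Some l) z.
Proof. by rewrite /lin_coord mxE. Qed.

Lemma is_derive_idR (x : R) : is_derive x 1 (id : R -> R) 1.
Proof. exact: is_derive_id. Qed.

Lemma partial_coord o o' : partial o' (coord o) = fun _ : ts => (o == o')%:R.
Proof.
apply/funext => z; rewrite -coord_direction -[RHS]mulr1.
exact: (derive_val (is_derive := is_derive_coord (direction o') (is_derive_idR (coord o z)))).
Qed.

Lemma smooth_coord o : smooth (coord o : ts -> R).
Proof.
apply: (@smooth_class _ _ (fun f => f = coord o \/ exists c, f = fun=> c)); last by left.
move=> f [->|[c ->]]; split.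
- exact: continuous_coord.
- move=> o'; split; last by right; exists (o == o')%:R; exact: partial_coord.
  move=> z; exact: (ex_derive (is_derive := is_derive_coord (direction o') (is_derive_idR (coord o z)))).
- exact: cst_continuous.
- by move=> o'; split; [move=> z; exact: derivable_cst|right; exists 0; exact: partial_cst].
Qed.

Lemma smooth_lin_coord k : smooth (lin_coord k).
Proof.
rewrite (_ : lin_coord k = fun z => \sum_l B k l * coord (Some l) z).
  by apply: smooth_sum => l _; apply: smoothZ; exact: smooth_coord.
by apply/funext => z; exact: lin_coordE.
Qed.

Lemma partial_lin_coord k l : partial (Some l) (lin_coord k) = fun=> B k l.
Proof.
rewrite (_ : lin_coord k = fun z => \sum_l B k l * coord (Some l) z); last first.
  by apply/funext => z; exact: lin_coordE.
rewrite partial_sum; last by move=> i; apply: smoothZ; exact: smooth_coord.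
have pz i : partial (Some l) (fun z => B k i * coord (Some i) z) = fun=> B k i * (i == l)%:R.
  by rewrite (partialZ _ _ (smooth_coord (Some i))) partial_coord.
apply/funext => z; under eq_bigr do rewrite pz.
rewrite (bigD1 l)//= big1 => [|i /negbTE ->]; last by rewrite mulr0.
by rewrite eqxx mulr1 addr0.
Qed.

Lemma derYE f z : derY B f z =
  \sum_(k < N) lin_coord k z * partial (Some k) f z + partial None f z.
Proof. by []. Qed.

Lemma smooth_derY f : smooth f -> smooth (derY B f).
Proof.
move=> sf; apply: (smoothD _ (smooth_partial None sf)).
apply: smooth_sum => k _; apply: (smoothM (smooth_lin_coord k)).
exact: smooth_partial.
Qed.

Lemma derYD f g : smooth f -> smooth g ->
  derY B (fun z => f z + g z) = fun z => derY B f z + derY B g z.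
Proof.
move=> sf sg; apply/funext => z; rewrite !derYE partialD// addrACA -big_split/=.
by congr (_ + _); apply: eq_bigr => k _; rewrite partialD// mulrDr.
Qed.

Lemma derYZ a f : smooth f -> derY B (fun z => a * f z) = fun z => a * derY B f z.
Proof.
move=> sf; apply/funext => z; rewrite !derYE partialZ// mulrDr mulr_sumr.
by congr (_ + _); apply: eq_bigr => k _; rewrite partialZ// mulrCA.
Qed.

Lemma derY_cst (c : R) : derY B (fun=> c) = fun=> 0.
Proof.
apply/funext => z; rewrite derYE partial_cst addr0 big1// => k _.
by rewrite partial_cst mulr0.
Qed.

Definition pdir w f (z : ts) := \sum_k w k ord0 * partial (Some k) f z.

Lemma smooth_pdir w f : smooth f -> smooth (pdir w f).
Proof.
by move=> sf; apply: smooth_sum => k _; apply: smoothZ; exact: smooth_partial.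
Qed.

(** The last sum comes from differentiating the coefficients [lin_coord l] of Y; otherwise the
    derivatives commute. *)
Lemma partial_derY k f : smooth f ->
  partial (Some k) (derY B f) =
  fun z => derY B (partial (Some k) f) z + \sum_l B l k * partial (Some l) f z.
Proof.
move=> sf; have sp o : smooth (partial o f) by exact: smooth_partial.
have slp l : smooth (fun z => lin_coord l z * partial (Some l) f z).
  exact: (smoothM (smooth_lin_coord l) (sp _)).
rewrite [derY B f](_ : _ = fun z => (\sum_l lin_coord l z * partial (Some l) f z) + partial None f z)//.
rewrite partialD; [|by apply: smooth_sum|exact: sp].
rewrite partial_sum//; apply/funext => z; rewrite derYE addrAC partialC//.
congr (_ + _); rewrite -big_split/=; apply: eq_bigr => l _.
rewrite (partialM _ (smooth_lin_coord l) (sp _)) partial_lin_coord partialC//.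
by congr (_ + _); exact: mulrC.
Qed.

Lemma pdir_derY w f : smooth f -> 
  pdir (B *m w) f = fun z => pdir w (derY B f) z - derY B (pdir w f) z.
Proof.
move=> sf; apply/funext => z; rewrite /pdir.
have sp o : smooth (partial o f) by exact: smooth_partial.
have -> : derY B (fun z => \sum_k w k ord0 * partial (Some k) f z) z =
   \sum_k w k ord0 * derY B (partial (Some k) f) z.
  rewrite derYE; under eq_bigr => l _.
    rewrite partial_sum; last by move=> i; exact: smoothZ.
    rewrite mulr_sumr; under eq_bigr => k _ do rewrite partialZ// mulrCA.
    over.
  rewrite partial_sum; last by move=> i; exact: smoothZ.
  rewrite exchange_big -big_split/=; apply: eq_bigr => k _.
  by rewrite partialZ// -mulr_sumr -mulrDr.
rewrite -sumrB; under [RHS]eq_bigr => k _.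
  rewrite partial_derY// mulrDr addrC addKr mulr_sumr.
  over.
rewrite exchange_big/=; apply: eq_bigr => l _; rewrite mxE mulr_suml.
by apply: eq_bigr => k _; rewrite mulrCA mulrA.
Qed.

End derivations.

Lemma lebesgue_space_sigma_finite (R : realType) (N : nat) :
  sigma_finite [set: measurableTypeR R * 'cV[R]_N] (lebesgue_space R N).
Proof.
exists (fun n => tsbox (0 : timespace R N) n.+1%:R).
  apply/seteqP; split=> // z _.
  have [M M0 /(_ z erefl) zM] := compact_tsbounded (@compact_set1 (timespace R N) z).
  exists (Num.trunc M) => //; have := truncnS_gt M; move: zM => [z1 z2] Mt.
  by split=> [|i]; [exact: lt_trans z1 Mt|exact: lt_trans (z2 i) Mt].
by move=> n; split; [exact: measurable_tsbox|exact: lebesgue_tsbox].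
Qed.

(* A copy of lebesgue_space that carries the instance of sigma-finite measure. *)
Definition lebm (R : realType) (N : nat) :
  set (measurableTypeR R * 'cV[R]_N)%type -> \bar R := lebesgue_space R N.
HB.instance Definition _ (R : realType) (N : nat) :=
  Measure.copy (@lebm R N) (lebesgue_space R N).
HB.instance Definition _ (R : realType) (N : nat) :=
  Measure_isSigmaFinite.Build _ _ _ (@lebm R N) (@lebesgue_space_sigma_finite R N).

Definition lebesgue_space_sf (R : realType) (N : nat) :
  {sigma_finite_measure set (measurableTypeR R * 'cV[R]_N)%type -> \bar R} := @lebm R N.

(** * Sobolev bounds for smooth functions and derivatives along the blocks *)

Section Sobolev_bound.
Context (R : realType) (N : nat) (B : 'M[R]_N) (b : 'I_N -> nat) (r : nat).
Hypothesis B0 : forall k l, b k != (b l).+1 -> B k l = 0.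
Hypothesis br : forall k, (b k <= r)%N.
Hypothesis bmono : forall k l : 'I_N, (b k < b l)%N -> (k < l)%N.
Variable P : 'M[R]_N.
Hypothesis P0 : forall l k, b k != (b l).+1 -> P l k = 0.
Hypothesis BP : forall (y : 'cV[R]_N) k, (0 < b k)%N -> (B *m (P *m y)) k ord0 = y k ord0.
Variable p : R.
Hypothesis p1 : 1 <= p.
Local Notation ts := (timespace R N).
Local Notation mts := (measurableTypeR R * 'cV[R]_N)%type.
Local Notation mu := (lebesgue_space_sf R N).
Local Notation Lle := (Lp_le mu p).
Implicit Types (f g u : ts -> R) (w xi : 'cV[R]_N) (K : R).

Lemma flow_preserving h : measure_preserving mu (flowY B h).
Proof.
rewrite (_ : flowY B h = fun z => group_law B z (h, 0)).
  exact: (group_law_preserving B0 br bmono (h, 0)).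
by apply/funext => z; exact: flowYE.
Qed.

Definition tr w (z : ts) : ts := (z.1, z.2 + w).

Lemma trE w z : tr w z = group_law B z (0, w).
Proof. by rewrite /tr (translationE B0 br). Qed.

Lemma tr_preserving w : measure_preserving mu (tr w).
Proof.
rewrite (_ : tr w = fun z => group_law B z (0, w)).
  exact: (group_law_preserving B0 br bmono (0, w)).
by apply/funext => z; exact: trE.
Qed.

Lemma trD v w z : tr (v + w) z = tr v (tr w z).
Proof. by rewrite /tr/= -addrA [v + w]addrC. Qed.

Lemma tr0 z : tr 0 z = z.
Proof. by case: z => t x; rewrite /tr/= addr0. Qed.

Lemma flow_tr h w z : flowY B h (tr w z) = tr (expmx (h *: B) *m w) (flowY B h z).
Proof. by rewrite /flowY /tr/= mulmxDr. Qed.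

Lemma smooth_measurable f : smooth f -> measurable_fun [set: mts] f.
Proof. by move=> sf; apply: continuous_measurable_space; exact: smooth_continuous. Qed.

Lemma Lle_flow K f h : Lle K f -> Lle K (fun z => f (flowY B h z)).
Proof. by move=> fK; exact: (Lp_le_preserving p1 (flow_preserving h) fK). Qed.

Lemma Lle_tr K f w : Lle K f -> Lle K (fun z => f (tr w z)).
Proof. by move=> fK; exact: (Lp_le_preserving p1 (tr_preserving w) fK). Qed.

Lemma Lle_flowV K f h : Lle K (fun z => f (flowY B h z)) -> Lle K f.
Proof.
move=> /(Lle_flow (- h)); apply: eq_Lp_le => z.
by rewrite -(flowYD B0 br) subrr (flowY0 B0 br).
Qed.

Lemma Lle_trV K f w : Lle K (fun z => f (tr w z)) -> Lle K f.
Proof. by move=> /(Lle_tr (- w)); apply: eq_Lp_le => z; rewrite -trD subrr tr0. Qed.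

(* The norm of W^{m,p}_B of a smooth function is at most a multiple of K. The
   fractional seminorm is replaced by the Hölder bound that it implies. *)
Fixpoint Wle (m : nat) K f : Prop :=
  match m with
  | 0 => Lle K f
  | m'.+1 => [/\ Lle K f,
     (forall k, b k = 0%N -> Wle m' K (partial (Some k) f)) &
     match m' with
     | 0 => forall h del, 0 <= del -> `|h| <= del ^+ 2 ->
              Lle (K * del) (fun z => f (flowY B h z) - f z)
     | m''.+1 => Wle m'' K (derY B f)
     end]
  end.

Lemma Wle_Lle m K f : Wle m K f -> Lle K f.
Proof. by case: m => [//|m []]. Qed.

Lemma Wle_ge0 m K f : Wle m K f -> 0 <= K.
Proof. by move=> /Wle_Lle; exact: Lp_le_ge0. Qed.

Lemma Wle_partial m K f k : b k = 0%N -> Wle m.+1 K f -> Wle m K (partial (Some k) f).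
Proof. by move=> bk [_ H _]; exact: H. Qed.

Lemma Wle_derY m K f : Wle m.+2 K f -> Wle m K (derY B f).
Proof. by move=> [_ _]. Qed.

Lemma WleD m K L f g : smooth f -> smooth g -> Wle m K f -> Wle m L g ->
  Wle m (K + L) (fun z => f z + g z).
Proof.
(* [Wle] at [m.+2] refers to both [m.+1] and [m], hence the induction on an upper bound [n] of
   [m]. *)
suff H : forall n m, (m <= n)%N -> forall K L f g, smooth f -> smooth g ->
    Wle m K f -> Wle m L g -> Wle m (K + L) (fun z => f z + g z).
  by apply: H; exact: leqnn.
elim=> [|n IH] [|{}m] mn {}K {}L {}f {}g sf sg.
- by move=> fK gL; exact: (Lp_leD p1 fK gL).
- by [].
- by move=> fK gL; exact: (Lp_leD p1 fK gL).
move=> [fK f1 f2] [gL g1 g2]; split; first exact: (Lp_leD p1 fK gL).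
  move=> k bk; rewrite (partialD _ sf sg); apply: (IH m mn).
  - exact: (smooth_partial (Some k) sf).
  - exact: (smooth_partial (Some k) sg).
  - exact: f1.
  - exact: g1.
case: m mn f1 f2 g1 g2 => [|m] mn f1 f2 g1 g2.
  move=> h del d0 hd; rewrite mulrDl.
  apply: eq_Lp_le (Lp_leD p1 (f2 h del d0 hd) (g2 h del d0 hd)) => z.
  by rewrite opprD addrACA.
rewrite (derYD _ sf sg); apply: (IH m (ltnW mn)).
- exact: (smooth_derY B sf).
- exact: (smooth_derY B sg).
- exact: f2.
- exact: g2.
Qed.

Lemma WleZ m K a f : smooth f -> Wle m K f -> Wle m (`|a| * K) (fun z => a * f z).
Proof.
suff H : forall n m, (m <= n)%N -> forall K f, smooth f ->
    Wle m K f -> Wle m (`|a| * K) (fun z => a * f z).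
  by apply: H; exact: leqnn.
elim=> [|n IH] [|{}m] mn {}K {}f sf.
- by move=> fK; exact: (Lp_leZ p1 a fK).
- by [].
- by move=> fK; exact: (Lp_leZ p1 a fK).
move=> [fK f1 f2]; split; first exact: (Lp_leZ p1 a fK).
  move=> k bk; rewrite (partialZ _ a sf); apply: (IH m mn).
  - exact: (smooth_partial (Some k) sf).
  - exact: f1.
case: m mn f1 f2 => [|m] mn f1 f2.
  move=> h del d0 hd; rewrite -mulrA.
  apply: eq_Lp_le (Lp_leZ p1 a (f2 h del d0 hd)) => z.
  by rewrite mulrBr.
rewrite (derYZ _ a sf); apply: (IH m (ltnW mn)); last exact: f2.
exact: (smooth_derY B sf).
Qed.

Lemma WleW m K L f : K <= L -> Wle m K f -> Wle m L f.
Proof.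
suff H : forall n m, (m <= n)%N -> forall f, K <= L -> Wle m K f -> Wle m L f.
  by apply: H; exact: leqnn.
elim=> [|n IH] [|{}m] mn {}f KL.
- exact: Lp_leW.
- by [].
- exact: Lp_leW.
move=> [fK f1 f2]; split; first exact: Lp_leW fK.
  by move=> k bk; apply: IH => //; exact: f1.
case: m mn f1 f2 => [|m] mn f1 f2.
  by move=> h del d0 hd; apply: Lp_leW (f2 h del d0 hd); rewrite ler_wpM2r.
by apply: IH => //; apply: ltnW; exact: mn.
Qed.

Lemma Wle0 m : Wle m 0 (fun=> 0).
Proof.
have L0 : Lle 0 (fun _ : ts => 0) by exact: (Lp_le0 mu p1).
suff H : forall n m, (m <= n)%N -> Wle m 0 (fun=> 0) by apply: H; exact: leqnn.
elim=> [|n IH] [|{}m] mn //; split=> //.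
  by move=> k bk; rewrite partial_cst; exact: IH.
case: m mn => [|m] mn; last by rewrite derY_cst; apply: IH; exact: ltnW.
by move=> h del d0 hd; rewrite mul0r; apply: eq_Lp_le L0 => z; rewrite subrr.
Qed.

Lemma Wle_sum m (I : Type) (s : seq I) (K : I -> R) (f : I -> ts -> R) :
  (forall i, smooth (f i)) -> (forall i, Wle m (K i) (f i)) ->
  Wle m (\sum_(i <- s) K i) (fun z => \sum_(i <- s) f i z).
Proof.
move=> sf fK; elim: s => [|i s IH].
  rewrite big_nil (_ : (fun z => _) = fun=> 0); first exact: Wle0.
  by apply/funext => z; rewrite big_nil.
rewrite big_cons (_ : (fun z => _) = fun z => f i z + \sum_(i <- s) f i z).
  by apply: WleD IH; [exact: sf|apply: smooth_sum => j _; exact: sf|exact: fK].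
by apply/funext => z; rewrite big_cons.
Qed.

Definition pure i w := forall k, b k != i -> w k ord0 = 0.

Definition sum_norm_mx (A : 'M[R]_N) := \sum_k \sum_l `|A k l|.

Lemma sum_norm_mx_ge0 A : 0 <= sum_norm_mx A.
Proof. by do 2!(apply: sumr_ge0 => ? _). Qed.

Lemma norm_mulmx_le (A : 'M[R]_N) w M k : 0 <= M ->
  (forall l, A k l != 0 -> `|w l ord0| <= M) -> `|(A *m w) k ord0| <= sum_norm_mx A * M.
Proof.
move=> M0 wM; rewrite mxE; apply: le_trans (ler_norm_sum _ _ _) _.
apply: (@le_trans _ _ ((\sum_l `|A k l|) * M)).
  rewrite mulr_suml; apply: ler_sum => l _; rewrite normrM.
  have [->|A0] := eqVneq (A k l) 0; first by rewrite normr0 !mul0r.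
  by rewrite ler_wpM2l// wM.
rewrite ler_wpM2r// /sum_norm_mx [leRHS](bigD1 k)//= lerDl.
by do 2!(apply: sumr_ge0 => ? _).
Qed.

(** For w in block i+1, the vector v = P w lies in block i and B v = w, so that d_w = d_v Y - Y d_v.
    In either term Y takes two orders and d_v takes 2i+1. The constant doubles for the two terms and
    acquires the size of [P]. *)
Lemma Wle_pdir i : exists2 C, 0 <= C & forall m K M f w, 0 <= M -> smooth f ->
  Wle (m + (2 * i + 1)) K f -> pure i w -> (forall k, `|w k ord0| <= M) ->
  Wle m (C * M * K) (pdir w f).
Proof.
elim: i => [|i [C C0 IH]].
  exists N%:R => // m K M f w M0 sf; rewrite muln0 add0n addn1 => fK wp wM.
  have K0 := Wle_ge0 fK.
  have H k : Wle m (M * K) (fun z => w k ord0 * partial (Some k) f z).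
    have [bk|bk] := eqVneq (b k) 0%N.
      apply: (@WleW _ (`|w k ord0| * K)); first by rewrite ler_wpM2r.
      by apply: WleZ; [exact: smooth_partial|exact: Wle_partial].
    rewrite wp// (_ : (fun z => _) = fun=> 0).
      by apply: WleW (Wle0 m); exact: mulr_ge0.
    by apply/funext => z; rewrite mul0r.
  apply: (@WleW _ (\sum_(k < N) M * K)).
    by rewrite sumr_const card_ord -mulrA mulr_natl.
  by apply: Wle_sum => k; [apply: smoothZ; exact: smooth_partial|exact: H].
exists (2 * (C * sum_norm_mx P)).
  by rewrite !mulr_ge0// sum_norm_mx_ge0.
move=> m K M f w M0 sf fK wp wM; have K0 := Wle_ge0 fK.
set w' := P *m w.
(* On block 0 both sides vanish: w is concentrated in a later block, and the rows of B in block 0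
   are zero. *)
have -> : w = B *m w'.
  apply/colP => k; have [bk|bk] := posnP (b k); last by rewrite BP.
  rewrite wp ?bk// mxE big1// => l _.
  by rewrite B0 ?mul0r// bk.
have w'p : pure i w'.
  move=> k bk; rewrite mxE big1// => l _.
  have [kl|kl] := eqVneq (b l) (b k).+1; last by rewrite P0// mul0r.
  by rewrite wp ?mulr0// kl eqSS.
have w'M k : `|w' k ord0| <= sum_norm_mx P * M by exact: norm_mulmx_le.
have PM0 : 0 <= sum_norm_mx P * M by rewrite mulr_ge0// sum_norm_mx_ge0.
have sY := smooth_derY B sf; have sw := smooth_pdir w' sf.
rewrite pdir_derY//.
have -> : 2 * (C * sum_norm_mx P) * M * K =
    C * (sum_norm_mx P * M) * K + `|-1| * (C * (sum_norm_mx P * M) * K).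
  by rewrite normrN1 mul1r; ring.
have -> : (fun z => pdir w' (derY B f) z - derY B (pdir w' f) z) =
    (fun z => pdir w' (derY B f) z + (-1) * derY B (pdir w' f) z).
  by apply/funext => z; rewrite mulN1r.
apply: WleD; [exact: smooth_pdir|apply: smoothZ; exact: smooth_derY|..].
  apply: IH => //; apply: Wle_derY; move: fK; congr Wle; lia.
apply: WleZ; first exact: smooth_derY.
apply: Wle_derY; apply: IH => //; move: fK; congr Wle; lia.
Qed.

Lemma measurable_joint f d (T : measurableType d) (z : T -> mts) :
  smooth f -> measurable_fun setT z -> measurable_fun setT (fun t => f (z t)).
Proof. by move=> sf mz; exact: measurableT_comp (smooth_measurable sf) mz. Qed.

Lemma measurable_flowY d (T : measurableType d) (h : T -> measurableTypeR R) (z : T -> mts) :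
  measurable_fun setT h -> measurable_fun setT z ->
  measurable_fun setT (fun t => flowY B (h t) (z t) : mts).
Proof.
move=> mh mz; rewrite (_ : (fun t => _) = fun t => group_law B (z t) (h t, 0)).
  exact: (measurable_flow B0 br mh mz (measurable_cst _)).
by apply/funext => t; exact: flowYE.
Qed.

Lemma measurable_tr d (T : measurableType d) (h : T -> measurableTypeR R) (z : T -> mts) w :
  measurable_fun setT h -> measurable_fun setT z ->
  measurable_fun setT (fun t => tr (h t *: w) (z t) : mts).
Proof.
move=> mh mz; apply: measurable_fun_pair; first exact: measurableT_comp measurable_fst mz.
apply/measurable_cVP => i; under eq_fun do rewrite !mxE.
apply: measurable_funD; last by apply: measurable_funM.
exact: (measurableT_comp (measurable_coord i) (measurableT_comp measurable_snd mz)).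
Qed.

(** What the flow of Y and the translations along a vector have in common; the mean value bound, the
    one-parameter expansion and integration by parts are proved for both at once. The factor [a]
    rescales time so that every integral runs over [0, 1]. *)
Record generates (Phi : R -> ts -> ts) (X : (ts -> R) -> ts -> R) : Prop := Generates {
  gen_smooth : forall f, smooth f -> smooth (X f);
  gen_derive : forall f z (a s : R), smooth f ->
    is_derive s 1 (fun h => f (Phi (h * a) z)) (a * X f (Phi (s * a) z));
  gen_cont : forall (a : R) z, continuous (fun s : R => Phi (s * a) z);
  gen_meas : forall a : R, measurable_fun setT
    (fun t : measurableTypeR R * mts => Phi (t.1 * a) t.2 : mts);
  gen0 : forall z, Phi 0 z = z }.

Lemma generates_flow : generates (flowY B) (derY B).
Proof.
split.
- exact: smooth_derY.
- by move=> f z a s sf; exact: (is_derive_flowY B0 br a s z sf).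
- by move=> a z; exact: (continuous_flowY B0 br).
- by move=> a; apply: measurable_flowY => //; exact: measurable_funM.
- exact: (flowY0 B0 br).
Qed.

Lemma generates_tr w : generates (fun h => tr (h *: w)) (pdir w).
Proof.
split.
- exact: smooth_pdir.
- move=> f z a s sf.
  have := is_derive_translation (a *: w) s z sf.
  rewrite (_ : (fun h => f (z.1, _)) = fun h => f (tr ((h * a) *: w) z)).
    move=> D; apply: (is_derive_eq D); rewrite /pdir mulr_sumr.
    by apply: eq_bigr => k _; rewrite mxE mulrA /tr scalerA.
  by apply/funext => h; rewrite /tr scalerA.
- move=> a z; rewrite (_ : (fun s : R => _) = fun s : R => (z.1, z.2 + s *: (a *: w))).
    exact: continuous_translation.
  by apply/funext => s; rewrite /tr scalerA.
- by move=> a; apply: measurable_tr => //; exact: measurable_funM.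
- by move=> z; rewrite scale0r tr0.
Qed.

(** [q] is the homogeneous degree of X, and the terms of degree below [m] are kept: [m] is the order
    of the remainder, and for m = 0 the sum is empty. *)
Definition Taylor_flow (X : (ts -> R) -> ts -> R) (q m : nat) (h : R) f (z : ts) : R :=
  \sum_(j < m | (q * j < m)%N) exp_coef j h * iter j X f z.

Lemma smooth_iter X j f : (forall f, smooth f -> smooth (X f)) ->
  smooth f -> smooth (iter j X f).
Proof. by move=> sX sf; elim: j => [|j IH]; [exact: sf|exact: sX]. Qed.

(** The terms with j > 0 are the primitives in h of the terms of the expansion of X f, whose order
    is lower by q. *)
Lemma Taylor_flowS X q m h f z : (0 < q)%N ->
  Taylor_flow X q (m + q) h f z = f z +
  \sum_(j < m | (q * j < m)%N) exp_coef j.+1 h * iter j X (X f) z.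
Proof.
move=> q0; rewrite /Taylor_flow -(prednK q0) addnS big_mkcond big_ord_recl/=.
rewrite muln0 ltnS leq0n /exp_coef expr0 fact0 divr1 mul1r; congr (_ + _).
rewrite -(big_mkord xpredT (fun j => if (q.-1.+1 * bump 0 j < (m + q.-1).+1)%N then
   h ^+ bump 0 j / (bump 0 j)`!%:R * iter (bump 0 j) X f z else 0)).
rewrite (@big_cat_nat _ _ _ m)//=; last exact: leq_addr.
rewrite [X in _ + X]big1_seq ?addr0; last first.
  move=> j; rewrite mem_index_iota => /andP[_ /andP[mj _]].
  by rewrite ifF//; apply/negbTE; rewrite -leqNgt /bump/=; nia.
rewrite big_mkord [RHS]big_mkcond/=; apply: eq_bigr => j _; rewrite /bump/= add1n -iterSr.
suff -> : (q.-1.+1 * j.+1 < (m + q.-1).+1 = (q.-1.+1 * j < m))%N by [].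
by apply/idP/idP; lia.
Qed.

Lemma is_derive_exp_coef j (c s : R) :
  is_derive s 1 (fun h => exp_coef j.+1 (h * c)) (c * exp_coef j (s * c)).
Proof.
rewrite (_ : (fun h => _) = (c ^+ j.+1 / j.+1`!%:R) *: ((id : R -> R) ^+ j.+1)); last first.
  by apply/funext => h; rewrite /exp_coef scalrfctE exprfctE/= exprMn [RHS]mulrC mulrA.
apply: is_derive_eq; rewrite [_%:A]mulr1 /exp_coef factS natrM exprMn exprS -[LHS]/(_ * _).
have f0 : j`!%:R != 0 :> R by rewrite pnatr_eq0 -lt0n fact_gt0.
have j0 : j.+1%:R != 0 :> R by rewrite pnatr_eq0.
move: (j.+1%:R : R) j0 (j`!%:R : R) f0 => a a0 e e0 /=.
by field; rewrite e0 a0.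
Qed.

Lemma continuous_exp_coef j (c : R) : continuous (fun s : R => exp_coef j (s * c)).
Proof.
rewrite (_ : (fun s => _) = horner ((c ^+ j / j`!%:R) *: 'X^j)).
  exact: continuous_horner.
by apply/funext => s; rewrite hornerZ hornerXn /exp_coef exprMn -mulrA mulrC.
Qed.

Lemma measurable_exp_coef j (c : R) d (T : measurableType d) (h : T -> measurableTypeR R) :
  measurable_fun setT h ->
  measurable_fun setT (fun t => exp_coef j (h t * c) : measurableTypeR R).
Proof.
move=> mh; rewrite /exp_coef; apply: measurable_funM => //.
by apply: measurable_funX; exact: measurable_funM.
Qed.

Lemma continuous_generates Phi X (a : R) z f : generates Phi X -> smooth f ->
  continuous (fun s : R => f (Phi (s * a) z)).
Proof.
move=> gP sf s; apply: (@continuous_comp _ _ _ (fun s : R => Phi (s * a) z) f).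
  exact: (gen_cont gP).
exact: smooth_continuous.
Qed.

Lemma measurable_Taylor_flow X q m c f : (forall f, smooth f -> smooth (X f)) -> smooth f ->
  measurable_fun setT (fun t : measurableTypeR R * mts => Taylor_flow X q m (t.1 * c) f t.2).
Proof.
move=> sX sf; rewrite (_ : (fun t => _) = fun t : measurableTypeR R * mts => \sum_(j < m)
    if (q * j < m)%N then exp_coef j (t.1 * c) * iter j X f t.2 else 0); last first.
  by apply/funext => t; rewrite /Taylor_flow big_mkcond.
apply: (@measurable_sum _ _ R setT _ _ (fun (j : 'I_m) (t : measurableTypeR R * mts) =>
  if (q * j < m)%N then exp_coef j (t.1 * c) * iter j X f t.2 else 0)) => j.
case: (q * j < m)%N => //; apply: measurable_funM; first exact: measurable_exp_coef.
exact: measurable_joint (smooth_iter j sX sf) measurable_snd.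
Qed.

(* Integrating the expansion of X f along the flow gives that of f. *)
Lemma Taylor_flow_le Phi X q : generates Phi X -> (0 < q)%N ->
  (exists2 A, 0 <= A & forall m K f, smooth f -> Wle (m + q) K f -> Wle m (A * K) (X f)) ->
  (forall m, (m < q)%N -> exists2 C, 0 <= C & forall K f h del, smooth f -> Wle m K f ->
     0 < del -> `|h| <= del ^+ q ->
     Lle (C * del ^+ m * K) (fun z => f (Phi h z) - (if m is 0 then 0 else f z))) ->
  forall m, exists2 C, 0 <= C & forall K f h del, smooth f -> Wle m K f ->
     0 < del -> `|h| <= del ^+ q ->
     Lle (C * del ^+ m * K) (fun z => f (Phi h z) - Taylor_flow X q m h f z).
Proof.
move=> gP q0 [A A0 XA] base; elim/ltn_ind => m IH.
have [mq|qm] := ltnP m q.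
  have [C C0 HC] := base m mq; exists C => // K f h del sf fK d0 hd.
  apply: eq_Lp_le (HC K f h del sf fK d0 hd) => z; congr (_ - _).
  (* Below order q the polynomial is f itself, except for m = 0 where it is empty; this explains the
     case distinction in the hypothesis on small m. *)
  case: m mq {IH HC} fK => [|m] mq fK; first by rewrite /Taylor_flow big_ord0.
  rewrite /Taylor_flow (bigD1 ord0)/=; last by rewrite muln0.
  rewrite big1 ?addr0; last first.
    move=> j /andP[jm j0]; exfalso; move/eqP: j0 => j0; apply: j0; apply: val_inj => /=.
    by nia.
  by rewrite /exp_coef expr0 fact0 divr1 mul1r.
(* X f is bounded by [A * K] at the order m - q, and the factor h in the integrand [G] below
   supplies the remaining [del ^+ q]. *)
have [C C0 HC] := IH (m - q)%N (ltac:(lia)); exists (C * A); first exact: mulr_ge0.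
move=> K f h del sf; set n := (m - q)%N in HC *.
have -> : m = (n + q)%N by rewrite /n subnK.
move=> fK d0 hd; have {}XA := XA _ _ _ sf fK.
have sX := gen_smooth gP sf.
pose H (s : R) z := f (Phi (s * h) z) - Taylor_flow X q (n + q) (s * h) f z.
pose G (s : R) z := h * (X f (Phi (s * h) z) - Taylor_flow X q n (s * h) (X f) z).
have sit j : smooth (iter j X (X f)) by exact: smooth_iter (gen_smooth gP) sX.
have E : (fun z => H 1 z - H 0 z) = fun z => f (Phi h z) - Taylor_flow X q (n + q) h f z.
  apply/funext => z; rewrite /H mul1r mul0r (gen0 gP) [X in _ - (_ - X)]Taylor_flowS// big1.
    by rewrite addr0 subrr subr0.
  by move=> j _; rewrite /exp_coef expr0n/= mul0r mul0r.
rewrite -E; apply: (@Lp_le_mean _ _ _ mu p p1 H G).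
- apply: measurable_funM => //; apply: measurable_funB.
    exact: measurable_joint sX (gen_meas gP h).
  by exact: measurable_Taylor_flow (gen_smooth gP) sX.
- move=> z s.
  have -> : H ^~ z = (fun s => f (Phi (s * h) z)) - (cst (f z) +
      \sum_(j < n) (fun s => if (q * j < n)%N then exp_coef j.+1 (s * h) * iter j X (X f) z else 0)).
    apply/funext => t; rewrite /H Taylor_flowS// !fctE fct_sumE big_mkcond.
    by [].
  have D (j : 'I_n) : is_derive s (1 : R) (fun s : R => if (q * j < n)%N then exp_coef j.+1 (s * h) * iter j X (X f) z else 0)
      (if (q * j < n)%N then h * exp_coef j (s * h) * iter j X (X f) z else 0).
    case: (q * j < n)%N; last exact: is_derive_cst.
    rewrite (_ : (fun s => _) = (iter j X (X f) z) *: (fun s => exp_coef j.+1 (s * h))); last first.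
      by apply/funext => t; rewrite scalrfctE mulrC.
    have H1 : is_derive s (1 : R) ((iter j X (X f) z) *: (fun s => exp_coef j.+1 (s * h)))
        ((iter j X (X f) z) *: (h * exp_coef j (s * h))).
      by apply: is_deriveZ; exact: is_derive_exp_coef.
    by apply: (is_derive_eq H1); exact: mulrC.
  have D2 := is_deriveB (gen_derive gP z h s sf) (is_deriveD (is_derive_cst (f z) s (1 : R)) (is_derive_sum D)).
  apply: (is_derive_eq D2); rewrite add0r /G mulrBr; congr (_ - _).
  rewrite /Taylor_flow [in RHS]big_mkcond mulr_sumr; apply: eq_bigr => j _.
  by case: (q * j < n)%N; [rewrite -mulrA|rewrite mulr0].
- move=> z s; apply: (@continuousM R R (cst h)
    (fun s => X f (Phi (s * h) z) - Taylor_flow X q n (s * h) (X f) z)).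
    exact: cst_continuous.
  apply: (@continuousB R R^o R (fun s => X f (Phi (s * h) z))
    (fun s => Taylor_flow X q n (s * h) (X f) z)).
    exact: (@continuous_generates Phi X h z (X f) gP sX s).
  rewrite (_ : (fun s => _) = fun s => \sum_(j < n)
    if (q * j < n)%N then exp_coef j (s * h) * iter j X (X f) z else 0); last first.
    by apply/funext => t; rewrite /Taylor_flow big_mkcond.
  apply: cvg_fin_sum => j; case: (q * j < n)%N; last exact: cvg_cst.
  by apply: cvgMl; exact: continuous_exp_coef.
- rewrite E; apply: measurable_funB.
    rewrite (_ : (fun z => _) = fun z : mts => f (Phi (1 * h) z)); last first.
      by apply/funext => z; rewrite mul1r.
    apply: measurable_joint sf _.
    apply: (measurableT_comp (gen_meas gP h) (g := fun z => (1 : measurableTypeR R, z))).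
    exact: measurable_fun_pair.
  rewrite (_ : Taylor_flow X q (n + q) h f =
    (fun t : measurableTypeR R * mts => Taylor_flow X q (n + q) (t.1 * h) f t.2) \o
    (fun z : mts => (1 : measurableTypeR R, z))); last by apply/funext => z; rewrite /= mul1r.
  apply: measurableT_comp (measurable_Taylor_flow q (n + q) h (gen_smooth gP) sf) _.
  exact: measurable_fun_pair.
move=> s /andP[s0 s1].
have shd : `|s * h| <= del ^+ q.
  by rewrite normrM (le_trans _ hd)// ger0_norm// ler_piMl.
apply: Lp_leW (Lp_leZ p1 h (HC _ _ (s * h) del sX XA d0 shd)).
apply: (@le_trans _ _ (del ^+ q * (C * del ^+ n * (A * K)))).
  by rewrite ler_wpM2r// mulr_ge0// ?mulr_ge0 ?exprn_ge0// ?(ltW d0)// (Wle_ge0 fK).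
by rewrite exprD le_eqVlt; apply/orP; left; apply/eqP; ring.
Qed.


(** * The estimate of order zero for translations *)

Lemma eq_Lle K f g : (forall z, f z = g z) -> Lle K f -> Lle K g.
Proof. by move=> /funext ->. Qed.

(** With e = 1 this bounds a mixed second difference by the first differences of X f between two
    orbits; with e = 0 it bounds a single increment. *)
Lemma Lle_mean_flow Phi X (psi chi : ts -> ts) a e f K : generates Phi X -> smooth f ->
  measurable_fun [set: mts] (psi : mts -> mts) ->
  measurable_fun [set: mts] (chi : mts -> mts) ->
  (forall s, 0 <= s <= 1 ->
    Lle K (fun z => a * (X f (Phi (s * a) (psi z)) - e * X f (Phi (s * a) (chi z))))) ->
  Lle K (fun z => (f (Phi a (psi z)) - f (psi z)) - e * (f (Phi a (chi z)) - f (chi z))).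
Proof.
move=> gP sf mpsi mchi HK.
pose H (s : R) z := f (Phi (s * a) (psi z)) - e * f (Phi (s * a) (chi z)).
pose G (s : R) z := a * (X f (Phi (s * a) (psi z)) - e * X f (Phi (s * a) (chi z))).
have sX := gen_smooth gP sf.
have mPhi d (T : measurableType d) g (t : T -> measurableTypeR R) (psi' : T -> mts) :
    smooth g -> measurable_fun setT t -> measurable_fun setT psi' ->
    measurable_fun setT (fun x : T => g (Phi (t x * a) (psi' x))).
  move=> sg mt mp; apply: (measurable_joint (z := fun x => Phi (t x * a) (psi' x)) sg).
  apply: (measurableT_comp (gen_meas gP a) (g := fun x => (t x, psi' x))).
  exact: measurable_fun_pair.
have E z : H 1 z - H 0 z = (f (Phi a (psi z)) - f (psi z)) - e * (f (Phi a (chi z)) - f (chi z)).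
  by rewrite /H mul1r mul0r !(gen0 gP); move: (f _) (f _) (f _) (f _) => x1 x2 x3 x4; ring.
apply: (eq_Lle E); apply: (@Lp_le_mean _ _ _ mu p p1 H G) => //.
- apply: measurable_funM => //; apply: measurable_funB.
    by apply: mPhi => //; exact: measurableT_comp mpsi measurable_snd.
  apply: measurable_funM => //.
  by apply: mPhi => //; exact: measurableT_comp mchi measurable_snd.
- move=> z s.
  have D := is_deriveB (gen_derive gP (psi z) a s sf)
    (is_deriveZ e (gen_derive gP (chi z) a s sf)).
  by apply: (is_derive_eq D); rewrite /G mulrBr mulrCA.
- move=> z s; apply: (@continuousM R R (cst a)
    (fun s => X f (Phi (s * a) (psi z)) - e * X f (Phi (s * a) (chi z)))).
    exact: cst_continuous.
  apply: (@continuousB R R^o R (fun s => X f (Phi (s * a) (psi z)))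
    (fun s => e * X f (Phi (s * a) (chi z)))).
    exact: (@continuous_generates Phi X a (psi z) (X f) gP sX s).
  apply: (@continuousM R R (cst e) (fun s => X f (Phi (s * a) (chi z)))).
    exact: cst_continuous.
  exact: (@continuous_generates Phi X a (chi z) (X f) gP sX s).
have mf g psi' : smooth g -> measurable_fun [set: mts] (psi' : mts -> mts) ->
    measurable_fun [set: mts] (fun z => g (psi' z)) by move=> ? ?; exact: measurable_joint.
have mH s : measurable_fun [set: mts] (H s).
  apply: measurable_funB; last apply: measurable_funM => //.
    by apply: (mPhi _ _ f (cst s)) => //.
  by apply: (mPhi _ _ f (cst s)) => //.
exact: measurable_funB.
Qed.

(** The size [M] of the box is quantified before the constant because every passage to a commutator
    enlarges the box. *)
Definition shift_le m i := forall M, 0 <= M -> exists2 C, 0 <= C &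
  forall f K del xi, smooth f -> Wle m K f -> 0 < del -> tail b i xi -> aniso b M del xi ->
    Lle (C * del ^+ m * K) (fun z => f (tr xi z) - f z).

(** For m = 1 there is no Y f to integrate, and each increment along Y satisfies the Hölder bound.
    For m >= 2, moving the translation past the flow at time sh turns w into e^{shB} w, which starts
    in the same block and lies in a box larger by the factor [Ce]; the factor h supplies
    [del ^+ 2]. *)
Lemma commutator_le m i : (0 < m)%N -> ((1 < m)%N -> shift_le (m - 2) i) ->
  forall M, 0 <= M -> exists2 C, 0 <= C &
  forall f K del h w, smooth f -> Wle m K f -> 0 < del -> `|h| <= del ^+ 2 ->
    tail b i w -> aniso b M del w ->
    Lle (C * del ^+ m * K)
      (fun z => (f (flowY B h (tr w z)) - f (tr w z)) - (f (flowY B h z) - f z)).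
Proof.
case: m => [//|[_ _ M M0|m _ /(_ isT)]].
  exists 2 => // f K del h w sf [_ _ fK] d0 hd _ _.
  have {}fK := fK h del (ltW d0) hd.
  have -> : 2 * del ^+ 1 * K = K * del + K * del by rewrite expr1 -mulrA mulr_natl mulr2n mulrC.
  exact: (Lp_leB p1 (Lle_tr w fK) fK).
rewrite !subSS subn0 => S M M0; have [Ce Ce0 eM] := expmx_aniso B0 br.
have [C C0 HC] := S (Ce * M) (mulr_ge0 Ce0 M0); exists C => // f K del h w sf fK d0 hd wi wM.
apply: (@eq_Lle _ (fun z => (f (flowY B h (tr w z)) - f (tr w z)) - 1 * (f (flowY B h z) - f z))).
  by move=> z; rewrite mul1r.
apply: (Lle_mean_flow (psi := tr w) (chi := id) generates_flow sf).
- exact: (tr_preserving w).1.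
- exact: measurable_id.
move=> s /andP[s0 s1].
have shd : `|s * h| <= del ^+ 2.
  by rewrite normrM (le_trans _ hd)// ger0_norm// ler_piMl.
have K0 := Wle_ge0 fK.
have sY := smooth_derY B sf.
have T := HC _ _ del _ sY (Wle_derY fK) d0 (tail_expmx B0 br (s * h) wi) (eM _ _ _ _ M0 (ltW d0) shd wM).
have {}T := Lle_flow (s * h) T.
apply: Lp_leW (eq_Lp_le _ (Lp_leZ p1 h T)); last by move=> z; rewrite mul1r flow_tr.
rewrite -addn2 exprD; apply: (@le_trans _ _ (del ^+ 2 * (C * del ^+ m * K))).
  by rewrite ler_wpM2r// !mulr_ge0// exprn_ge0// ltW.
by rewrite le_eqVlt; apply/orP; left; apply/eqP; ring.
Qed.

(* The group commutator of the two flows at (h, w) is translation by e^{hB}w - w. *)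
Lemma Lle_shift_commutator f h w L L' : 
  Lle L (fun z => (f (flowY B h (tr w z)) - f (tr w z)) - (f (flowY B h z) - f z)) ->
  Lle L' (fun z => (f (tr w (flowY B h z)) - f (flowY B h z)) - (f (tr w z) - f z)) ->
  Lle (L + L') (fun z => f (tr (expmx (h *: B) *m w - w) z) - f z).
Proof.
(* By invariance the bound may be proved at the point [tr w (flowY B h z)]. Its shift is
   [flowY B h (tr w z)], and in the difference of the two hypotheses all other terms cancel. *)
move=> HL HL'; apply: (Lle_trV (w := w)); apply: (Lle_flowV (h := h)).
apply: eq_Lp_le (Lp_leB p1 HL HL') => z.
rewrite -trD subrK -flow_tr.
move: (f _) (f _) (f _) (f _) => x1 x2 x3 x4; ring.
Qed.

(** [P] moves each block to the previous one, whose scale is larger by [del ^- 2]. Dividing by the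
    flow time [del ^+ 2] matches this exactly. *)
Lemma lift_bound i y M del : 0 <= M -> 0 < del -> tail b i.+1 y -> aniso b M del y ->
  tail b i (del ^- 2 *: (P *m y)) /\ aniso b (sum_norm_mx P * M) del (del ^- 2 *: (P *m y)).
Proof.
move=> M0 d0 yi yM; split=> k; rewrite mxE.
  move=> ki; rewrite mxE big1 ?mulr0// => l _.
  have [lk|lk] := eqVneq (b l) (b k).+1; last by rewrite P0// mul0r.
  by rewrite yi ?mulr0// lk ltnS.
rewrite normrM gtr0_norm ?invr_gt0 ?exprn_gt0// mulrC ler_pdivrMr ?exprn_gt0//.
rewrite -mulrA -exprD; rewrite -mulrA; apply: norm_mulmx_le.
  by rewrite mulr_ge0// exprn_ge0// ltW.
move=> l Pl; have [lk|lk] := eqVneq (b l) (b k).+1; last by rewrite P0 ?eqxx in Pl.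
by rewrite (le_trans (yM l))// lk mulnS -addnA addnC.
Qed.

(** In block i+1 the commutator shift is hBw with h = [del ^+ 2]. There only the part of w in block
    i matters, and it agrees with that of P y divided by h, so that B P y = y removes block i+1 of
    y. *)
Lemma tail_lift i y w del : 0 < del -> tail b i.+1 y -> tail b i w ->
  tail b i.+1 (del ^- 2 *: (P *m y) - w) ->
  tail b i.+2 (y - (expmx (del ^+ 2 *: B) *m w - w)).
Proof.
move=> d0 yi wi yw k; rewrite ltnS leq_eqVlt => /orP[/eqP ki|ki]; last first.
  have /(_ k ki) E := tail_expmx_sub B0 br (del ^+ 2) wi.
  by rewrite mxE yi// mxE E subr0.
rewrite 3!mxE; rewrite (expmx_lead B0 br (del ^+ 2) wi) ?ki//.
rewrite [(- w) k ord0]mxE [_ + _ * _]addrC addrK.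
suff -> : (B *m w) k ord0 = del ^- 2 * (B *m (P *m y)) k ord0.
  by rewrite BP ?ki// mulrA divff ?mul1r ?subrr// expf_neq0// gt_eqF.
have -> : del ^- 2 * (B *m (P *m y)) k ord0 = (B *m (del ^- 2 *: (P *m y))) k ord0.
  by rewrite -scalemxAr [RHS]mxE.
rewrite !mxE; apply: eq_bigr => l _.
have [kl|kl] := eqVneq (b k) (b l).+1; last by rewrite B0// !mul0r.
have := yw l; rewrite !mxE => /(_ _)/eqP; rewrite subr_eq0 => /(_ _)/eqP -> //.
by rewrite -kl ki.
Qed.

(* Up to later blocks, y is some xi for which the estimate of shift_le holds; so
   shift_le follows by descending induction on the first block of the shift. *)
Definition good_shift m i := forall M, 0 <= M -> exists2 C, 0 <= C &
  forall del y, 0 < del -> tail b i y -> aniso b M del y -> exists xi,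
    [/\ tail b i xi, aniso b C del xi, tail b i.+1 (y - xi) &
      forall f K, smooth f -> Wle m K f -> Lle (C * del ^+ m * K) (fun z => f (tr xi z) - f z)].

Definition block i (y : 'cV[R]_N) : 'cV[R]_N := \col_k (if b k == i then y k ord0 else 0).

Lemma pure_block i y : pure i (block i y).
Proof. by move=> k /negbTE bk; rewrite mxE bk. Qed.

Lemma tail_block i y : tail b i (block i y).
Proof. by move=> k ki; rewrite mxE ltn_eqF. Qed.

Lemma tail_sub_block i y : tail b i y -> tail b i.+1 (y - block i y).
Proof.
move=> yi k; rewrite ltnS leq_eqVlt => /orP[/eqP ki|ki]; rewrite !mxE.
  by rewrite ki eqxx subrr.
by rewrite yi// ltn_eqF// subr0.
Qed.

Lemma aniso_block i y M del : 0 <= M -> 0 <= del -> aniso b M del y -> aniso b M del (block i y).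
Proof.
move=> M0 d0 yM k; rewrite mxE; case: ifP => _; first exact: yM.
by rewrite normr0 mulr_ge0// exprn_ge0.
Qed.

Lemma norm_block i y M del : 0 <= M -> 0 <= del -> aniso b M del y ->
  forall k, `|block i y k ord0| <= M * del ^+ (2 * i + 1).
Proof.
move=> M0 d0 yM k; rewrite mxE; case: eqP => [<-|_]; first exact: yM.
by rewrite normr0 mulr_ge0// exprn_ge0.
Qed.

(** At the order 2i+1 the derivative along block i is bounded in L^p, and the block of y has size
    [del ^+ (2 * i + 1)]: the translation is integrated directly. *)
Lemma good_shift_odd i : good_shift (2 * i + 1) i.
Proof.
move=> M M0; have [C C0 HC] := Wle_pdir i.
exists (M + C * M); first by rewrite addr_ge0// mulr_ge0.
move=> del y d0 yi yM; have d0' := ltW d0.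
exists (block i y); split; [exact: tail_block|..|exact: tail_sub_block|].
  have ML : M <= M + C * M by rewrite lerDl mulr_ge0.
  exact: (@aniso_le _ _ b M _ _ _ d0' ML (@aniso_block i y M del M0 d0' yM)).
move=> f K sf fK; have K0 := Wle_ge0 fK; set w := block i y.
apply: (@eq_Lle _ (fun z => f (tr (1 *: w) z) - f z - 0 * (f (tr (1 *: w) z) - f z))).
  by move=> z; rewrite scale1r mul0r subr0.
apply: (Lle_mean_flow (psi := id) (chi := id) (generates_tr w) sf).
- exact: measurable_id.
- exact: measurable_id.
move=> s _.
have Md0 : 0 <= M * del ^+ (2 * i + 1) by rewrite mulr_ge0// exprn_ge0.
have := HC 0%N K _ f w Md0 sf fK (@pure_block i y) (@norm_block i y M del M0 d0' yM).
move=> /(Lle_tr ((s * 1) *: w)) T; apply: Lp_leW (eq_Lp_le _ T).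
  rewrite mulrDl mulrDl mulrA lerDr.
  by rewrite mulr_ge0.
by move=> z; rewrite mul1r mul0r subr0.
Qed.

(** Separately, the increments of f under a translation by w in block i are only of order
    [del ^+ (2 * i + 1)]. Their difference along the flow is therefore integrated in the direction
    w: the derivative of f along w lies in W^1 with a norm of that order, and comparing it at a
    point and at the image of that point under the flow gains one more factor [del]. *)
Lemma good_shift_even i : shift_le 1 i -> shift_le (2 * i) i -> good_shift (2 * i).+2 i.+1.
Proof.
move=> S1 S M M0; set sP := sum_norm_mx P.
have sPM : 0 <= sP * M by rewrite mulr_ge0// sum_norm_mx_ge0.
have [Ce Ce0 eM] := expmx_aniso B0 br.
have S' : (1 < (2 * i).+2)%N -> shift_le ((2 * i).+2 - 2) i by rewrite !subSS subn0.
have [C C0 HC] := @commutator_le (2 * i).+2 i isT S' _ sPM.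
have [C1 C10 HC1] := S1 _ sPM; have [D D0 HD] := Wle_pdir i.
(* [D * (sP * M)] is the size of the derivative along w. The factor [C1 + 1 + C1] counts the three
   moves from [tr v z] to [tr v (flowY B h z)]: undo the translation, follow the flow, translate
   again. *)
pose E := (C1 + 1 + C1) * (D * (sP * M)).
have E0 : 0 <= E by apply: mulr_ge0; [apply: addr_ge0 => //; exact: addr_ge0|exact: mulr_ge0].
exists (Ce * (sP * M) + sP * M + (C + E)).
  by rewrite !addr_ge0// mulr_ge0.
move=> del y d0 yi yM; have d0' := ltW d0.
have [w0i w0M] := lift_bound M0 d0 yi yM; set w0 := _ *: _ in w0i w0M.
pose w := block i w0; have wi : tail b i w by exact: tail_block.
have wM : aniso b (sP * M) del w by exact: aniso_block.
have hd : `|del ^+ 2| <= del ^+ 2 by rewrite ger0_norm// exprn_ge0.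
exists (expmx (del ^+ 2 *: B) *m w - w); split.
- exact: tail_expmx_sub.
- have ML : Ce * (sP * M) + sP * M <= Ce * (sP * M) + sP * M + (C + E) by rewrite lerDl addr_ge0.
  exact: (@aniso_le _ _ b _ _ _ _ d0' ML (anisoB (eM _ _ _ _ sPM d0' hd wM) wM)).
- by apply: tail_lift => //; exact: tail_sub_block.
move=> f K sf fK; have K0 := Wle_ge0 fK.
apply: (@Lp_leW _ _ _ _ _ (C * del ^+ (2 * i).+2 * K + E * del ^+ (2 * i).+2 * K)).
  rewrite -!mulrDl ler_wpM2r// ler_wpM2r ?exprn_ge0// lerDr addr_ge0//.
  by rewrite mulr_ge0.
apply: Lle_shift_commutator; first exact: HC.
set h := del ^+ 2.
apply: (@eq_Lle _ (fun z => f (tr (1 *: w) (flowY B h z)) - f (flowY B h z) -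
    1 * (f (tr (1 *: w) z) - f z))).
  by move=> z; rewrite scale1r mul1r.
apply: (Lle_mean_flow (psi := flowY B h) (chi := id) (generates_tr w) sf).
- exact: (flow_preserving h).1.
- exact: measurable_id.
move=> s /andP[s0 s1]; pose g := pdir w f; pose v := (s * 1) *: w.
have sg : smooth g by exact: smooth_pdir.
pose L := D * (sP * M * del ^+ (2 * i + 1)) * K.
have gL : Wle 1 L g.
  apply: HD => //.
  - by rewrite mulr_ge0// exprn_ge0.
  - by rewrite add1n addn1.
  - exact: pure_block.
  - exact: norm_block.
have vi : tail b i v by move=> k ki; rewrite mxE wi// mulr0.
have vM : aniso b (sP * M) del v.
  move=> k; rewrite mxE mulr1 normrM (ger0_norm s0); apply: le_trans (wM k).
  by rewrite ler_piMl.
have T := HC1 g L del v sg gL d0 vi vM.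
have [_ _ /(_ h del d0' hd) U] := gL.
have V := Lp_leB p1 (Lp_leD p1 (Lle_flow h T) U) T.
have EL : E * del ^+ (2 * i).+2 * K = C1 * del ^+ 1 * L + L * del + C1 * del ^+ 1 * L.
  by rewrite /E /L -[(2 * i).+2]addn1 -[(2 * i).+1]addn1 (exprD _ (2 * i + 1)) !expr1; ring.
rewrite EL; apply: eq_Lp_le V => z; rewrite -/g -/v !mul1r.
move: (g _) (g _) (g _) (g _) => x1 x2 x3 x4; ring.
Qed.

(** When the estimate of order m is available for a suitable shift w in block i, the increments of f
    under w at z and at its image under the flow are bounded separately, whence [D + D]; only the
    other half of the commutator needs integration. *)
Lemma good_shiftS m i : (0 < m)%N -> ((1 < m)%N -> shift_le (m - 2) i) ->
  good_shift m i -> good_shift m i.+1.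
Proof.
move=> m0 S G M M0; set sP := sum_norm_mx P.
have sPM : 0 <= sP * M by rewrite mulr_ge0// sum_norm_mx_ge0.
have [Ce Ce0 eM] := expmx_aniso B0 br.
have [D D0 HD] := G _ sPM.
have [C C0 HC] := commutator_le m0 S D0.
exists (Ce * D + D + (C + (D + D))); first by rewrite !addr_ge0// mulr_ge0.
move=> del y d0 yi yM; have d0' := ltW d0.
have [w0i w0M] := lift_bound M0 d0 yi yM; set w0 := _ *: _ in w0i w0M.
have [w [wi wM w0w Hw]] := HD _ _ d0 w0i w0M.
have hd : `|del ^+ 2| <= del ^+ 2 by rewrite ger0_norm// exprn_ge0.
exists (expmx (del ^+ 2 *: B) *m w - w); split.
- exact: tail_expmx_sub.
- have ML : Ce * D + D <= Ce * D + D + (C + (D + D)) by rewrite lerDl !addr_ge0.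
  exact: (@aniso_le _ _ b _ _ _ _ d0' ML (anisoB (eM _ _ _ _ D0 d0' hd wM) wM)).
- exact: tail_lift.
move=> f K sf fK; have K0 := Wle_ge0 fK; have {}Hw := Hw f K sf fK.
apply: (@Lp_leW _ _ _ _ _ (C * del ^+ m * K + (D * del ^+ m * K + D * del ^+ m * K))).
  rewrite -!mulrDl ler_wpM2r// ler_wpM2r ?exprn_ge0// lerDr addr_ge0//.
  by rewrite mulr_ge0.
apply: Lle_shift_commutator; first exact: HC.
exact: (Lp_leB p1 (Lle_flow (del ^+ 2) Hw) Hw).
Qed.

Lemma shift_le_desc m i : good_shift m i -> shift_le m i.+1 -> shift_le m i.
Proof.
move=> G S M M0; have [C C0 HC] := G M M0.
have [D D0 HD] := S (M + C) (addr_ge0 M0 C0).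
exists (D + C); first exact: addr_ge0.
move=> f K del xi sf fK d0 xii xiM.
have [eta [ei eM ee He]] := HC del xi d0 xii xiM.
have := HD f K del (xi - eta) sf fK d0 ee (anisoB xiM eM).
move=> /(Lle_tr eta) T; rewrite !mulrDl.
apply: eq_Lp_le (Lp_leD p1 T (He f K sf fK)) => z.
by rewrite -trD subrK addrA subrK.
Qed.

Lemma shift_le_tail m i : (r < i)%N -> shift_le m i.
Proof.
move=> ri M M0; exists 0 => // f K del xi sf fK d0 xii _.
have -> : xi = 0.
  by apply/colP => k; rewrite mxE xii// (leq_ltn_trans (br k)).
rewrite !mul0r; apply: eq_Lp_le (Lp_le0 mu p1) => z.
by rewrite tr0 subrr.
Qed.

(* Moving along x_k with b k >= i costs del ^ m only when m <= 2 i + 1, the degree of x_k. *)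
Lemma shift_leP m i : (m <= 2 * i + 1)%N -> shift_le m i.
Proof.
elim/ltn_ind: m i => m IH i mi.
have [m0|m0] := posnP m.
  move=> M M0; exists 2 => // f K del xi sf; rewrite m0 => fK d0 _ _.
  rewrite expr0 mulr1 mulr_natl mulr2n.
  exact: (Lp_leB p1 (Lle_tr xi fK) fK).
have Sm j : (m <= 2 * j + 1)%N -> (1 < m)%N -> shift_le (m - 2) j by move=> mj m1; apply: IH; lia.
have G j : (m <= 2 * j + 1)%N -> good_shift m j.
  elim: j => [|j IHj] mj.
    have -> : m = (2 * 0 + 1)%N by lia.
    exact: good_shift_odd.
  have [mj1|mj1] := leqP m (2 * j + 1)%N.
    by apply: good_shiftS => //; [exact: Sm|exact: IHj].
  have [mj2|mj2] := leqP m (2 * j).+2.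
    have E : m = (2 * j).+2 by lia.
    rewrite E; apply: good_shift_even; apply: IH; lia.
  have -> : m = (2 * j.+1 + 1)%N by lia.
  exact: good_shift_odd.
(* Descending induction on i, starting beyond block r where a shift has no nonzero coordinate
   left. *)
have [k ki] := ubnP (r.+1 - i); elim: k i mi ki => // k IHk i mi ki.
have [ri|ri] := leqP i r; last exact: shift_le_tail.
apply: shift_le_desc; first exact: G.
by apply: IHk; lia.
Qed.


(** * Taylor remainders in time, in one coordinate and in all coordinates *)

Lemma Taylor_flow_time m : exists2 C, 0 <= C & forall K f h del, smooth f -> Wle m K f ->
  0 < del -> `|h| <= del ^+ 2 ->
  Lle (C * del ^+ m * K) (fun z => f (flowY B h z) - Taylor_flow (derY B) 2 m h f z).
Proof.
apply: (Taylor_flow_le generates_flow (q := 2)) => //.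
  exists 1 => // {}m K f sf; rewrite addn2 mul1r; exact: Wle_derY.
(* The orders below the degree 2 of Y: the L^p bound for m = 0 and the Hölder bound for m = 1. *)
case=> [|[|//]] _; exists 1 => // K f h del sf fK d0 hd.
  rewrite expr0 !mul1r; apply: eq_Lle (Lle_flow h fK) => z.
  by rewrite subr0.
have [_ _ H] := fK; rewrite expr1 mul1r mulrC; exact: H (ltW d0) hd.
Qed.

Lemma pdir_delta k f : pdir (delta_mx k ord0) f = partial (Some k) f.
Proof.
apply/funext => z; rewrite /pdir (bigD1 k)//= big1 => [|l lk].
  by rewrite mxE !eqxx mul1r addr0.
by rewrite mxE (negbTE lk) mul0r.
Qed.

Lemma pdir_delta_fun k : pdir (delta_mx k ord0 : 'cV[R]_N) = partial (Some k).
Proof. by apply/funext => f; exact: pdir_delta. Qed.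

Lemma Wle_partial_block k : exists2 A, 0 <= A & forall m K f, smooth f ->
  Wle (m + (2 * b k + 1)) K f -> Wle m (A * K) (partial (Some k) f).
Proof.
have [A A0 HA] := Wle_pdir (b k); exists A => // m K f sf fK.
rewrite -pdir_delta -[A]mulr1; apply: HA => //.
  move=> l; have [->|lk] := eqVneq l k; first by rewrite eqxx.
  by rewrite mxE (negbTE lk).
by move=> l; rewrite mxE eqxx andbT; case: eqP => _; rewrite ?normr1// normr0.
Qed.

(** The estimate of order zero enters here: for the orders below the degree 2 b k + 1 of x_k, the
    base case is [shift_leP] for a multiple of the k-th basis vector. *)
Lemma Taylor_flow_coord k m : exists2 C, 0 <= C & forall K f h del, smooth f -> Wle m K f ->
  0 < del -> `|h| <= del ^+ (2 * b k + 1) ->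
  Lle (C * del ^+ m * K) (fun z => f (tr (h *: delta_mx k ord0) z) -
    Taylor_flow (partial (Some k)) (2 * b k + 1) m h f z).
Proof.
have q0 : (0 < 2 * b k + 1)%N by rewrite addn1.
rewrite -pdir_delta_fun.
apply: (Taylor_flow_le (generates_tr (delta_mx k ord0)) q0).
  rewrite pdir_delta_fun; exact: Wle_partial_block.
move=> [_|{}m mq].
  exists 1 => // K f h del sf fK d0 hd.
  rewrite expr0 !mul1r; apply: eq_Lle (Lle_tr (h *: delta_mx k ord0) fK) => z.
  by rewrite subr0.
have [C C0 HC] := shift_leP (ltnW mq) ler01.
exists C => // K f h del sf fK d0 hd; apply: HC => //.
  by move=> l lk; rewrite !mxE; case: eqP lk => [->|_ _]; rewrite ?ltnn// mulr0.
move=> l; rewrite !mxE eqxx andbT; case: eqP => [->|_].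
  by rewrite mulr1 mul1r.
by rewrite mulr0 normr0 mulr_ge0// exprn_ge0// ltW.
Qed.

Lemma Wle_iter k : exists2 A, 0 <= A & forall j m K f, smooth f ->
  Wle (m + (2 * b k + 1) * j) K f -> Wle m (A ^+ j * K) (iter j (partial (Some k)) f).
Proof.
have [A A0 HA] := Wle_partial_block k; exists A => //.
elim=> [|j IH] m K f sf; first by rewrite muln0 addn0 expr0 mul1r.
move=> fK; rewrite iterS exprS -mulrA; apply: HA.
  by apply: smooth_iter sf => g; exact: smooth_partial.
by apply: IH => //; rewrite -addnA -mulnS.
Qed.

(* The head of l is differentiated first, and Y last. *)
Fixpoint multi_Taylor (l : seq 'I_N) m (h : R) (xi : 'cV[R]_N) f (z : ts) : R :=
  if l is a :: l' then \sum_(j < m | ((2 * b a + 1) * j < m)%N)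
    exp_coef j (xi a ord0) * multi_Taylor l' (m - (2 * b a + 1) * j)%N h xi
      (iter j (partial (Some a)) f) z
  else Taylor_flow (derY B) 2 m h f z.

Lemma norm_exp_coef j (x : R) : `|exp_coef j x| <= `|x| ^+ j.
Proof.
rewrite /exp_coef normrM normrX normfV normr_nat ler_pdivrMr ?ltr0n ?fact_gt0//.
by rewrite ler_peMr ?exprn_ge0// ler1n fact_gt0.
Qed.

(** The remainder in x_a is taken at a point already moved in time and in the other coordinates,
    which by invariance does not change its norm. The coefficient of the j-th power is then expanded
    in the rest to the order m - qj, and the power of xi_a supplies the missing [del ^+ (q * j)]. *)
Lemma multi_Taylor_le l m : exists2 C, 0 <= C & forall K f h xi del,
  smooth f -> Wle m K f -> 0 < del -> `|h| <= del ^+ 2 ->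
  (forall k, `|xi k ord0| <= del ^+ (2 * b k + 1)) ->
  Lle (C * del ^+ m * K) (fun z =>
    f (tr (\sum_(k <- l) xi k ord0 *: delta_mx k ord0) (flowY B h z)) - multi_Taylor l m h xi f z).
Proof.
elim: l m => [|a l IH] m.
  have [C C0 HC] := Taylor_flow_time m; exists C => // K f h xi del sf fK d0 hd _.
  apply: eq_Lle (HC K f h del sf fK d0 hd) => z.
  by rewrite big_nil tr0.
have [D D0 HD] := Taylor_flow_coord a m.
have [A A0 HA] := Wle_iter a.
have /choice[C HC] : forall m, exists C, 0 <= C /\ forall K f h xi del,
  smooth f -> Wle m K f -> 0 < del -> `|h| <= del ^+ 2 ->
  (forall k, `|xi k ord0| <= del ^+ (2 * b k + 1)) ->
  Lle (C * del ^+ m * K) (fun z =>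
    f (tr (\sum_(k <- l) xi k ord0 *: delta_mx k ord0) (flowY B h z)) - multi_Taylor l m h xi f z).
  by move=> n; have [C C0 HC] := IH n; exists C.
set q := (2 * b a + 1)%N in HD HA *.
exists (D + \sum_(j < m | (q * j < m)%N) C (m - q * j)%N * A ^+ j).
  apply: addr_ge0 => //; apply: sumr_ge0 => j _; apply: mulr_ge0; first exact: (HC _).1.
  exact: exprn_ge0.
move=> K f h xi del sf fK d0 hd xid; have K0 := Wle_ge0 fK.
pose rest : 'cV[R]_N := \sum_(k <- l) xi k ord0 *: delta_mx k ord0.
have T0 := Lle_flow h (Lle_tr rest (HD K f (xi a ord0) del sf fK d0 (xid a))).
have T1 (j : 'I_m) : (q * j < m)%N -> Lle (C (m - q * j)%N * A ^+ j * del ^+ m * K)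
    (fun z => exp_coef j (xi a ord0) * (iter j (partial (Some a)) f (tr rest (flowY B h z)) -
      multi_Taylor l (m - q * j)%N h xi (iter j (partial (Some a)) f) z)).
  move=> jm.
  have sj : smooth (iter j (partial (Some a)) f).
    by apply: smooth_iter sf => g; exact: smooth_partial.
  have fj : Wle (m - q * j) (A ^+ j * K) (iter j (partial (Some a)) f).
    by apply: HA => //; rewrite subnK// ltnW.
  have U := Lp_leZ p1 (exp_coef j (xi a ord0)) ((HC _).2 _ _ h xi del sj fj d0 hd xid).
  apply: Lp_leW U.
  have -> : C (m - q * j)%N * A ^+ j * del ^+ m * K =
      del ^+ (q * j) * (C (m - q * j)%N * del ^+ (m - q * j) * (A ^+ j * K)).
    have -> : del ^+ m = del ^+ (m - q * j) * del ^+ (q * j) by rewrite -exprD subnK// ltnW.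
    move: (A ^+ j) (del ^+ (q * j)) (del ^+ (m - q * j)) (C _) => x1 x2 x3 x4; ring.
  rewrite ler_wpM2r//.
    apply: mulr_ge0; last by rewrite mulr_ge0// exprn_ge0.
    by rewrite mulr_ge0 ?exprn_ge0 ?(ltW d0)//; exact: (HC _).1.
  apply: le_trans (norm_exp_coef _ _) _.
  by rewrite exprM lerXn2r ?nnegrE// ?exprn_ge0 ?(ltW d0)//; exact: xid.
rewrite 2!mulrDl 2!mulr_suml.
have T2 := Lp_leD p1 T0 (Lp_le_sum p1 (index_enum 'I_m) T1).
apply: eq_Lle T2 => z.
rewrite big_cons trD -/rest /Taylor_flow.
under [X in _ + X]eq_bigr do rewrite mulrBr.
by rewrite sumrB addrA subrK.
Qed.
End Sobolev_bound.

(** * Test functions and uniqueness of weak derivatives *)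

Section flat.
Context {R : realType}.
Implicit Types (p : {poly R}) (x : R).

(** The polynomial factor makes the family stable under differentiation, which sends p to X^2 (p -
    p'); so [smooth_class] applies to it. *)
Definition flat p x : R := if 0 < x then p.[x^-1] * expR (- x^-1) else 0.

Lemma horner_expR_bounded p : exists2 C, 0 <= C & forall y, 0 <= y -> `|p.[y]| * expR (- y) <= C.
Proof.
(* For y >= 0, the exponential series gives y^i <= i! e^y. *)
exists (\sum_(i < size p) `|p`_i| * i`!%:R).
  by apply: sumr_ge0 => i _; rewrite mulr_ge0.
move=> y y0; rewrite horner_coef.
apply: (@le_trans _ _ ((\sum_(i < size p) `|p`_i * y ^+ i|) * expR (- y))).
  by rewrite ler_wpM2r ?expR_ge0// ler_norm_sum.
rewrite mulr_suml; apply: ler_sum => i _.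
rewrite normrM -mulrA ler_wpM2l// ger0_norm ?exprn_ge0// expRN ler_pdivrMr ?expR_gt0//.
rewrite -ler_pdivrMl ?ltr0n ?fact_gt0// mulrC.
case: (val i) => [|n].
  by rewrite expr0 fact0 divr1 -expR0 ler_expR.
by apply: le_trans (expR_ge1Dxn n y0); rewrite lerDr.
Qed.

Lemma flat_le0 p x : x <= 0 -> flat p x = 0.
Proof. by move=> x0; rewrite /flat ltNge x0. Qed.

(** The factor X^2 in the bounded function becomes 1/x^2. A quadratic bound at 0 is what makes the
    derivative vanish there. *)
Lemma flat_sqr_bounded p : exists2 C, 0 <= C & forall x, `|flat p x| <= C * x ^+ 2.
Proof.
have [C C0 HC] := horner_expR_bounded (p * 'X^2).
exists C => // x; rewrite /flat; case: ltP => x0; last first.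
  by rewrite normr0 mulr_ge0// sqr_ge0.
have := HC x^-1; rewrite hornerM hornerXn invr_ge0 (ltW x0) => /(_ isT).
rewrite [`|p.[_] * _ ^+ 2|]normrM [`|p.[_] * expR _|]normrM normrX [`|x^-1|]ger0_norm ?invr_ge0 ?(ltW x0)//.
rewrite [`|expR _|]ger0_norm ?expR_ge0// exprVn mulrAC => H.
by rewrite -ler_pdivrMr// exprn_gt0.
Qed.

Lemma is_derive_flat p x : is_derive x (1 : R) (flat p) (flat ('X^2 * (p - p^`())) x).
Proof.
have [x0|x0|->] := ltgtP x 0.
- rewrite flat_le0 ?(ltW x0)//.
  have D : is_derive x (1 : R) (cst (0 : R)) 0 by exact: is_derive_cst.
  apply: near_eq_is_derive D; near=> y; rewrite flat_le0// ltW//; near: y.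
  exact: lt_nbhsl.
- rewrite {2}/flat x0.
  have DV : is_derive x (1 : R) (fun y : R => y^-1) (- x ^- 2).
    have D1 := is_deriveV (f := id) (lt0r_neq0 x0) (is_derive_id x (1 : R)).
    by apply: (is_derive_eq D1); rewrite [_%:A]mulr1.
  have D2 := is_derive1_comp (is_derive_poly p x^-1) DV.
  have DN : is_derive x (1 : R) (fun y : R => - y^-1) (- - x ^- 2) by exact: is_deriveN.
  have D3 := @is_derive1_comp _ expR (fun y => - y^-1) x _ _ (is_derive_expR (- x^-1)) DN.
  apply: (near_eq_is_derive (f := (horner p \o (fun y => y^-1)) * (expR \o (fun y => - y^-1)))).
    near=> y; rewrite /flat; have -> // : 0 < y.
    by near: y; exact: lt_nbhsr.
  apply: (is_derive_eq (is_deriveM D2 D3)) => /=.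
  rewrite hornerM hornerXn hornerD hornerN exprVn.
  rewrite -[p.[_] *: _]/(_ * _) -[expR _ *: _]/(_ * _).
  move: (expR (- _)) p.[x^-1] _.[x^-1] (x ^- 2) => a1 a2 a3 a4; ring.
have [C C0 HC] := flat_sqr_bounded p.
have C1 : 0 < C + 1 by rewrite ltr_wpDl.
rewrite flat_le0//.
have E : (fun h : R => h^-1 *: ((flat p \o shift 0) (h *: 1) - flat p 0)) = fun h => h^-1 * flat p h.
  by apply/funext => h /=; rewrite addr0 [_%:A]mulr1 (flat_le0 _ (lexx 0)) subr0.
have L : h^-1 * flat p h @[h --> (0 : R)^'] --> (0 : R).
  apply/cvgr0Pnorm_le => e e0; near=> h.
  have h0 : h != 0 by near: h; exact: nbhs_dnbhs_neq.
  rewrite normrM normfV ler_pdivrMl ?normr_gt0//; apply: le_trans (HC h) _.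
  have he : `|h| <= e / (C + 1) by near: h; apply: dnbhs0_le; exact: divr_gt0.
  rewrite -real_normK ?num_real// expr2 mulrA [leRHS]mulrC ler_wpM2r//.
  apply: (@le_trans _ _ ((C + 1) * `|h|)); first by rewrite ler_wpM2r// lerDl.
  by rewrite mulrC -ler_pdivlMr.
apply: DeriveDef.
  rewrite /derivable E; apply/cvg_ex; exists 0; exact: L.
by rewrite /derive E; apply: cvg_lim => //; exact: L.
Unshelve. all: by end_near. Qed.

End flat.

Section test_functions.
Context (R : realType) (N : nat).
Local Notation ts := (timespace R N).
Local Notation mts := (measurableTypeR R * 'cV[R]_N)%type.
Local Notation mu := (lebesgue_space_sf R N).
Implicit Types (u f g phi : ts -> R) (o : option 'I_N).

Lemma smooth_flat (p : {poly R}) (s a : R) o :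
  smooth (fun z : ts => flat p (s * coord o z + a)).
Proof.
apply: (@smooth_class _ _ (fun f => exists p, f = fun z => flat p (s * coord o z + a)));
  last by exists p.
move=> _ [{}p ->].
have Dl (x : R) : is_derive x (1 : R) (fun x : R => s * x + a) s.
  apply: (is_derive_eq (is_deriveD (is_deriveZ s (is_derive_id x (1 : R))) (is_derive_cst a x (1 : R)))).
  by rewrite addr0 [_%:A]mulr1.
have D o' (z : ts) : is_derive z (direction o') (fun z => flat p (s * coord o z + a))
    ((o == o')%:R * (flat ('X^2 * (p - p^`())) (s * coord o z + a) * s)).
  rewrite -coord_direction; apply: (@is_derive_coord _ _ o z _ (fun x => flat p (s * x + a))).
  exact: (@is_derive1_comp _ (flat p) (fun x => s * x + a) _ _ _ (is_derive_flat _ _) (Dl _)).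
split.
  move=> z; apply: (@continuous_comp _ _ _ (fun z : ts => s * coord o z + a) (flat p)).
    apply: continuousD; last exact: cst_continuous.
    by apply: continuousM; [exact: cst_continuous|exact: continuous_coord].
  apply: differentiable_continuous; apply/derivable1_diffP.
  by have [] := is_derive_flat p (s * coord o z + a).
move=> o'; split; first by move=> z; have [] := D o' z.
exists (((o == o')%:R * s) *: ('X^2 * (p - p^`()))).
apply/funext => z; rewrite /partial; have [_ ->] := D o' z.
rewrite /flat; case: ifP => _; last by rewrite mul0r mulr0.
by rewrite hornerZ; ring.
Qed.

(* Compactly supported smooth weights with values in [0, 1]; their nonvanishing sets
   form a pi-system that generates the Borel sets. *)
Definition unit_test g := test_function g /\ forall z, 0 <= g z <= 1.

Definition test_sets : set (set mts) := [set A | exists2 g, unit_test g & A = [set z | g z != 0]].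

Lemma test_functionMl u g : smooth u -> test_function g -> test_function (fun z => u z * g z).
Proof.
move=> su [sg cg]; split; first exact: smoothM.
apply: (@subclosed_compact _ _ (closure [set z | g z != 0])) => //; first exact: closed_closure.
by apply: closureS => z /=; rewrite mulf_eq0 negb_or => /andP[].
Qed.

Lemma test_setsI : setI_closed test_sets.
Proof.
move=> _ _ [f [tf f01] ->] [g [tg g01] ->]; exists (fun z => f z * g z).
  split; first exact: test_functionMl tf.1 tg.
  move=> z; have /andP[f0 f1] := f01 z; have /andP[g0 g1] := g01 z.
  by rewrite mulr_ge0// mulr_ile1.
apply/seteqP; split => z /=; rewrite mulf_eq0 negb_or; first by move=> [-> ->].
by move=> /andP[].
Qed.

Lemma flat1_gt0 (x : R) : (flat 1 x != 0) = (0 < x).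
Proof.
rewrite /flat; case: ltP => x0; last by rewrite eqxx.
by rewrite hornerC mul1r gt_eqF// expR_gt0.
Qed.

Lemma flat1_01 (x : R) : 0 <= flat 1 x <= 1.
Proof.
rewrite /flat; case: ltP => x0; last by rewrite lexx ler01.
by rewrite hornerC mul1r expR_ge0 -expR0 ler_expR oppr_le0 invr_ge0 ltW.
Qed.

Lemma tsbox_coord (z w : ts) e : tsbox z e w <-> forall o, `|coord o w - coord o z| < e.
Proof.
split; first by move=> [w1 w2] [k|]; [exact: w2|exact: w1].
by move=> H; split; [exact: (H None)|move=> k; exact: (H (Some k))].
Qed.

Lemma compact_box (z : ts) e : compact [set w : ts | forall o, `|coord o w - coord o z| <= e].
Proof.
pose G (a : R * 'rV[R]_N) : ts := (a.1, a.2^T).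
have cG : continuous G.
  apply: continuous_cV => -[k|] a; last exact: cvg_fst.
  rewrite (_ : (fun s => _) = fun a : R * 'rV[R]_N => a.2 ord0 k); last first.
    by apply/funext => s; rewrite /= mxE.
  apply: (@continuous_comp _ _ _ (fun a : R * 'rV[R]_N => a.2) (fun x : 'rV[R]_N => x ord0 k)).
    exact: cvg_snd.
  exact: coord_continuous.
pose I (x : R) : set R := `[x - e, x + e]%classic.
have Ie (x y : R) : I y x <-> `|x - y| <= e by rewrite /I/= in_itv/= ler_distl.
rewrite (_ : [set w | _] = G @` (I z.1 `*` [set v : 'rV[R]_N | forall i, I (z.2 i ord0) (v ord0 i)])).
  apply: continuous_compact; first exact: continuous_subspaceT.
  apply: compact_setX; first exact: segment_compact.
  by apply: (rV_compact (A := fun i => I (z.2 i ord0))) => i; exact: segment_compact.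
apply/seteqP; split => w /=.
  move=> H; exists (w.1, w.2^T); last by rewrite /G/= trmxK; case: (w).
  split => /=; first by apply/Ie; exact: (H None).
  by move=> i; rewrite mxE; apply/Ie; exact: (H (Some i)).
move=> [a [/= /Ie a1 a2] <-] [k|] //=.
by rewrite mxE; apply/Ie.
Qed.

Lemma compact_closure_tsbox (z : ts) e : compact (closure (tsbox z e)).
Proof.
have cC := @compact_box z e; set C := [set w : ts | _] in cC.
apply: (subclosed_compact _ cC); first exact: closed_closure.
have CC : closed C by apply: compact_closed => //; exact: norm_hausdorff.
rewrite [X in _ `<=` X](proj1 (closure_id C) CC).
by apply: closureS => w /tsbox_coord H o; exact/ltW.
Qed.

(** [flat 1] is nonzero exactly on the positive numbers; the product of two copies for each
    coordinate, one for each end of its interval, is nonzero exactly on the box. *)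
Lemma test_sets_tsbox (z : ts) e : 0 < e -> test_sets (tsbox z e).
Proof.
move=> e0.
pose g (w : ts) := \prod_o (flat 1 (1 * coord o w + (e - coord o z)) *
  flat 1 ((-1) * coord o w + (e + coord o z))).
have gE w : (g w != 0) = [forall o, `|coord o w - coord o z| < e].
  rewrite /g; apply/prodf_neq0/forallP => [H o|H o _].
    have := H o isT; rewrite mulf_eq0 negb_or !flat1_gt0 mul1r mulN1r ltr_norml => /andP[h1 h2].
    by apply/andP; split; lra.
  rewrite mulf_eq0 negb_or !flat1_gt0 mul1r mulN1r.
  by have := H o; rewrite ltr_norml => /andP[h1 h2]; apply/andP; split; lra.
have E : tsbox z e = [set w | g w != 0].
  apply/seteqP; split => w /=.
    by move=> /tsbox_coord H; rewrite gE; apply/forallP.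
  by rewrite gE => /forallP H; apply/tsbox_coord.
exists g => //; split; last first.
  move=> w; apply/andP; split.
    apply: prodr_ge0 => o _; apply: mulr_ge0.
      by have /andP[] := flat1_01 (1 * coord o w + (e - coord o z)).
    by have /andP[] := flat1_01 ((-1) * coord o w + (e + coord o z)).
  apply: prodr_ile1 => o _.
  have /andP[a0 a1] := flat1_01 (1 * coord o w + (e - coord o z)).
  have /andP[b0 b1] := flat1_01 ((-1) * coord o w + (e + coord o z)).
  by rewrite mulr_ge0// mulr_ile1.
split.
  by apply: smooth_prod => o _; apply: smoothM; exact: smooth_flat.
by rewrite -E; exact: compact_closure_tsbox.
Qed.

(** Test sets are open, hence Borel. Conversely, boxes are test sets, so the coordinates are
    measurable for the generated sigma-algebra, and the coordinates determine the Borel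
    structure. *)
Lemma measurable_test_sets : @measurable _ mts = <<s test_sets>>.
Proof.
apply/seteqP; split; last first.
  apply: smallest_sub; first exact: sigma_algebra_measurable.
  move=> _ [g [[sg _] _] ->]; apply: open_measurable_space.
  rewrite (_ : [set z | _] = g @^-1` [set x | x != 0])//.
  apply: open_comp; last exact: open_neq.
  by move=> z _; exact: smooth_continuous.
pose TG := g_sigma_algebraType test_sets.
have mc o : measurable_fun [set: TG] (fun z : TG => coord o z : measurableTypeR R).
  apply: (measurability _ (RGenOpens.measurableE R)).
  move=> _ [_ [a [b ->]] <-]; rewrite setTI.
  apply: (@open_sigma_tsbox R N <<s test_sets>>).
  - exact: smallest_sigma_algebra.
  - by move=> z e e0; apply: sub_sigma_algebra; exact: test_sets_tsbox.
  - apply: open_comp; last exact: interval_open.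
    by move=> z _; exact: continuous_coord.
have mid : measurable_fun [set: TG] (fun z : TG => (z.1, z.2) : mts).
  apply: measurable_fun_pair; first exact: (mc None).
  by apply: measurable_to_cV => i; exact: (mc (Some i)).
move=> A mA; have := mid measurableT A mA; rewrite setTI.
by congr (_ _); apply/seteqP; split => -[].
Qed.

End test_functions.

Section density.
Context d (T : measurableType d) (R : realType) (mu : {measure set T -> \bar R}).
Variables (f : T -> \bar R) (mf : measurable_fun setT f) (f0 : forall x, (0 <= f x)%E).

(* The proofs are arguments so that density has an instance of measure. *)
Definition density (mf : measurable_fun setT f) (f0 : forall x, (0 <= f x)%E) (A : set T) :=
  (\int[mu]_(x in A) f x)%E.

Let density0 : density mf f0 set0 = 0%E. Proof. exact: integral_set0. Qed.
Let density_ge0 A : (0 <= density mf f0 A)%E. Proof. exact: integral_ge0. Qed.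
Let density_sigma_additive : semi_sigma_additive (density mf f0).
Proof. exact: semi_sigma_additive_nng_induced. Qed.

HB.instance Definition _ := isMeasure.Build _ _ _ (density mf f0)
  density0 density_ge0 density_sigma_additive.
End density.

Section weak_uniqueness.
Context (R : realType) (N : nat).
Local Notation ts := (timespace R N).
Local Notation mts := (measurableTypeR R * 'cV[R]_N)%type.
Local Notation mu := (lebesgue_space R N).
Variable w : ts -> R.
Hypothesis lw : locally_integrable_space w.
Hypothesis w0 : forall phi, test_function phi -> \int[mu]_z (w z * phi z) = 0.

Let mw : measurable_fun [set: mts] (EFin \o w).
Proof. by apply/measurable_EFinP; exact: lw.1. Qed.

Let integrable_compact (K : set ts) : compact K -> mu.-integrable (K : set mts) (EFin \o w).
Proof.
move=> cK; apply/integrableP; split; first exact: measurable_funTS.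
exact: lw.2.
Qed.

Let integrable_test A : test_sets A -> mu.-integrable A (EFin \o w).
Proof.
move=> [g [[sg cg] g01] ->].
apply: integrableS (integrable_compact cg).
- exact: compact_measurable_space.
- rewrite (@measurable_test_sets R N); apply: sub_sigma_algebra.
  by exists g.
- exact: subset_closure.
Qed.

(** The functions 1 - (1 - g)^n are test functions with values in [0, 1] that vanish where g does,
    and they tend to the indicator of the set where g is nonzero. Dominated convergence passes from
    [w0] to this indicator. *)
Let integral_test A : test_sets A -> (\int[mu]_(z in A) (w z)%:E = 0)%E.
Proof.
move=> [g [[sg cg] g01] ->]; set A0 := [set z | _]; pose K : set mts := closure A0.
have mA0 : measurable (A0 : set mts).
  by rewrite (@measurable_test_sets R N); apply: sub_sigma_algebra; exists g.
have mK : measurable K by exact: compact_measurable_space.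
have AK : A0 `<=` K by exact: subset_closure.
have iK : mu.-integrable K (EFin \o w) by exact: integrable_compact.
pose phi n z := 1 - (1 - g z) ^+ n.
have phi0 n z : g z = 0 -> phi n z = 0 by rewrite /phi => ->; rewrite subr0 expr1n subrr.
have tphi n : test_function (phi n).
  split; first by apply: smoothB; [exact: smooth_cst|apply: smoothX; apply: smoothB => //; exact: smooth_cst].
  apply: (subclosed_compact _ cg); first exact: closed_closure.
  by apply: closureS => z /=; apply: contra_neq; exact: phi0.
have phi01 n z : `|phi n z| <= 1.
  have /andP[g0 g1] := g01 z.
  have h0 : 0 <= (1 - g z) ^+ n by rewrite exprn_ge0// subr_ge0.
  have h1 : (1 - g z) ^+ n <= 1 by rewrite exprn_ile1 ?subr_ge0// lerBlDr lerDl.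
  by rewrite ger0_norm /phi ?subr_ge0// lerBlDr lerDl.
have mphi n : measurable_fun [set: mts] (fun z => (w z * phi n z)%:E).
  apply/measurable_EFinP; apply: measurable_funM; first exact: lw.1.
  by apply: continuous_measurable_space; exact: smooth_continuous (tphi n).1.
have lephi n z : (`|(w z * phi n z)%:E| <= `|(w z)%:E|)%E.
  by rewrite lee_fin normrM ler_piMr.
have iphi n : mu.-integrable K (fun z => (w z * phi n z)%:E).
  by apply: le_integrable iK => //; exact: measurable_funTS.
have E n : (\int[mu]_(z in K) (w z * phi n z)%:E = 0)%E.
  (* [w0] only concerns the real number [fine] of the integral, which is also 0 for an infinite one;
     integrability excludes that. *)
  rewrite -(fineK (integrable_fin_num mK (iphi n))).
  have := w0 (tphi n); rewrite /Rintegral => H; congr EFin; rewrite -[RHS]H; congr fine.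
  rewrite integral_mkcond; apply: eq_integral => z _; rewrite patchE.
  case: ifPn => // /negP zK; congr EFin.
  have -> : g z = 0 -> 0 = w z * phi n z by move=> gz; rewrite phi0// mulr0.
    by [].
  apply/eqP; apply: contra_notT zK => gz; rewrite inE; exact: AK.
have [] := @dominated_convergence _ _ _ mu K mK (fun n z => (w z * phi n z)%:E)
  ((EFin \o w) \_ A0) (fun z => `|(w z)%:E|)%E.
- by move=> n; exact: measurable_funTS.
- by apply: measurable_funTS; apply/(measurable_restrictT _ mA0); exact: measurable_funTS.
- apply: aeW => z _; rewrite patchE; case: ifPn => [|/negP]; rewrite inE => gz; last first.
    have {}gz : g z = 0 by apply/eqP; apply: contra_notT gz.
    under eq_fun do rewrite phi0// mulr0.
    exact: cvg_cst.
  apply: cvg_EFin; first exact: nearW.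
  rewrite -[X in _ --> X]mulr1; apply: cvgM; first exact: cvg_cst.
  rewrite -[X in _ --> X]subr0; apply: cvgB; first exact: cvg_cst.
  apply: cvg_expr; have /andP[g0 g1] := g01 z.
  rewrite ger0_norm ?subr_ge0// gtrBl lt_def g0 andbT; exact: gz.
- exact: integrable_abse.
- by apply: aeW => z n _; exact: lephi.
move=> _ _; under eq_fun do rewrite E.
move=> H; have := cvg_unique _ H (cvg_cst _).
rewrite -integral_mkcondr setIidr// => -> //.
Qed.

(** The positive and negative parts of w are densities of two measures that agree on the test sets
    and are finite on boxes, so they agree on all Borel sets. *)
Let pos_neg A : measurable (A : set mts) ->
  (\int[mu]_(z in A) (EFin \o w)^\+ z = \int[mu]_(z in A) (EFin \o w)^\- z)%E.
Proof.
pose mp := density mu (measurable_funepos mw) (funepos_ge0 (EFin \o w)).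
pose mn := density mu (measurable_funeneg mw) (funeneg_ge0 (EFin \o w)).
apply: (@measure_unique _ _ _ (@test_sets R N) (fun k => tsbox (0 : ts) k.+1%:R) _ _ _ _ mp mn).
- exact: measurable_test_sets.
- exact: test_setsI.
- by move=> k; exact: test_sets_tsbox.
- apply/seteqP; split => // z _.
  have [M M0 /(_ z erefl) zM] := compact_tsbounded (@compact_set1 (timespace R N) z).
  exists (Num.trunc M) => //; have := truncnS_gt M; move: zM => [z1 z2] Mt.
  by split=> [|i]; [exact: lt_trans z1 Mt|exact: lt_trans (z2 i) Mt].
- move=> {}A tA; have iA := integrable_test tA.
  have mA : measurable A by rewrite (@measurable_test_sets R N); exact: sub_sigma_algebra.
  have := integral_test tA; rewrite integralE => /eqP.
  rewrite sube_eq ?add0e; last 2 first.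
  - exact: integrable_fin_num (integrable_funepos mA iA).
  - apply: fin_num_adde_defl; exact: integrable_fin_num (integrable_funeneg mA iA).
  by move=> /eqP.
move=> k; have tA := test_sets_tsbox (0 : ts) (ltr0Sn R k).
have mA : measurable (tsbox (0 : ts) k.+1%:R : set mts) by exact: measurable_tsbox.
rewrite ltey_eq; apply/orP; left.
exact: integrable_fin_num (integrable_funepos mA (integrable_test tA)).
Qed.

Lemma ae_zero_weak : {ae mu, forall z : mts, w z = 0}.
Proof.
have H k : {ae mu, forall z : mts, tsbox (0 : ts) k.+1%:R z -> (EFin \o w)^\+%E z = (EFin \o w)^\-%E z}.
  have mA : measurable (tsbox (0 : ts) k.+1%:R : set mts) by exact: measurable_tsbox.
  apply: (integral_ae_eq mA).
  - exact: integrable_funepos (integrable_test (test_sets_tsbox (0 : ts) (ltr0Sn R k))).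
  - by apply: measurable_funTS; exact: measurable_funeneg.
  - by move=> E _ mE; exact: pos_neg.
apply: filterS (ae_foralln H) => z Hz.
have [M M0 /(_ z erefl) zM] := compact_tsbounded (@compact_set1 (timespace R N) z).
have /Hz : tsbox (0 : ts) (Num.trunc M).+1%:R z.
  have := truncnS_gt M; move: zM => [z1 z2] Mt.
  by split=> [|i]; [exact: lt_trans z1 Mt|exact: lt_trans (z2 i) Mt].
move=> E; have := congr1 (fun f => f z) (funeposneg (EFin \o w)); rewrite /= E.
rewrite subee; first by case.
by rewrite funenegE maxEle; case: ifP.
Qed.

End weak_uniqueness.

(** * Weak derivatives of smooth functions *)

Section integration_by_parts.
Context (R : realType) (N : nat).
Local Notation ts := (timespace R N).
Local Notation mts := (measurableTypeR R * 'cV[R]_N)%type.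
Local Notation mu := (lebesgue_space_sf R N).
Implicit Types (u f g w phi : ts -> R).

Lemma integrable_Mcompact w phi (K : set ts) : locally_integrable_space w -> continuous phi ->
  compact K -> (forall z, ~ K z -> phi z = 0) -> mu.-integrable setT (EFin \o (fun z => w z * phi z)).
Proof.
move=> [mw lw] cphi cK phi0; have mphi := continuous_measurable_space cphi.
have mK := compact_measurable_space cK.
have mwphi : measurable_fun [set: mts] (EFin \o (fun z => w z * phi z)).
  by apply/measurable_EFinP; exact: measurable_funM.
have /compact_bounded[M [_ HM]] : compact (phi @` K).
  by apply: continuous_compact => //; exact: continuous_subspaceT.
have M1 z : K z -> `|phi z| <= `|M| + 1.
  by move=> Kz; apply: HM; [rewrite (le_lt_trans (ler_norm _))// ltrDl|exists z].
have iw : mu.-integrable (K : set mts) (EFin \o w).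
  apply/integrableP; split; first by apply: measurable_funTS; exact/measurable_EFinP.
  exact: lw.
have E : EFin \o (fun z => w z * phi z) = (EFin \o (fun z => w z * phi z)) \_ K.
  apply/funext => z; rewrite patchE; case: ifPn => // /negP; rewrite inE => Kz.
  by rewrite /= phi0// mulr0.
rewrite E; apply/(integrable_mkcond _ mK).
apply: (@le_integrable _ _ _ mu _ mK _ (fun z => (`|M| + 1)%:E * (w z)%:E)%E).
- exact: measurable_funTS.
- move=> z Kz; rewrite /= lee_fin normrM normrM mulrC ler_wpM2r//.
  by rewrite [leRHS]ger0_norm ?addr_ge0//; exact: M1.
- exact: integrableZl.
Qed.

(** X is local because it is a derivative along orbits, and an orbit stays near its starting point
    for small times. *)
Lemma generator_eq0 Phi X f z : generates Phi X -> smooth f -> (\near z, f z = 0) -> X f z = 0.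
Proof.
move=> gP sf f0.
have D := gen_derive gP z 1 0 sf; rewrite !mul0r (gen0 gP) mul1r in D.
have D0 : is_derive (0 : R) (1 : R) (cst (0 : R)) 0 by exact: is_derive_cst.
have {}D0 : is_derive (0 : R) (1 : R) (fun h => f (Phi (h * 1) z)) 0.
  apply: near_eq_is_derive D0.
  have c : Phi (h * 1) z @[h --> (0 : R)] --> z.
    have c : continuous (fun s : R => Phi (s * 1) z) by exact: (gen_cont gP).
    by have := c 0; rewrite /continuous_at mul0r (gen0 gP).
  near=> h; apply/esym; near: h; exact: (c _ f0).
by rewrite -(@derive_val _ _ _ _ _ _ _ D) (@derive_val _ _ _ _ _ _ _ D0).
Unshelve. all: by end_near. Qed.

Lemma generatorM Phi X f g z : generates Phi X -> smooth f -> smooth g ->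
  X (fun z => f z * g z) z = f z * X g z + X f z * g z.
Proof.
move=> gP sf sg.
have D := gen_derive gP z 1 0 (smoothM sf sg); rewrite !mul0r (gen0 gP) mul1r in D.
have Df := gen_derive gP z 1 0 sf; have Dg := gen_derive gP z 1 0 sg.
have := is_deriveM Df Dg; rewrite !mul0r (gen0 gP) !mul1r => D'.
rewrite -(@derive_val _ _ _ _ _ _ _ D) (@derive_val _ _ _ _ _ _ _ D').
by rewrite -[f z *: _]/(_ * _) -[g z *: _]/(_ * _) [g z * _]mulrC.
Qed.

(* The integral of g o Phi_s does not depend on s, and its derivative is that of X g. *)
Lemma integral_generator0 Phi X g : generates Phi X -> (forall h, measure_preserving mu (Phi h)) ->
  smooth g -> mu.-integrable setT (EFin \o g) -> mu.-integrable setT (EFin \o X g) ->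
  (\int[mu]_z (X g z)%:E = 0)%E.
Proof.
move=> gP mP sg ig iX; have sX := gen_smooth gP sg.
set leb : {sigma_finite_measure set (measurableTypeR R) -> \bar R} := lebesgue_measure.
pose D : set (measurableTypeR R) := `[0, 1]%classic.
have mD : measurable D by exact: measurable_itv.
have lD : leb D = 1%E by rewrite /D /leb/= lebesgue_measure_itv/= lte_fin ltr01 oppr0 adde0.
have iD : (\int[leb]_x (\1_D x)%:E = 1)%E.
  by transitivity (leb (D `&` setT)); [exact: integral_indic|rewrite setIT].
have [c Ec] : exists c : R, (\int[mu]_z (X g z)%:E = c%:E)%E.
  by exists (fine (\int[mu]_z (X g z)%:E)%E); rewrite fineK//; exact: integrable_fin_num.
pose G (a : measurableTypeR R * mts) := X g (Phi (a.1 * 1) a.2).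
have mG : measurable_fun setT G by exact: (measurable_joint sX (gen_meas gP 1)).
pose f (a : measurableTypeR R * mts) := (\1_D a.1 * G a)%:E.
have mf : measurable_fun setT f.
  apply/measurable_EFinP; apply: measurable_funM => //.
  exact: (measurableT_comp (measurable_indic mD) measurable_fst).
have iXP s : mu.-integrable setT (fun z => (X g (Phi s z))%:E).
  apply/integrableP; split.
    exact: (measurableT_comp (measurable_int _ iX) (mP s).1).
  rewrite (ge0_integral_preserving (mP s) (f := fun z => `|(X g z)%:E|%E)) => //.
    by have /integrableP[] := iX.
  by apply: measurableT_comp => //; exact: measurable_int iX.
have intf s : (\int[mu]_z f (s, z) = (\1_D s)%:E * \int[mu]_z (X g z)%:E)%E.
  rewrite /f/= /G/=; under eq_integral do rewrite EFinM.
  rewrite integralZl//.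
  by rewrite (integral_preserving (mP (s * 1)) iX).
have intabs s : (\int[mu]_z `|f (s, z)| = (\1_D s)%:E * \int[mu]_z `|(X g z)%:E|)%E.
  rewrite /f/= /G/=; under eq_integral do rewrite normrM EFinM ger0_norm//.
  rewrite ge0_integralZl_EFin//; last first.
    apply/measurable_EFinP; apply: measurableT_comp => //.
    exact: measurable_joint sX (mP (s * 1)).1.
  rewrite (ge0_integral_preserving (mP (s * 1)) (f := fun z => `|(X g z)%:E|%E))//.
  by apply: measurableT_comp => //; exact: measurable_int iX.
(* The joint integrability required by Fubini's theorem: by invariance, each slice with s in [0, 1]
   has the L^1 norm of X g. *)
have If : (leb \x mu)%E.-integrable setT f.
  apply/(@integrable12ltyP _ _ _ _ _ leb mu f mf).
  under eq_integral do rewrite intabs.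
  rewrite ge0_integralZr//; last 2 first.
  - by apply/measurable_EFinP; exact: measurable_indic.
  - by apply: integral_ge0.
  rewrite iD mul1e.
  by have /integrableP[] := iX.
have := Fubini (m1 := leb) (m2 := mu) If.
under eq_integral do rewrite intf Ec.
rewrite integralZr//; last exact: integrable_indic_itv.
rewrite iD mul1e Ec => ->.
have E z : (\int[leb]_s f (s, z) = (g (Phi 1 z))%:E - (g z)%:E)%E.
  have := integral_is_derive01 (h := fun s => g (Phi (s * 1) z)) (g := fun s => 1 * X g (Phi (s * 1) z))
    (fun s => gen_derive gP z 1 s sg) _.
  rewrite mul1r mul0r (gen0 gP) EFinB => <-.
    rewrite integral_indicM; apply: eq_integral => s _.
    by rewrite mul1r -EFinM.
  have := @continuous_generates _ _ Phi X 1 z (X g) gP sX.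
  by rewrite (_ : (fun s => 1 * _) = fun s => X g (Phi (s * 1) z))//; apply/funext => s; rewrite mul1r.
under eq_integral do rewrite E.
have igP : mu.-integrable setT (fun z => (g (Phi 1 z))%:E).
  apply/integrableP; split.
    exact: (measurableT_comp (measurable_int _ ig) (mP 1).1).
  rewrite (ge0_integral_preserving (mP 1) (f := fun z => `|(g z)%:E|%E)) => //.
    by have /integrableP[] := ig.
  by apply: measurableT_comp => //; exact: measurable_int ig.
rewrite integralB// (integral_preserving (mP 1) ig) subee//.
exact: integrable_fin_num.
Qed.

Lemma generator_support Phi X phi z : generates Phi X -> test_function phi ->
  ~ closure [set z | phi z != 0] z -> X phi z = 0.
Proof.
move=> gP [sphi _] zK; apply: (generator_eq0 gP sphi).
have : open (~` closure [set z | phi z != 0]) by apply: closed_openC; exact: closed_closure.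
rewrite openE => /(_ z zK); apply: filterS => y yK.
by apply/eqP; apply: contra_notT yK => y0; exact: subset_closure.
Qed.

(** The integral of X over the product f phi vanishes, and X is a derivation; the compact support of
    phi makes all terms integrable although f need not be. *)
Lemma integration_by_parts Phi X f phi : generates Phi X ->
  (forall h, measure_preserving mu (Phi h)) -> smooth f -> test_function phi ->
  \int[mu]_z (f z * X phi z) = - \int[mu]_z (X f z * phi z).
Proof.
move=> gP mP sf tphi; have [sphi cK] := tphi; set K := closure _ in cK.
have phiK z : ~ K z -> phi z = 0.
  by move=> zK; apply/eqP; apply: contra_notT zK => z0; exact: subset_closure.
have XphiK z : ~ K z -> X phi z = 0 by exact: (generator_support gP tphi).
have sXphi := gen_smooth gP sphi; have sX := gen_smooth gP sf.
have cl g : smooth g -> locally_integrable_space g.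
  by move=> sg; apply: continuous_locally_integrable; exact: smooth_continuous.
have i1 : mu.-integrable setT (EFin \o (fun z => f z * X phi z)).
  by apply: (integrable_Mcompact _ _ cK XphiK); [exact: cl|exact: smooth_continuous].
have i2 : mu.-integrable setT (EFin \o (fun z => X f z * phi z)).
  by apply: (integrable_Mcompact _ _ cK phiK); [exact: cl|exact: smooth_continuous].
have i0 : mu.-integrable setT (EFin \o (fun z => f z * phi z)).
  by apply: (integrable_Mcompact _ _ cK phiK); [exact: cl|exact: smooth_continuous].
have XE : X (fun z => f z * phi z) = fun z => f z * X phi z + X f z * phi z.
  by apply/funext => z; rewrite (generatorM z gP sf sphi).
apply/eqP; rewrite -addr_eq0 -RintegralD// -XE.
rewrite /Rintegral (integral_generator0 gP mP (smoothM sf sphi))//.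
rewrite XE; have := integrableD measurableT i1 i2.
by apply: eq_integrable => // z _; rewrite /= EFinD.
Qed.

(** [v] is only assumed equal to f almost everywhere: the Sobolev norm evaluates its pieces at
    chosen weak derivatives, which are known up to a null set, and these are differentiated
    again. *)
Lemma weak_der_ae Phi X v w f : generates Phi X ->
  (forall h, measure_preserving mu (Phi h)) -> smooth f ->
  {ae mu, forall z : mts, v z = f z} -> weak_der X v w -> {ae mu, forall z : mts, w z = X f z}.
Proof.
move=> gP mP sf vf [lv lw vw]; have sX := gen_smooth gP sf.
have lX : locally_integrable_space (X f).
  by apply: continuous_locally_integrable; exact: smooth_continuous.
have lwX : locally_integrable_space (fun z => w z - X f z).
  split; first exact: measurable_funB lw.1 lX.1.
  move=> K cK; have mK := compact_measurable_space cK.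
  have iK g : locally_integrable_space g -> mu.-integrable (K : set mts) (EFin \o g).
    move=> lg; apply/integrableP; split; last exact: lg.2.
    by apply: measurable_funTS; apply/measurable_EFinP; exact: lg.1.
  by have /integrableP[] := integrableB mK (iK _ lw) (iK _ lX).
have H : {ae mu, forall z : mts, w z - X f z = 0}.
  apply: (ae_zero_weak lwX) => phi tphi; have [sphi cK] := tphi; set K := closure _ in cK.
  have phiK z : ~ K z -> phi z = 0.
    by move=> zK; apply/eqP; apply: contra_notT zK => z0; exact: subset_closure.
  have cphi := smooth_continuous sphi.
  have i1 := integrable_Mcompact lw cphi cK phiK.
  have i2 := integrable_Mcompact lX cphi cK phiK.
  under eq_Rintegral do rewrite mulrBl.
  rewrite (RintegralB (mu := mu))//.
  have /eqP := vw phi tphi; rewrite -eqr_oppLR => /eqP <-.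
  have -> : \int[mu]_z (v z * X phi z) = \int[mu]_z (f z * X phi z).
    rewrite /Rintegral; congr fine; apply: ae_eq_integral => //.
    - apply/measurable_EFinP; apply: measurable_funM; first exact: lv.1.
      by apply: smooth_measurable; exact: gen_smooth gP _ sphi.
    - apply/measurable_EFinP; apply: measurable_funM; first exact: smooth_measurable.
      by apply: smooth_measurable; exact: gen_smooth gP _ sphi.
    - by apply: filterS vf => z vz _; rewrite vz.
  by rewrite (integration_by_parts gP mP sf tphi) opprK subrr.
by apply: filterS H => z /eqP; rewrite subr_eq0 => /eqP.
Qed.

End integration_by_parts.

(** * From norms of weak derivatives to bounds on classical derivatives *)

Section Sobolev_Wle.
Context (R : realType) (N : nat) (B : 'M[R]_N) (b : 'I_N -> nat) (r d : nat).
Hypothesis B0 : forall k l, b k != (b l).+1 -> B k l = 0.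
Hypothesis br : forall k, (b k <= r)%N.
Hypothesis bmono : forall k l : 'I_N, (b k < b l)%N -> (k < l)%N.
Hypothesis bd : forall k : 'I_N, b k = 0%N -> (k < d)%N.
Variable p : R.
Hypothesis p1 : 1 <= p.
Local Notation ts := (timespace R N).
Local Notation mts := (measurableTypeR R * 'cV[R]_N)%type.
Local Notation mu := (lebesgue_space_sf R N).
Local Notation Lle := (Lp_le mu p).
Implicit Types (u v f w : ts -> R).

Lemma at_weak_der_le (F : (ts -> R) -> \bar R) D v (K : R) :
  (at_weak_der F D v <= K%:E)%E -> exists2 w, weak_der D v w & (F w <= K%:E)%E.
Proof.
rewrite /at_weak_der; case: asboolP => [ex FK|_]; last by rewrite leye_eq.
by exists (get (weak_der D v)) => //; exact: getPex ex.
Qed.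

Lemma at_weak_der_ge0 (F : (ts -> R) -> \bar R) D v :
  (forall w, 0 <= F w)%E -> (0 <= at_weak_der F D v)%E.
Proof. by move=> F0; rewrite /at_weak_der; case: ifP. Qed.

Lemma Sobolev_norm_ge0 m v : (0 <= Sobolev_norm B d p m v)%E.
Proof.
suff H : forall n m, (m <= n)%N -> forall v, (0 <= Sobolev_norm B d p m v)%E.
  exact: (H m m (leqnn m) v).
elim=> [|n IH] [|{}m] mn {}v; rewrite ?Lnorm_ge0//; try exact: Lnorm_ge0.
case: m mn => [|m] mn /=.
  rewrite !adde_ge0 ?Lnorm_ge0 ?poweR_ge0//.
  by apply: sume_ge0 => k _; apply: at_weak_der_ge0 => w; exact: Lnorm_ge0.
apply: adde_ge0; first apply: adde_ge0.
- exact: Lnorm_ge0.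
- by apply: sume_ge0 => k _; apply: at_weak_der_ge0 => w; exact: (IH m.+1 mn).
- by apply: at_weak_der_ge0 => w; exact: (IH m (ltnW mn)).
Qed.

Lemma seminormY_le (K : R) v h : 0 <= K -> measurable_fun [set: mts] v ->
  (seminormY B p v <= K%:E)%E -> 0 < h <= 1 ->
  Lle (2 * (h `^ 2^-1) * K) (fun z => v (flowY B h z) - v z).
Proof.
move=> K0 mv vK h01; have p0 : 0 < p by exact: lt_le_trans ltr01 p1.
apply: (@Lp_le_fractional_gt0 _ mts R mu p p1 (flowY B)) => //.
- exact: (flowY0 B0 br).
- exact: (flowYD B0 br).
- exact: (flow_preserving B0 br bmono).
- exact: (measurable_flowY B0 br measurable_fst measurable_snd).
move: vK; rewrite /seminormY; set I := integral _ _ _ => vK.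
have I0 : (0 <= I)%E.
  apply: integral_ge0 => z _; apply: integral_ge0 => k _; rewrite lee_fin.
  by rewrite divr_ge0// powR_ge0.
rewrite -[X in (X <= _)%E]poweRe1// -(mulVf (lt0r_neq0 p0)) poweRrM.
rewrite -poweR_EFin; apply: gt0_ler_poweR => //; first exact: ltW.
- by rewrite in_itv/= poweR_ge0 leey.
- by rewrite in_itv/= lee_fin K0 leey.
Qed.

(** The seminorm only sees |h| <= 1. If |h| > 1 then del >= 1, and twice the L^p norm suffices. A
    negative h is reduced to -h by invariance. *)
Lemma Lle_flow_seminormY (K : R) v f h del : 0 <= K -> measurable_fun [set: mts] v -> smooth f ->
  {ae mu, forall z : mts, v z = f z} -> Lle K f -> (seminormY B p v <= K%:E)%E ->
  0 <= del -> `|h| <= del ^+ 2 -> Lle (2 * K * del) (fun z => f (flowY B h z) - f z).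
Proof.
move=> K0 mv sf vf fK vK d0.
have sE (k : R) : 0 < k -> k <= del ^+ 2 -> k `^ 2^-1 <= del.
  move=> k0 kd; rewrite powR12_sqrt ?(ltW k0)//.
  by rewrite -[leRHS](ger0_norm d0) -sqrtr_sqr ler_sqrt// exprn_ge0.
have pos k : 0 < k <= 1 -> k <= del ^+ 2 -> Lle (2 * K * del) (fun z => f (flowY B k z) - f z).
  move=> /andP[k0 k1] kd.
  have vk := seminormY_le K0 mv vK (h := k); rewrite k0 k1 in vk; have {}vk := vk isT.
  apply: (@Lp_leW _ _ _ _ _ (2 * (k `^ 2^-1) * K)).
    by rewrite mulrAC ler_wpM2l ?mulr_ge0// sE.
  apply: (Lp_le_ae p1 _ _ vk).
    apply: measurable_funB; last exact: smooth_measurable.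
    exact: (measurable_joint sf (flow_preserving B0 br bmono k).1).
  have vfk : {ae mu, forall z : mts, v (flowY B k z) = f (flowY B k z)}.
    have [A [mA A0 vA]] := vf; have [mF muF] := flow_preserving B0 br bmono k.
    exists (flowY B k @^-1` A); split.
    - by rewrite -[X in measurable X]setTI; exact: mF.
    - by rewrite muF.
    - by move=> z /= zn; exact: vA.
  by apply: filterS2 vf vfk => z -> ->.
have [->|h0] := eqVneq h 0.
  move=> _; apply: (@Lp_leW _ _ _ _ _ 0); first by rewrite !mulr_ge0.
  apply: eq_Lle (Lp_le0 mu p1) => z.
  by rewrite (flowY0 B0 br) subrr.
have [h1|h1] := leP `|h| 1; last first.
  move=> hd; apply: (@Lp_leW _ _ _ _ _ (K + K)); last first.
    exact: (Lp_leB p1 (Lle_flow B0 br bmono p1 h fK) fK).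
  have d1 : 1 <= del.
    by rewrite -(@ler_pXn2r _ 2)// ?nnegrE// expr1n ltW// (lt_le_trans h1).
  have -> : K + K = 2 * K * 1 by ring.
  by rewrite ler_wpM2l// mulr_ge0.
have [hp|hn|hz] := ltgtP h 0.
- rewrite ltr0_norm// in h1 *; move=> hd.
  have Nh : 0 < - h <= 1 by rewrite oppr_gt0 hp.
  have := Lp_leN p1 (Lle_flow B0 br bmono p1 h (pos _ Nh hd)).
  apply: eq_Lle => z.
  by rewrite -(flowYD B0 br) addNr (flowY0 B0 br) opprB.
- by rewrite gtr0_norm// in h1 * => hd; apply: pos => //; rewrite hn.
- by rewrite hz eqxx in h0.
Qed.

Lemma sum3_le (a c K : \bar R) (F : 'I_N -> \bar R) :
  (0 <= a -> (forall k, 0 <= F k) -> 0 <= c -> a + \sum_(k < N | (k < d)%N) F k + c <= K ->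
  [/\ a <= K, (forall k : 'I_N, (k < d)%N -> F k <= K) & c <= K])%E.
Proof.
move=> a0 F0 c0 H.
have S0 : (0 <= \sum_(k < N | (k < d)%N) F k)%E by apply: sume_ge0 => k _; exact: F0.
split.
- by apply: le_trans H; rewrite -addeA leeDl// adde_ge0.
- move=> k kd; apply: le_trans H; rewrite (bigD1 k)//= addeAC addeCA leeDl//.
  by apply: adde_ge0; [exact: adde_ge0|apply: sume_ge0 => l _; exact: F0].
- by apply: le_trans H; rewrite leeDr// adde_ge0.
Qed.

(** The induction runs over a representative v of f and its chosen weak derivatives, which are
    identified at each level with the classical derivatives of f. The factor 2 is that of
    [Lle_flow_seminormY]. *)
Lemma Wle_Sobolev m v f (K : R) : measurable_fun [set: mts] v -> smooth f ->
  {ae mu, forall z : mts, v z = f z} -> (Sobolev_norm B d p m v <= K%:E)%E ->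
  Wle B b p m (2 * K) f.
Proof.
suff H : forall n m, (m <= n)%N -> forall v f, measurable_fun [set: mts] v -> smooth f ->
    {ae mu, forall z : mts, v z = f z} -> (Sobolev_norm B d p m v <= K%:E)%E ->
    Wle B b p m (2 * K) f by exact: (H m m (leqnn m) v f).
have Lf v' f' : measurable_fun [set: mts] v' -> smooth f' ->
    {ae mu, forall z : mts, v' z = f' z} -> (Lp_norm p v' <= K%:E)%E -> Lle K f'.
  move=> mv sf vf vK; apply: (Lp_le_ae p1 _ vf); first exact: smooth_measurable.
  by split.
have LW g : Lle K g -> Lle (2 * K) g.
  move=> gK; have K0 := Lp_le_ge0 gK; apply: Lp_leW gK.
  by rewrite ler_peMl ?ler1n.
have pE k v' w' f' : smooth f' -> {ae mu, forall z : mts, v' z = f' z} ->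
    weak_der (partial (Some k)) v' w' -> {ae mu, forall z : mts, w' z = partial (Some k) f' z}.
  move=> sf; rewrite -pdir_delta_fun; apply: weak_der_ae sf; first exact: generates_tr.
  by move=> h; exact: (tr_preserving B0 br bmono).
elim=> [|n IH] [|{}m] mn {}v {}f mv sf vf //.
- by move=> vK; apply: LW; exact: (Lf v).
- by move=> vK; apply: LW; exact: (Lf v).
case: m mn => [|m] mn vK.
  have [v1 v2 v3] := sum3_le (Lnorm_ge0 _ _ _)
    (fun k => at_weak_der_ge0 _ _ (fun w => Lnorm_ge0 _ _ _)) (poweR_ge0 _ _) vK.
  have fK := Lf v f mv sf vf v1.
  split; first exact: LW.
    move=> k bk; apply: LW; have [w [vw lw ww] wK] := at_weak_der_le (v2 k (bd bk)).
    apply: (Lf w) => //; first exact: lw.1.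
      exact: smooth_partial.
    by apply: (pE k v w f).
  move=> h del d0 hd; apply: (Lle_flow_seminormY (v := v)) => //.
  exact: Lp_le_ge0 fK.
have [v1 v2 v3] := sum3_le (Lnorm_ge0 _ _ _)
  (fun k => at_weak_der_ge0 _ _ (Sobolev_norm_ge0 m.+1)) (at_weak_der_ge0 _ _ (Sobolev_norm_ge0 m)) vK.
split; first by apply: LW; exact: (Lf v).
  move=> k bk; have [w vw wK] := at_weak_der_le (v2 k (bd bk)).
  apply: (IH m.+1 mn w) => //.
  - by have [_ []] := vw.
  - exact: smooth_partial.
  - exact: (pE k v w f).
have [w vw wK] := at_weak_der_le v3.
apply: (IH m (ltnW mn) w) => //.
- by have [_ []] := vw.
- exact: smooth_derY.
apply: (weak_der_ae (generates_flow B0 br) (flow_preserving B0 br bmono) sf vf vw).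
Qed.

End Sobolev_Wle.

(** * The Taylor polynomial in coordinates *)

Section multi_index.
Context (N M : nat) (V : nmodType).
Local Notation idx := {ffun 'I_N -> 'I_M.+1}.
Implicit Types (l : seq 'I_N) (beta : idx).

Definition supported l beta := [forall i, (i \notin l) ==> (beta i == ord0)].

Definition update beta a (j : 'I_M.+1) : idx := [ffun i => if i == a then j else beta i].

Lemma supported0 l beta i : supported l beta -> i \notin l -> beta i = ord0.
Proof. by move=> /forallP/(_ i)/implyP H /H /eqP. Qed.

(** A multi-index supported in a :: l amounts to its entry at a together with the multi-index,
    supported in l, in which that entry is reset to 0. *)
Lemma sum_supported_cons a l (Q : pred idx) (G : idx -> V) : a \notin l ->
  \sum_(beta | supported (a :: l) beta && Q beta) G beta =
  \sum_(j < M.+1) \sum_(beta | supported l beta && Q (update beta a j)) G (update beta a j).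
Proof.
move=> al; rewrite pair_big_dep/=.
rewrite (reindex_onto (fun x : 'I_M.+1 * idx => update x.2 a x.1)
  (fun beta => (beta a, update beta a ord0)))/=; last first.
  move=> beta /andP[sb _]; apply/ffunP => i; rewrite !ffunE.
  by case: eqVneq => [->//|ia].
apply: eq_bigl => -[j beta] /=.
apply/andP/andP => [[/andP[sb Qb] /eqP[_ E]]|[sb Qb]].
  split=> //; apply/forallP => i; apply/implyP => il.
  have [->|ia] := eqVneq i a; first by rewrite -E !ffunE eqxx.
  have := supported0 sb (i := i); rewrite inE negb_or ia il !ffunE (negbTE ia).
  by move=> /(_ isT) ->.
split.
  rewrite Qb andbT; apply/forallP => i; apply/implyP; rewrite inE negb_or => /andP[ia il].
  by rewrite ffunE (negbTE ia) (supported0 sb il).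
rewrite ffunE eqxx; apply/eqP; congr pair; apply/ffunP => i; rewrite !ffunE.
by case: eqVneq => // ->; rewrite (supported0 sb al).
Qed.

End multi_index.

Section multi_Taylor_sum.
Context (R : realType) (N : nat) (B : 'M[R]_N) (b : 'I_N -> nat) (n : nat).
Local Notation ts := (timespace R N).
Local Notation idx := {ffun 'I_N -> 'I_n.+1}.

(** The order m decreases along the recursion while the range of the exponents stays [n.+1]. The
    list is reversed because [multi_Taylor] applies the derivative of the head first and [foldr]
    applies it last. *)
Lemma multi_TaylorE l m h (xi : 'cV[R]_N) f (z : ts) : uniq l -> (m <= n.+1)%N ->
  multi_Taylor B b l m h xi f z = \sum_(k < n.+1) \sum_(beta : idx |
      supported l beta && (2 * k + \sum_i (2 * b i + 1) * beta i < m)%N)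
    exp_coef k h * (\prod_i exp_coef (beta i) (xi i ord0)) *
    iter k (derY B) (foldr (fun i => iter (beta i) (partial (Some i))) f (rev l)) z.
Proof.
elim: l m f => [|a l IH] m f /= ul mn.
  rewrite /Taylor_flow (big_ord_widen_cond n.+1 (fun k => 2 * k < m)%N
    (fun k => exp_coef k h * iter k (derY B) f z))// big_mkcond; apply: eq_bigr => k _.
  pose b0 : idx := [ffun=> ord0].
  have s0 : supported [::] b0 by apply/forallP => i; rewrite ffunE eqxx implybT.
  have E0 : (\sum_i (2 * b i + 1) * b0 i)%N = 0%N.
    by rewrite big1// => i _; rewrite ffunE muln0.
  have Eb beta : supported [::] beta -> beta = b0.
    by move=> sb; apply/ffunP => i; rewrite ffunE (supported0 sb).
  case: ifPn => km.
    rewrite (big_pred1 b0) => [|beta]; last first.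
      apply/andP/eqP => [[/Eb//]|->]; split=> //.
      by rewrite E0 addn0; case/andP: km.
    rewrite big1 ?mulr1// => i _; rewrite ffunE.
    by rewrite /exp_coef expr0 fact0 divr1.
  rewrite big1// => beta /andP[/Eb -> ]; rewrite E0 addn0 => k2.
  by case/negP: km; apply/andP; split=> //; lia.
have {ul}[al ul] := andP ul; set q := (2 * b a + 1)%N.
under [RHS]eq_bigr do rewrite sum_supported_cons//.
rewrite [RHS]exchange_big/=.
rewrite (big_ord_widen_cond n.+1 (fun j => q * j < m)%N
    (fun j => exp_coef j (xi a ord0) * multi_Taylor B b l (m - q * j) h xi
      (iter j (partial (Some a)) f) z))// big_mkcond; apply: eq_bigr => j _.
have W (beta : idx) : supported l beta ->
    (\sum_i (2 * b i + 1) * update beta a j i = \sum_i (2 * b i + 1) * beta i + q * j)%N.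
  move=> sb; rewrite (bigD1 a)//= [in RHS](bigD1 a)//= (supported0 sb al) muln0 add0n.
  rewrite ffunE eqxx addnC; congr (_ + _)%N; apply: eq_bigr => i ia.
  by rewrite ffunE (negbTE ia).
case: ifPn => jm; last first.
  rewrite big1// => k _; rewrite big1// => beta /andP[sb]; rewrite W// => H.
  by case/negP: jm; apply/andP; split; lia.
rewrite (IH (m - q * j)%N)//; last by rewrite leq_subLR (leq_trans mn)// leq_addl.
rewrite mulr_sumr; apply: eq_bigr => k _; rewrite mulr_sumr.
apply: eq_big => [beta|beta /andP[sb _]].
  case sb : (supported l beta) => //=; rewrite W//.
  by rewrite ltn_subRL addnC addnA.
have -> : foldr (fun i => iter (update beta a j i) (partial (Some i))) f (rev (a :: l)) =
    foldr (fun i => iter (beta i) (partial (Some i))) (iter j (partial (Some a)) f) (rev l).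
  rewrite rev_cons foldr_rcons ffunE eqxx.
  have : {in rev l, forall i, i != a}.
    by move=> i; rewrite mem_rev => il; apply: contraNneq al => <-.
  elim: (rev l) => //= i s IHs Hs; rewrite IHs.
    by rewrite ffunE (negbTE (Hs i _))// inE eqxx.
  by move=> i' si'; apply: Hs; rewrite inE si' orbT.
have -> : \prod_i exp_coef (update beta a j i) (xi i ord0) =
    exp_coef j (xi a ord0) * \prod_i exp_coef (beta i) (xi i ord0).
  rewrite (bigD1 a)//= [in RHS](bigD1 a)//= (supported0 sb al).
  rewrite [exp_coef ord0 _](_ : _ = 1) ?mul1r; last by rewrite /exp_coef expr0 fact0 divr1.
  by rewrite ffunE eqxx; congr (_ * _); apply: eq_bigr => i ia; rewrite ffunE (negbTE ia).
by move: (exp_coef j _) (exp_coef k h) => x1 x2; rewrite !mulrA [x2 * x1]mulrC.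
Qed.

End multi_Taylor_sum.

Lemma mulmx_row_id (R : pzRingType) n (A : 'M[R]_n) (y : 'cV[R]_n) k :
  (forall l, A k l = (k == l)%:R) -> (A *m y) k ord0 = y k ord0.
Proof.
move=> Ak; rewrite mxE (bigD1 k)//= big1 ?addr0 => [|l lk]; rewrite Ak ?eqxx ?mul1r//.
by rewrite eq_sym (negbTE lk) mul0r.
Qed.

Lemma sum_delta_rev_enum (R : pzRingType) n (xi : 'cV[R]_n) :
  \sum_(k <- rev (enum 'I_n)) xi k ord0 *: delta_mx k ord0 = xi.
Proof.
apply/colP => k; rewrite summxE (perm_big (enum 'I_n)) ?perm_rev//= big_enum/= (bigD1 k)//=.
rewrite big1 ?addr0; first by rewrite !mxE !eqxx mulr1.
by move=> l lk; rewrite !mxE eq_sym (negbTE lk) mulr0.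
Qed.

(** * The blocks of B, their right inverses and the homogeneous norm *)

Section block_structure.
Context (R : realType) (r : nat) (d : 'I_r.+1 -> nat).
Local Notation N := (\sum_i d i)%N.
Variable B : 'M[R]_N.
Hypothesis hB : block_assumption B.

Definition block_index (k : 'I_N) : nat := tagnat.sig1 k.
Local Notation b := block_index.

Lemma block_indexP k l : b k != (b l).+1 -> B k l = 0.
Proof.
move=> kl; have [_ _ H _] := hB; have := H _ _ kl => /matrixP/(_ (tagnat.sig2 k) (tagnat.sig2 l)).
by rewrite !mxE !tagnat.sig2K.
Qed.

Lemma block_index_le k : (b k <= r)%N.
Proof. by rewrite -ltnS /b. Qed.

Lemma block_index_lt k l : (b k < b l)%N -> (k < l)%N.
Proof.
apply: contraTT; rewrite -!leqNgt => lk.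
exact: (tagnat.le_sig1 lk).
Qed.

Lemma block_index0 k : b k = 0%N -> (k < d ord0)%N.
Proof.
move=> k0; rewrite -(tagnat.sigK k) tagnat.rankEsum big1 ?add0n; last first.
  by move=> i; rewrite -/(tagnat.sig1 k) -/(b k) k0.
have E : tagnat.sig1 k = ord0 by exact: val_inj.
by have := ltn_ord (tagnat.sig2 k); rewrite {2}E.
Qed.

(** The block in row i and column i + 1 is a pseudo-inverse of the block of B in row i + 1 and
    column i; since the latter has full row rank, it is a right inverse. *)
Definition block_pinv : 'M[R]_N :=
  mxblock (fun i j : 'I_r.+1 => if j == i.+1 :> nat then pinvmx (submxblock B j i) else 0).

Lemma block_pinvP l k : b k != (b l).+1 -> block_pinv l k = 0.
Proof. by move=> kl; rewrite mxE (negbTE kl) mxE. Qed.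

Lemma mul_block_pinv (y : 'cV[R]_N) k : (0 < b k)%N -> (B *m (block_pinv *m y)) k ord0 = y k ord0.
Proof.
move=> k0; rewrite mulmxA; have [_ _ H0 Hrank] := hB.
(* In row block i > 0 of B only the block in column i - 1 can be nonzero, and row block i - 1 of
   [block_pinv] contains only its right inverse, in column i. The inner indices are compared as
   naturals because their types agree only once [i = c]. *)
have H (i c : 'I_r.+1) : (0 < i)%N -> submxblock (B *m block_pinv) i c =
    \matrix_(a < d i, e < d c) ((i == c) && (a == e :> nat))%:R.
  move=> i0; have ir : (i.-1 < r.+1)%N by apply: leq_ltn_trans (leq_pred _) (ltn_ord i).
  pose j := Ordinal ir; have ij : i = j.+1 :> nat by rewrite /= prednK.
  have -> : B *m block_pinv = mxblock (fun i c => \sum_j submxblock B i j *m submxblock block_pinv j c).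
    by rewrite -{1}(submxblockK B) -{1}(submxblockK block_pinv) mul_mxblock.
  rewrite mxblockK (bigD1 j)//= big1 ?addr0; last first.
    move=> j' jj'; rewrite H0 ?mul0mx//; apply: contraNneq jj' => ij'.
    by apply/eqP/val_inj/succn_inj; rewrite -ij -ij'.
  rewrite mxblockK; have [<-|ic] := eqVneq i c.
    rewrite ij eqxx mulmxVp; first by apply/matrixP => a e; rewrite !mxE.
    by rewrite /row_free Hrank.
  rewrite ifN ?mulmx0; last by apply: contraNneq ic => cj; apply/eqP/val_inj; exact: etrans ij (esym cj).
  by apply/matrixP => a e; rewrite !mxE.
apply: mulmx_row_id => l.
have := H (tagnat.sig1 k) (tagnat.sig1 l) k0 => /matrixP/(_ (tagnat.sig2 k) (tagnat.sig2 l)).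
by rewrite [X in X = _ -> _]mxE [X in _ = X -> _]mxE -tagnat.eq_Rank !tagnat.sig2K val_eqE.
Qed.

Lemma weightE (beta : 'I_N -> nat) : weight (d := d) beta = (\sum_k (2 * b k + 1) * beta k)%N.
Proof.
rewrite /weight (partition_big (@tagnat.sig1 _ d) xpredT)//=; apply: eq_bigr => i _.
by rewrite big_distrr/=; apply: eq_bigr => k /eqP <-.
Qed.

Lemma homogeneous_norm_ge0 (zeta : timespace R N) : 0 <= homogeneous_norm zeta.
Proof. by rewrite addr_ge0 ?powR_ge0//; apply: sumr_ge0 => i _; exact: powR_ge0. Qed.

Lemma homogeneous_norm_time (zeta : timespace R N) : `|zeta.1| <= homogeneous_norm zeta ^+ 2.
Proof.
rewrite -[leLHS]powRr1// -[X in _ `^ X](_ : 1 / 2 * 2%:R = 1); last by rewrite mul1r mulVf.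
rewrite powRrM powR_mulrn ?powR_ge0//.
rewrite lerXn2r ?nnegrE ?powR_ge0 ?homogeneous_norm_ge0//.
by rewrite lerDl; apply: sumr_ge0 => i _; exact: powR_ge0.
Qed.

Lemma homogeneous_norm_space (zeta : timespace R N) k :
  `|zeta.2 k ord0| <= homogeneous_norm zeta ^+ (2 * b k + 1).
Proof.
set i := tagnat.sig1 k.
have H : `|zeta.2 k ord0| <= euclid_norm (block_part i zeta.2).
  rewrite -sqrtr_sqr ler_wsqrtr// (bigD1 k)//= mxE eqxx lerDl.
  by apply: sumr_ge0 => j _; exact: sqr_ge0.
apply: le_trans H _; set e := euclid_norm _; have e0 : 0 <= e by exact: sqrtr_ge0.
have q0 : (2 * i + 1)%N%:R != 0 :> R by rewrite pnatr_eq0 addn1.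
rewrite -[leLHS]powRr1// -[X in _ `^ X](_ : 1 / (2 * i + 1)%N%:R * (2 * i + 1)%N%:R = 1); last first.
  by rewrite mul1r mulVf.
rewrite powRrM powR_mulrn ?powR_ge0//.
rewrite lerXn2r ?nnegrE ?powR_ge0 ?homogeneous_norm_ge0//.
pose F (i : 'I_r.+1) := euclid_norm (block_part i zeta.2) `^ (1 / (2 * i + 1)%N%:R).
have F0 j : 0 <= F j by exact: powR_ge0.
have Fi : F i <= \sum_j F j by rewrite [leRHS](bigD1 i)//= lerDl sumr_ge0.
by apply: le_trans Fi _; rewrite /homogeneous_norm lerDr powR_ge0.
Qed.

(** h and xi are the increments in which the polynomial around w is written. The order is [n.+1]
    because [multi_Taylor] keeps the degrees strictly below its order, and reversing the enumeration
    restores the order of differentiation of [partial_multi]. *)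
Lemma TaylorE n u (w : timespace R N) h xi z :
  z = tr xi (flowY B h w) ->
  Taylor B n u w z = multi_Taylor B b (rev (enum 'I_N)) n.+1 h xi u w.
Proof.
move=> zE; rewrite (@multi_TaylorE R N B b n)//; last by rewrite rev_uniq enum_uniq.
rewrite /Taylor; apply: eq_bigr => k _; apply: eq_big => beta.
  rewrite weightE ltnS; case: (_ <= n)%N; rewrite ?andbF//= andbT.
  by apply/esym/forallP => i; rewrite mem_rev mem_enum.
move=> _; have -> : z.1 - w.1 = h by rewrite zE /= addrAC subrr add0r.
have -> : z.2 - expmx (h *: B) *m w.2 = xi by rewrite zE /= addrAC subrr add0r.
rewrite revK; congr (_ * _); rewrite /exp_coef prodf_div natrM natr_prod.
by rewrite invfM mulrACA.
Qed.

End block_structure.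
Theorem theorem4p1 (R : realType) (r : nat) (d : 'I_r.+1 -> nat)
    (B : 'M[R]_(\sum_i d i)%N) (hB : block_assumption B)
    (n : nat) (p : R) (hp : 1 <= p) :
  exists c : R, forall u : timespace R (\sum_i d i)%N -> R,
    in_Sobolev B (d ord0) p n.+1 u -> smooth u ->
    forall zeta : timespace R (\sum_i d i)%N,
      (Lp_norm p (fun z => (u z - Taylor B n u (group_law B z zeta) z)%R) <=
       (c * homogeneous_norm zeta ^+ n.+1)%R%:E *
         Sobolev_norm B (d ord0) p n.+1 u)%E.
Proof.
set N := (\sum_i d i)%N; set b := @block_index r d.
have B0 := block_indexP hB; have br := @block_index_le r d.
have bmono := @block_index_lt r d; have bd := @block_index0 r d.
pose mu := lebesgue_space_sf R N.
have [C C0 HC] := multi_Taylor_le B0 br bmono (block_pinvP B) (mul_block_pinv hB) hp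
  (rev (enum 'I_N)) n.+1.
(* [xi] is minus e^{hB} applied to the space part of zeta, so its coordinates in block i are at most
   [Ce * nu ^+ (2 * i + 1)]. As [L >= 1], this is below [(L * nu) ^+ (2 * i + 1)], whence the choice
   [del = L * nu] below. *)
have [Ce Ce0 eM] := expmx_aniso B0 br; pose L := Ce + 1.
have L1 : 1 <= L by rewrite lerDr.
(* [L ^+ n.+1] comes from [del = L * nu], and 2 from the passage from the Sobolev norm to [Wle]. *)
exists (C * L ^+ n.+1 * 2) => u [_ uoo] su zeta; set nu := homogeneous_norm zeta.
have nu0 : 0 <= nu by exact: homogeneous_norm_ge0.
pose K := fine (Sobolev_norm B (d ord0) p n.+1 u).
have uK : Sobolev_norm B (d ord0) p n.+1 u = K%:E.
  by rewrite /K fineK// ge0_fin_numE//; exact: Sobolev_norm_ge0.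
have uW : Wle B b p n.+1 (2 * K) u.
  apply: (Wle_Sobolev (v := u) B0 br bmono bd hp) => //.
  - exact: smooth_measurable.
  - exact: aeW.
  - by rewrite uK.
have K0 : 0 <= 2 * K := Wle_ge0 uW.
pose h := - zeta.1; pose xi : 'cV[R]_N := - (expmx (h *: B) *m zeta.2).
pose D z := u z - Taylor B n u (group_law B z zeta) z.
have zE z : z = tr xi (flowY B h (group_law B z zeta)).
  rewrite /tr /flowY /group_law /= addrK mulmxDr addrK mulmxA -(expmxD B0 br) addNr.
  by rewrite (expmx0B B0 br) mul1mx; case: z.
have main del : 0 < del -> L * nu <= del -> Lp_le mu p (C * del ^+ n.+1 * (2 * K)) D.
  move=> d0 nud; have nud1 : nu <= del by apply: le_trans nud; rewrite ler_peMl.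
  have hd : `|h| <= del ^+ 2.
    rewrite normrN; apply: le_trans (homogeneous_norm_time zeta) _.
    by rewrite lerXn2r// nnegrE// ltW.
  have xid k : `|xi k ord0| <= del ^+ (2 * b k + 1).
    rewrite mxE normrN.
    have hnu : `|h| <= nu ^+ 2 by rewrite normrN; exact: homogeneous_norm_time.
    have znu : aniso b 1 nu zeta.2 by move=> l; rewrite mul1r; exact: homogeneous_norm_space.
    have := eM 1 nu h zeta.2 ler01 nu0 hnu znu k; rewrite mulr1 => H; apply: le_trans H _.
    apply: (@le_trans _ _ ((L * nu) ^+ (2 * b k + 1))).
      rewrite exprMn ler_wpM2r ?exprn_ge0// (@le_trans _ _ L)// ?lerDl//.
      by rewrite addn1 ler_eXnr.
    by rewrite lerXn2r ?nnegrE ?mulr_ge0// ?(ltW d0)// (le_trans ler01 L1).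
  have T := HC (2 * K) u h xi del su uW d0 hd xid.
  have mP : measure_preserving mu (fun z => group_law B z zeta).
    exact: (group_law_preserving B0 br bmono zeta).
  have := Lp_le_preserving hp mP T; apply: eq_Lle => z.
  by rewrite sum_delta_rev_enum /D (TaylorE _ _ (zE z)) -(zE z).
rewrite uK -EFinM; have [nup|nu_le0] := ltP 0 nu.
  have := (main (L * nu) (mulr_gt0 (lt_le_trans ltr01 L1) nup) (lexx _)).2.
  by congr (_ <= _%:E)%E; rewrite exprMn; ring.
have {}nu0 : nu = 0 by apply/eqP; rewrite eq_le nu_le0.
(* The estimate requires [del > 0]. When zeta has norm 0 every positive [del] is admissible, and
   letting it tend to 0 shows that the remainder has norm 0. *)
rewrite nu0 expr0n/= mulr0 mul0r; apply/lee_addgt0Pr => e e0; rewrite add0e.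
have CK0 : 0 <= C * (2 * K) by rewrite mulr_ge0.
(* The bound by 1 gives [del ^+ n.+1 <= del], and the other one keeps the product below [e]; the
   added 1 makes the denominator positive. *)
pose del := Num.min 1 (e / (C * (2 * K) + 1)).
have d0 : 0 < del by rewrite lt_min ltr01 divr_gt0// ltr_wpDl.
have dl : L * nu <= del by rewrite nu0 mulr0 ltW.
apply: le_trans (main del d0 dl).2 _; rewrite lee_fin.
apply: (@le_trans _ _ (del * (C * (2 * K) + 1))).
  rewrite mulrAC [leRHS]mulrC; apply: ler_pM => //.
  - by rewrite exprn_ge0// ltW.
  - by rewrite lerDl.
  - by apply: ler_iXnr => //; [exact: ltW|rewrite /del ge_min lexx].
by rewrite -ler_pdivlMr ?ltr_wpDl// /del ge_min lexx orbT.
Qed.
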